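(* Let $0<s<1<p$, $sp<3$, $1<q<p$, and $p^*_s=\frac{3p}{3-sp}$. Let $A:\mathbb{R}^3\to\mathbb{R}^3$ be a continuous vector field with locally bounded gradient. Let $H,K$ be nontrivial (not a.e. zero) real functions on $\mathbb{R}^3$ with $0\le H\in L^{r}(\mathbb{R}^3,\mathbb{R})$, $r=\frac{p^*_s}{p^*_s-q}$, and $0\le K\in L^\infty(\mathbb{R}^3,\mathbb{R})\cap C(\mathbb{R}^3,\mathbb{R})$. Assume also that there exists $\Omega_H\subset\mathbb{R}^3$ with $|\Omega_H|>0$ and $H>0$ in $\Omega_H$. Then there exists $\lambda_*>0$ such that for every $0<\lambda<\lambda_*$ the equation $$(-\Delta)^s_{p,A}u=\lambda H(x)|u|^{q-2}u+K(x)|u|^{p^*_s-2}u\quad\text{in }\mathbb{R}^3$$ admits a sequence $(u_k)_{k\in\mathbb{N}}$ of (pairwise distinct) nontrivial weak solutions in $D^{s,p}_A(\mathbb{R}^3,\mathbb{C})$ with negative energy, i.e. $\mathcal{E}(u_k)<0$ for all $k$.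
   Context: For measurable $u:\mathbb{R}^3\to\mathbb{C}$ set $$[u]_{A,s,p}=\Big(\int_{\mathbb{R}^3\times\mathbb{R}^3}\frac{|e^{-i(x-y)\cdot A(\frac{x+y}{2})}u(x)-u(y)|^p}{|x-y|^{3+sp}}\,dx\,dy\Big)^{1/p}.$$ $D^{s,p}_A(\mathbb{R}^3,\mathbb{C})=\{u\in L^{p^*_s}(\mathbb{R}^3,\mathbb{C}):[u]_{A,s,p}<\infty\}$, a real Banach space with norm $[\cdot]_{A,s,p}$. The fractional magnetic $p$-Laplacian (constant normalized to $1$) is formally $$(-\Delta)^s_{p,A}u(x)=\lim_{\varepsilon\searrow0}\int_{\{|y-x|\ge\varepsilon\}}\frac{|u(x)-e^{i(x-y)\cdot A(\frac{x+y}{2})}u(y)|^{p-2}\big(u(x)-e^{i(x-y)\cdot A(\frac{x+y}{2})}u(y)\big)}{|x-y|^{3+sp}}\,dy.$$ The energy functional $\mathcal{E}:D^{s,p}_A(\mathbb{R}^3,\mathbb{C})\to\mathbb{R}$ is $$\mathcal{E}(u)=\frac1p[u]^p_{A,s,p}-\frac{\lambda}{q}\int_{\mathbb{R}^3}H|u|^q\,dx-\frac1{p^*_s}\int_{\mathbb{R}^3}K|u|^{p^*_s}\,dx .$$ Weak solutions are the critical points of $\mathcal{E}$: $u\in D^{s,p}_A(\mathbb{R}^3,\mathbb{C})$ is a weak solution if for all $v\in D^{s,p}_A(\mathbb{R}^3,\mathbb{C})$ $$\Re\int_{\mathbb{R}^3\times\mathbb{R}^3}\frac{|U|^{p-2}U\,\overline{V}}{|x-y|^{3+sp}}\,dx\,dy=\Re\Big(\lambda\int_{\mathbb{R}^3}H|u|^{q-2}u\,\overline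 v\,dx+\int_{\mathbb{R}^3}K|u|^{p^*_s-2}u\,\overline v\,dx\Big),$$ where $U=e^{-i(x-y)\cdot A(\frac{x+y}{2})}u(x)-u(y)$ and $V=e^{-i(x-y)\cdot A(\frac{x+y}{2})}v(x)-v(y)$. *)

(* Defs.v *)
From HB Require Import structures.
From mathcomp Require Import all_boot all_order all_algebra.
From mathcomp Require Import all_classical all_reals all_analysis.
From mathcomp Require Import complex.
Set Implicit Arguments.
Unset Strict Implicit.
Unset Printing Implicit Defensive.
Import Order.TTheory GRing.Theory Num.Theory.
Import numFieldNormedType.Exports.

Local Open Scope classical_set_scope.
Local Open Scope ring_scope.

(* The product type carries the product topology and the product (hence Borel)
   sigma-algebra.  Its library norm is the maximum norm, whence [enorm] below. *)
Notation R3 R := (R * R * R)%type.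

(* The library declares products of sigma-finite measures as measures, but not
   as sigma-finite measures. *)
Lemma sigma_finite_prod d1 d2 (T1 : measurableType d1) (T2 : measurableType d2)
    (R : realType) (m1 : {sigma_finite_measure set T1 -> \bar R})
    (m2 : {sigma_finite_measure set T2 -> \bar R}) :
  sigma_finite setT (m1 \x m2)%E.
Proof.
have /sigma_finiteP[F [TF ndF Foo]] := sigma_finiteT m1.
have /sigma_finiteP[G [TG ndG Goo]] := sigma_finiteT m2.
exists (fun n => F n `*` G n).
  rewrite -setXTT TF TG predeqE => -[x y]; split.
    move=> [/= [n _ Fnx] [k _ Gky]]; exists (maxn n k) => //; split.
    - by move: x Fnx; exact/subsetPset/ndF/leq_maxl.
    - by move: y Gky; exact/subsetPset/ndG/leq_maxr.
  by move=> [n _ []/= ? ?]; split; exists n.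
move=> k; have [? ?] := Foo k; have [? ?] := Goo k.
split; first exact: measurableX.
by rewrite product_measure1E// lte_mul_pinfty// ge0_fin_numE.
Qed.

Section Magnetic.
Variable R : realType.
Local Notation Re := (@complex.Re R).
Local Notation Im := (@complex.Im R).
Implicit Types (x y v : R3 R) (A : R3 R -> R3 R) (u w : R3 R -> R[i]).

(* [lebesgue_measure] lives on the alias [measurableTypeR R] of R, whose
   sigma-algebra is that of R but has another display. *)
Definition leb1 : set R -> \bar R := @lebesgue_measure R.

HB.instance Definition _ := isMeasure.Build _ R R leb1
  (measure0 (@lebesgue_measure R)) (measure_ge0 (@lebesgue_measure R))
  (@measure_semi_sigma_additive _ _ _ (@lebesgue_measure R)).

HB.instance Definition _ := Measure_isSigmaFinite.Build _ R R leb1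
  (sigma_finiteT (@lebesgue_measure R)).

Definition leb2 : set (R * R) -> \bar R := (leb1 \x leb1)%E.

HB.instance Definition _ := Measure.copy leb2 (leb1 \x leb1)%E.

HB.instance Definition _ := Measure_isSigmaFinite.Build _ _ _ leb2
  (sigma_finite_prod leb1 leb1).

Definition leb3 : set (R3 R) -> \bar R := (leb2 \x leb1)%E.

HB.instance Definition _ := Measure.copy leb3 (leb2 \x leb1)%E.

HB.instance Definition _ := Measure_isSigmaFinite.Build _ _ _ leb3
  (sigma_finite_prod leb2 leb1).

Definition coord3 (i : 'I_3) x : R := [:: x.1.1; x.1.2; x.2]`_i.

Definition ebasis (i : 'I_3) : R3 R :=
  ((i == 0%N :> nat)%:R, (i == 1%N :> nat)%:R, (i == 2%N :> nat)%:R).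

Definition dot x y : R := \sum_(i < 3) coord3 i x * coord3 i y.

Definition enorm x : R := Num.sqrt (dot x x).

Definition iter_derive (f : R3 R -> R) (vs : seq (R3 R)) : R3 R -> R :=
  foldr (fun v g x => 'D_v g x) f vs.

(* C^infinity functions with compact support *)
Definition test_function (f : R3 R -> R) : Prop :=
  (forall vs, continuous (iter_derive f vs) /\
     forall x v, derivable (iter_derive f vs) x v) /\
  compact (closure [set x | f x != 0]).

Definition locally_bounded (g : R3 R -> R) : Prop :=
  forall x, exists M : R, \forall y \near x, `|g y| <= M.

Definition weak_partial (f : R3 R -> R) (i : 'I_3) (g : R3 R -> R) : Prop :=
  forall phi, test_function phi ->
    \int[leb3]_x (f x * 'D_(ebasis i) phi x) = - \int[leb3]_x (g x * phi x).

(* The gradient is taken in the sense of distributions, so that no pointwise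
   differentiability of the (continuous) field A is required. *)
Definition locally_bounded_gradient A : Prop :=
  forall i j : 'I_3, exists g : R3 R -> R,
    [/\ measurable_fun setT g, locally_bounded g
      & weak_partial (coord3 i \o A) j g].

Definition cmeasurable d (T : measurableType d) (f : T -> R[i]) : Prop :=
  measurable_fun setT (Re \o f) /\ measurable_fun setT (Im \o f).

Definition cintegral d (T : measurableType d)
    (mu : {measure set T -> \bar R}) (f : T -> R[i]) : R[i] :=
  ((\int[mu]_z Re (f z))%R +i* (\int[mu]_z Im (f z))%R)%C.

Definition cmod (z : R[i]) : R := ComplexField.Normc.normc z.

(* e^(i t) *)
Definition cis (t : R) : R[i] := (cos t +i* sin t)%C.

(* |z|^(a-2) z; it vanishes at z = 0 whatever a, since 0 `^ t is 0 or 1. *)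
Definition cpow (a : R) (z : R[i]) : R[i] := ((cmod z `^ (a - 2))%:C)%C * z.

(* e^(-i (x - y) . A((x + y) / 2)) u(x) - u(y) *)
Definition mdiff A u (z : R3 R * R3 R) : R[i] :=
  cis (- dot (z.1 - z.2) (A (2^-1 *: (z.1 + z.2)))) * u z.1 - u z.2.

Definition seminorm A (s p : R) u : \bar R :=
  ((\int[(leb3 \x leb3)]_z
     (cmod (mdiff A u z) `^ p / enorm (z.1 - z.2) `^ (3 + s * p))%R%:E)
   `^ p^-1)%E.

Definition pstar (s p : R) : R := 3 * p / (3 - s * p).

Definition in_D A (s p : R) u : Prop :=
  [/\ cmeasurable u,
      (cmod \o u) \in Lfun leb3 (pstar s p)%:E
    & (seminorm A s p u < +oo)%E].

Definition energy A (s p q lam : R) (H K : R3 R -> R) u : R :=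
  p^-1 * fine (seminorm A s p u) `^ p
  - lam / q * \int[leb3]_x (H x * cmod (u x) `^ q)
  - (pstar s p)^-1 * \int[leb3]_x (K x * cmod (u x) `^ pstar s p).

Definition weak_solution A (s p q lam : R) (H K : R3 R -> R) u : Prop :=
  in_D A s p u /\
  forall v : R3 R -> R[i], in_D A s p v ->
    Re (cintegral (leb3 \x leb3)%E (fun z => (
      cpow p (mdiff A u z) * (mdiff A v z)^*
      / (enorm (z.1 - z.2) `^ (3 + s * p))%:C)%C))
    = Re
       ((lam%:C)%C
          * cintegral leb3 (fun x => (H x)%:C * cpow q (u x) * (v x)^*)%C
        + cintegral leb3
            (fun x => (K x)%:C * cpow (pstar s p) (u x) * (v x)^*)%C).

End Magnetic.

(* Main.v *)
(** The energy and the space are invariant under [u |-> c u] with [|c| = 1], so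
    one nontrivial critical point of negative energy yields infinitely many.
    Such a point is found by minimising on a ball [ [u]^p <= rho ].  For small
    [rho] and [lambda] the energy is nonnegative on the sphere, by the Sobolev
    inequality and [H in L^r], and, as [q < p], it is negative at small multiples
    of a tent function charged by [H]; hence a minimiser is interior and critical.

    The minimiser exists because a minimising sequence has a subsequence that
    converges a.e. to some [u]: the Gagliardo energy controls the distance of a
    function to its averages on dyadic cells.  The lack of compactness at the
    critical exponent [P = p^*_s] is harmless: on a small ball [int K |w|^P] is
    at most a small multiple of [ [w]^p ], which absorbs the crude constants with
    which Fatou's lemma (instead of the exact Brezis-Lieb splitting) compares
    [ [u_n]^p ] and [int K |u_n|^P] with their values at [u] and [u_n - u].  *)

Require Import Defs.
From mathcomp Require Import all_boot all_order all_algebra.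
From mathcomp Require Import all_classical all_reals all_analysis.
From mathcomp Require Import measurable_realfun ess_sup_inf.
From mathcomp Require Import complex.
From mathcomp Require Import ring lra.
Set Implicit Arguments.
Unset Strict Implicit.
Unset Printing Implicit Defensive.
Import Order.TTheory GRing.Theory Num.Theory.
Import numFieldNormedType.Exports.
Local Open Scope classical_set_scope.
Local Open Scope ring_scope.

(** * Powers of the complex modulus *)

(** Write [G] for the Gagliardo integral and [k] for [int K |.|^P]. For large [n] Fatou's lemma
    yields [G(u) + 2^-p G(u_n - u) <= G(u_n) + d] and [k(u_n) <= k(u) + 2^P k(u_n - u) + d]. The
    loss in the second must be paid for by the gain in the first, and this fixes the constant
    [smallness] through [P^-1 2^P smallness = p^-1 2^-p]. Differences of two points of the ball have
    energy up to [2^p (rho + rho)], so [rho] is chosen such that [k <= smallness * G] holds up to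
    that level.

    The magnetic phase has modulus one, so the Sobolev inequality sees only [|u|] and its constant
    does not depend on [A]. Compactness needs more, namely a limit of the complex values: ordinary
    differences are recovered from magnetic ones on bounded sets, where [A] is bounded.

    The sign of [H] and the bound on [K] are given almost everywhere only, so the variational
    argument runs with modified weights, and its result is transferred back at the end. *)

Section ComplexModulus.
Variable R : realType.
Implicit Types (z w : R[i]) (a t : R).

Lemma cmod_ge0 z : 0 <= cmod z.
Proof. by case: z => x y; exact: sqrtr_ge0. Qed.

Lemma cmodM z w : cmod (z * w) = cmod z * cmod w.
Proof. exact: ComplexField.Normc.normcM. Qed.

Lemma cmodD z w : cmod (z + w) <= cmod z + cmod w.
Proof. exact: le_normcD. Qed.

Lemma cmodN z : cmod (- z) = cmod z.
Proof. exact: normcN. Qed.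

Lemma cmodB z w : cmod (z - w) <= cmod z + cmod w.
Proof. by rewrite -(cmodN w); exact: cmodD. Qed.

Lemma cmodB_rev z w : cmod (z - w) >= cmod z - cmod w.
Proof. by rewrite lerBlDr -{1}(subrK w z); exact: cmodD. Qed.

Lemma cmod0 : cmod (0 : R[i]) = 0.
Proof. exact: ComplexField.Normc.normc0. Qed.

Lemma cmod_eq0 z : cmod z = 0 -> z = 0.
Proof. exact: ComplexField.Normc.eq0_normc. Qed.

Lemma cmod_real t : cmod (t%:C)%C = `|t|.
Proof. by rewrite /cmod /= expr0n addr0 sqrtr_sqr. Qed.

Lemma cmod_cis t : cmod (cis t) = 1.
Proof. by rewrite /cmod /= cos2Dsin2 sqrtr1. Qed.

Lemma cmod_Re z : `|complex.Re z| <= cmod z.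
Proof.
case: z => x y /=; rewrite /cmod /= -sqrtr_sqr ler_wsqrtr//.
by rewrite lerDl sqr_ge0.
Qed.

Lemma cmod_Im z : `|complex.Im z| <= cmod z.
Proof.
case: z => x y /=; rewrite /cmod /= -sqrtr_sqr ler_wsqrtr//.
by rewrite lerDr sqr_ge0.
Qed.

Lemma cmod_sqr z : cmod z ^+ 2 = complex.Re z ^+ 2 + complex.Im z ^+ 2.
Proof. by case: z => x y; rewrite /cmod /= sqr_sqrtr// addr_ge0// sqr_ge0. Qed.

Lemma cmodD_sqr z w : cmod (z + w) ^+ 2 =
  cmod z ^+ 2 + 2 * complex.Re (z * (w^*)%C) + cmod w ^+ 2.
Proof.
rewrite !cmod_sqr; case: z => x y; case: w => x' y' /=; ring.
Qed.

Lemma ReZ t z : complex.Re ((t%:C)%C * z) = t * complex.Re z.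
Proof. by case: z => x y /=; rewrite mul0r subr0. Qed.

Lemma powR_convex a x y t : 1 <= a -> 0 <= x -> 0 <= y -> 0 <= t -> t <= 1 ->
  ((1 - t) * x + t * y) `^ a <= (1 - t) * x `^ a + t * y `^ a.
Proof.
move=> a1 x0 y0 t0 t1.
have := @convex_powR R a a1 (Itv01 t0 t1) y x.
rewrite !inE /= !in_itv /= !andbT => /(_ y0 x0).
by rewrite [conv _ _ _]convRE convRE /= addrC [X in _ <= X -> _]addrC.
Qed.

Lemma cmod_powR_convex a z w t : 1 <= a -> 0 <= t -> t <= 1 ->
  cmod (((1 - t)%:C)%C * z + (t%:C)%C * w) `^ a
    <= (1 - t) * cmod z `^ a + t * cmod w `^ a.
Proof.
move=> a1 t0 t1; have a0 : 0 <= a by exact: le_trans a1.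
apply: le_trans (powR_convex a1 (cmod_ge0 z) (cmod_ge0 w) t0 t1).
apply: ge0_ler_powR => //; rewrite ?nnegrE ?cmod_ge0//.
  by rewrite addr_ge0// mulr_ge0// ?cmod_ge0// subr_ge0.
apply: le_trans (cmodD _ _) _.
by rewrite !cmodM !cmod_real !ger0_norm// subr_ge0.
Qed.

(** The sum is at most twice the maximum. The constant is not sharp, but it serves every
    [a >= 0]. *)
Lemma powRD_le a x y : 0 <= a -> 0 <= x -> 0 <= y ->
  (x + y) `^ a <= 2 `^ a * (x `^ a + y `^ a).
Proof.
move=> a0; wlog xy : x y / x <= y => [hw x0 y0|x0 y0].
  have [/hw|/ltW/hw h] := leP x y; first exact.
  by rewrite addrC [x `^ a + _]addrC; exact: h.
apply: (@le_trans _ _ ((2 * y) `^ a)).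
  apply: ge0_ler_powR => //; rewrite ?nnegrE ?addr_ge0 ?mulr_ge0//.
  by rewrite mulr_natl mulr2n lerD2r.
by rewrite powRM// ler_wpM2l ?powR_ge0// lerDr powR_ge0.
Qed.

Lemma cmodD_powR a z w : 0 <= a ->
  cmod (z + w) `^ a <= 2 `^ a * (cmod z `^ a + cmod w `^ a).
Proof.
move=> a0; apply: le_trans (powRD_le a0 (cmod_ge0 z) (cmod_ge0 w)).
by apply: ge0_ler_powR => //; rewrite ?nnegrE ?cmod_ge0 ?addr_ge0 ?cmod_ge0// cmodD.
Qed.

(* The difference quotients of [t |-> |z + t w|^a] at [0] are squeezed by
   convexity between those at [-1] and [1]. *)
Lemma cmod_powR_slope a z w t : 1 <= a -> 0 < t -> t <= 1 ->
  `|(cmod (z + (t%:C)%C * w) `^ a - cmod z `^ a) / t|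
     <= cmod (z + w) `^ a + cmod (z - w) `^ a + cmod z `^ a.
Proof.
move=> a1 t0 t1; rewrite ler_norml; apply/andP; split.
- rewrite ler_pdivlMr//.
  (* [z] is the convex combination of [z + t w] and [z - w] with weight [t / (1 + t)] on the latter;
     convexity there gives the lower bound. *)
  have t'0 : 0 <= t / (1 + t) by rewrite divr_ge0 ?ltW// addr_gt0.
  have t'1 : t / (1 + t) <= 1 by rewrite ler_pdivrMr ?addr_gt0// mul1r lerDr.
  have := cmod_powR_convex (z + (t%:C)%C * w) (z - w) a1 t'0 t'1.
  have -> : (((1 - t / (1 + t))%:C)%C * (z + (t%:C)%C * w)
      + (((t / (1 + t)))%:C)%C * (z - w)) = z.
    case: z w => x y [x' y'].
    have t10 : 1 + t != 0 by rewrite gt_eqF// addr_gt0.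
    by apply/eqP; rewrite eq_complex /=; apply/andP; split; apply/eqP; field.
  have -> : 1 - t / (1 + t) = (1 + t)^-1 by field; rewrite gt_eqF// addr_gt0.
  rewrite (mulrC t (1 + t)^-1) -mulrA -mulrDr ler_pdivlMl ?addr_gt0//.
  have := powR_ge0 (cmod (z + w)) a; have := powR_ge0 (cmod z) a.
  set X := cmod z `^ a; set Y := cmod (z + w) `^ a; set Z := cmod (z - w) `^ a.
  set W := cmod _ `^ a.
  by move=> X0 Y0 h; nra.
- rewrite ler_pdivrMr//.
  have := cmod_powR_convex z (z + w) a1 (ltW t0) t1.
  have -> : (((1 - t)%:C)%C * z + (t%:C)%C * (z + w)) = z + (t%:C)%C * w.
    case: z w => x y [x' y'].
    by apply/eqP; rewrite eq_complex /=; apply/andP; split; apply/eqP; ring.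
  have := powR_ge0 (cmod (z - w)) a; have := powR_ge0 (cmod z) a.
  set X := cmod z `^ a; set Y := cmod (z + w) `^ a; set Z := cmod (z - w) `^ a.
  set W := cmod _ `^ a.
  by move=> X0 Y0 h; nra.
Qed.

End ComplexModulus.

(** * Directional derivatives of powers of the modulus *)

Section Sequences.
Variable R : realType.

(** Directional derivatives are taken along the step sizes [harmonic n], because dominated
    convergence is applied to sequences. *)
Lemma harmonic_right : @harmonic R n @[n --> \oo] --> (0 : R)^'+.
Proof.
move=> U [e /= e0 eU]; have /cvgrPdist_lt/(_ e e0) := @cvg_harmonic R.
apply: filterS => n; rewrite sub0r normrN => ne.
by apply: eU; rewrite /= ?sub0r ?normrN//; exact: harmonic_gt0.
Qed.

(** For [z != 0] the square [|z + t w|^2] is a quadratic polynomial in [t], positive at [0], and the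
    chain rule applies to its power [a / 2]. For [z = 0] the quotient is [t^(a-1) |w|^a], which
    tends to [0] because [a > 1]. *)
Lemma cmod_powR_slope_cvg (a : R) (z w : R[i]) : 1 < a ->
  (cmod (z + ((harmonic n)%:C)%C * w) `^ a - cmod z `^ a) / harmonic n
    @[n --> \oo] --> a * complex.Re (cpow a z * (w^*)%C).
Proof.
move=> a1; have a0 : 0 < a by exact: lt_trans a1.
have [->|z0] := eqVneq z 0.
  rewrite /cpow mulr0 mul0r /= mulr0.
  have -> : (fun n => (cmod (0 + ((@harmonic R n)%:C)%C * w) `^ a - cmod 0 `^ a) / harmonic n)
     = (fun n => (harmonic n) `^ (a - 1) * cmod w `^ a).
    apply/funext => n; rewrite add0r cmod0 powR0 ?gt_eqF// subr0.
    rewrite cmodM cmod_real ger0_norm ?harmonic_ge0//.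
    rewrite powRM ?harmonic_ge0 ?cmod_ge0// mulrAC; congr (_ * _).
    rewrite powRB ?powRr1 ?harmonic_ge0//.
    by rewrite gt_eqF ?harmonic_gt0// implybT.
  rewrite -(mul0r (cmod w `^ a)); apply: cvgM; last exact: cvg_cst.
  have a10 : 0 < a - 1 by rewrite subr_gt0.
  exact: (cvg_comp _ _ harmonic_right (powR_cvg0 a10)).
have zm0 : 0 < cmod z.
  by rewrite lt_neqAle cmod_ge0 andbT eq_sym; apply/eqP => /cmod_eq0/eqP; rewrite (negbTE z0).
pose B := complex.Re (z * (w^*)%C).
pose g t : R := cmod z ^+ 2 + 2 * B * t + cmod w ^+ 2 * t ^+ 2.
have gE t : cmod (z + (t%:C)%C * w) ^+ 2 = g t.
  rewrite cmodD_sqr cmodM cmod_real exprMn real_normK ?num_real// /g /B.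
  case: (z) (w) => x y [x' y'] /=; ring.
have gpow t : cmod (z + (t%:C)%C * w) `^ a = g t `^ (a / 2).
  rewrite -gE -powR_mulrn ?cmod_ge0// -powRrM; congr (_ `^ _); by field.
have dg : is_derive (0 : R) 1 g (2 * B).
  rewrite /g; apply: is_derive_eq => //.
  by rewrite /GRing.scale /=; ring.
have g0 : 0 < g 0 by rewrite /g mulr0 expr0n mulr0 !addr0 exprn_gt0.
have := is_derive1_comp (is_derive1_powR (a / 2) g0) dg.
move=> [dd de]; move: dd; rewrite /derivable => dd.
have cc : (h^-1 *: (((powR (R:=R))^~ (a / 2) \o g) (h *: 1 + 0) - ((powR (R:=R))^~ (a / 2) \o g) 0)
    @[h --> (0:R)^'] --> a * complex.Re (cpow a z * (w^*)%C)).
  have -> : a * complex.Re (cpow a z * (w^*)%C) =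
    'D_1 ((powR (R:=R))^~ (a / 2) \o g) 0.
    rewrite de /cpow -mulrA ReZ -/B.
    rewrite {1}/g mulr0 expr0n mulr0 !addr0 -powR_mulrn ?cmod_ge0// -powRrM.
    have -> : 2%:R * (a / 2 - 1) = a - 2 by field.
    by field.
  exact: dd.
have h := cvg_comp _ _ harmonic_right (cvg_dnbhs_at_right cc).
apply: cvg_trans h; apply: near_eq_cvg; apply: nearW => n.
rewrite /= /GRing.scale /= mulr1 addr0 gpow [RHS]mulrC. congr (_ * (_ - _)).
by rewrite -gpow mul0r addr0.
Qed.

End Sequences.

(** * Measurability of complex functions *)

Section ComplexMeasurable.
Context d (T : measurableType d) (R : realType).
Implicit Types f g : T -> R[i].

Lemma measurable_cmod f : cmeasurable f -> measurable_fun setT (@cmod R \o f).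
Proof.
move=> [fr fi].
have -> : @cmod R \o f = Num.sqrt \o
    (fun x => complex.Re (f x) ^+ 2 + complex.Im (f x) ^+ 2).
  by apply/funext => x /=; rewrite -cmod_sqr sqrtr_sqr ger0_norm// cmod_ge0.
apply: measurableT_comp.
  by apply: continuous_measurable_fun; exact: sqrt_continuous.
by apply: measurable_funD; apply: measurable_funX.
Qed.

Lemma cmeasurableD f g : cmeasurable f -> cmeasurable g ->
  cmeasurable (fun x => f x + g x).
Proof.
move=> [fr fi] [gr gi]; split.
  have -> : @complex.Re R \o (fun x => f x + g x) =
    (fun x => complex.Re (f x) + complex.Re (g x)).
    by apply/funext => x /=; case: (f x) (g x) => ? ? [].
  exact: measurable_funD.
have -> : @complex.Im R \o (fun x => f x + g x) =
  (fun x => complex.Im (f x) + complex.Im (g x)).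
  by apply/funext => x /=; case: (f x) (g x) => ? ? [].
exact: measurable_funD.
Qed.

Lemma cmeasurableM f g : cmeasurable f -> cmeasurable g ->
  cmeasurable (fun x => f x * g x).
Proof.
move=> [fr fi] [gr gi]; split.
  have -> : @complex.Re R \o (fun x => f x * g x) =
    (fun x => complex.Re (f x) * complex.Re (g x) - complex.Im (f x) * complex.Im (g x)).
    by apply/funext => x /=; case: (f x) (g x) => ? ? [].
  by apply: measurable_funB; apply: measurable_funM.
have -> : @complex.Im R \o (fun x => f x * g x) =
  (fun x => complex.Re (f x) * complex.Im (g x) + complex.Im (f x) * complex.Re (g x)).
  by apply/funext => x /=; case: (f x) (g x) => ? ? [].
by apply: measurable_funD; apply: measurable_funM.
Qed.

Lemma cmeasurable_cst (c : R[i]) : cmeasurable (fun _ : T => c).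
Proof. by split; apply: measurable_cst. Qed.

Lemma cmeasurable_conj f : cmeasurable f -> cmeasurable (fun x => (f x)^*%C).
Proof.
move=> [fr fi]; split.
  have -> // : @complex.Re R \o (fun x => (f x)^*%C) = @complex.Re R \o f.
  by apply/funext => x /=; case: (f x).
have -> : @complex.Im R \o (fun x => (f x)^*%C) = (fun x => - complex.Im (f x)).
  by apply/funext => x /=; case: (f x).
exact: measurableT_comp.
Qed.

Lemma cmeasurable_real (h : T -> R) : measurable_fun setT h ->
  cmeasurable (fun x => (h x)%:C%C).
Proof. by move=> mh; split => //; apply: measurable_cst. Qed.

Lemma cmeasurable_cpow (a : R) f : cmeasurable f ->
  cmeasurable (fun x => cpow a (f x)).
Proof.
move=> mf; apply: cmeasurableM => //; apply: cmeasurable_real.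
exact: (measurableT_comp (measurable_powR (a - 2)) (measurable_cmod mf)).
Qed.

Lemma cmeasurable_comp d' (S : measurableType d') (h : S -> T) f :
  measurable_fun setT h -> cmeasurable f -> cmeasurable (f \o h).
Proof.
move=> mh [fr fi].
by split; [exact: (measurableT_comp fr mh)|exact: (measurableT_comp fi mh)].
Qed.

End ComplexMeasurable.

(** * Weighted power integrals *)

Section Fatou.
Context d (T : measurableType d) (R : realType).
Variable mu : {measure set T -> \bar R}.
Implicit Types h : T -> R.

Lemma limn_einf_gt (u : (\bar R)^nat) (l : \bar R) :
  (l < limn_einf u)%E -> exists n, forall k, (n <= k)%N -> (l < u k)%E.
Proof.
rewrite limn_einf_lim => lu.
have [n ln] : exists n, (l < einfs u n)%E.
  apply: contrapT => /forallNP H; move: lu; apply/negP; rewrite -leNgt.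
  apply: lime_le; first exact: is_cvg_einfs.
  by apply: nearW => n; rewrite leNgt; apply/negP/H.
exists n => k nk; apply: (lt_le_trans ln).
by apply: ereal_inf_lbound; exists k.
Qed.

Lemma ge0_integrable h : measurable_fun setT h -> (forall x, 0 <= h x) ->
  (\int[mu]_x (h x)%:E < +oo)%E -> mu.-integrable setT (EFin \o h).
Proof.
move=> mh h0 hoo; apply/integrableP; split; first exact/measurable_EFinP.
by under eq_integral do rewrite /= ger0_norm//.
Qed.

Lemma integrable_EFinK h : mu.-integrable setT (EFin \o h) ->
  (\int[mu]_x (h x)%:E = (\int[mu]_x h x)%R%:E)%E.
Proof. by move=> ih; rewrite fineK//; exact: integrable_fin_num. Qed.

Lemma integrable_le (h k : T -> R) : measurable_fun setT h ->
  mu.-integrable setT (EFin \o k) -> (forall x, 0 <= h x <= k x) ->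
  mu.-integrable setT (EFin \o h).
Proof.
move=> mh ik hk; apply: (le_integrable measurableT _ _ ik).
  exact/measurable_EFinP.
move=> x _ /=; have /andP[h0 hkx] := hk x.
by rewrite lee_fin !ger0_norm// (le_trans h0).
Qed.

Lemma integrableZlR (c : R) (h : T -> R) : mu.-integrable setT (EFin \o h) ->
  mu.-integrable setT (EFin \o (fun x => c * h x)).
Proof. by move=> ih; have := integrableZl measurableT c ih. Qed.

Lemma integrableDR (h k : T -> R) : mu.-integrable setT (EFin \o h) ->
  mu.-integrable setT (EFin \o k) ->
  mu.-integrable setT (EFin \o (fun x => h x + k x)).
Proof. by move=> ih ik; have := integrableD measurableT ih ik. Qed.

Lemma integrableBR (h k : T -> R) : mu.-integrable setT (EFin \o h) ->
  mu.-integrable setT (EFin \o k) ->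
  mu.-integrable setT (EFin \o (fun x => h x - k x)).
Proof. by move=> ih ik; have := integrableB measurableT ih ik. Qed.

Lemma fatou_le (h_ : nat -> T -> R) h (M : \bar R) :
  (forall n, measurable_fun setT (h_ n)) -> (forall n x, 0 <= h_ n x) ->
  (forall x, h_ n x @[n --> \oo] --> h x) ->
  (forall n, \int[mu]_x (h_ n x)%:E <= M)%E ->
  (\int[mu]_x (h x)%:E <= M)%E.
Proof.
move=> mh h0 hh hM.
have mE n : measurable_fun setT (fun x => (h_ n x)%:E) by exact/measurable_EFinP.
have h0E n x : setT x -> (0 <= (h_ n x)%:E)%E by rewrite lee_fin.
have := fatou mu measurableT mE h0E.
under eq_integral.
  move=> x _; have /cvg_limn_einf_sup[-> _] : (h_ n x)%:E @[n --> \oo] --> (h x)%:E.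
    by apply: cvg_EFin; [exact: nearW|exact: hh].
  over.
move=> H; apply: (le_trans H).
rewrite leNgt; apply/negP => /limn_einf_gt[n /(_ _ (leqnn n))].
by rewrite ltNge hM.
Qed.

(** Stated for all large [n] instead of with a lower limit, so that several such bounds can be used
    at one common index. *)
Lemma fatou_eventually (h_ : nat -> T -> R) h (e : R) :
  (forall n, mu.-integrable setT (EFin \o h_ n)) ->
  (forall n x, 0 <= h_ n x) ->
  (forall x, h_ n x @[n --> \oo] --> h x) ->
  mu.-integrable setT (EFin \o h) -> 0 < e ->
  \forall n \near \oo, \int[mu]_x h x <= \int[mu]_x h_ n x + e.
Proof.
move=> ih_ h0 hh ih e0.
have mE n : measurable_fun setT (fun x => (h_ n x)%:E) by exact: measurable_int (ih_ n).
have h0E n x : setT x -> (0 <= (h_ n x)%:E)%E by rewrite lee_fin.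
have := fatou mu measurableT mE h0E.
under eq_integral.
  move=> x _; have /cvg_limn_einf_sup[-> _] : (h_ n x)%:E @[n --> \oo] --> (h x)%:E.
    by apply: cvg_EFin; [exact: nearW|exact: hh].
  over.
rewrite (integrable_EFinK ih) => H.
have : ((\int[mu]_x h x - e)%:E < limn_einf (fun n => \int[mu]_x (h_ n x)%:E))%E.
  by apply: lt_le_trans H; rewrite lte_fin ltrBlDr ltrDl.
move=> /limn_einf_gt[N HN]; exists N => // n /= Nn.
by have := HN n Nn; rewrite integrable_EFinK// lte_fin => /ltW; rewrite lerBlDr.
Qed.

End Fatou.

Section WeightedPower.
Context d (T : measurableType d) (R : realType).
Variables (mu : {measure set T -> \bar R}) (w : T -> R) (a : R).
Hypotheses (mw : measurable_fun setT w) (w0 : forall x, 0 <= w x) (a1 : 1 < a).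
Implicit Types f g : T -> R[i].

(** One notion covers all terms of the energy: the Gagliardo integrand ([f] a magnetic difference,
    [w] the kernel), the [H] and [K] terms, and the [L^P] norm with weight [1]. *)
Definition wpow f x : R := w x * cmod (f x) `^ a.

Definition wpow_finite f := cmeasurable f /\ mu.-integrable setT (EFin \o wpow f).

Definition wpow_int f : R := \int[mu]_x wpow f x.

Let a0 : 0 <= a. Proof. exact/ltW/(lt_trans _ a1). Qed.

Lemma wpow_ge0 f x : 0 <= wpow f x.
Proof. by rewrite mulr_ge0// powR_ge0. Qed.

Lemma wpow_int_ge0 f : 0 <= wpow_int f.
Proof. by apply: Rintegral_ge0 => x _; exact: wpow_ge0. Qed.

Lemma measurable_wpow f : cmeasurable f -> measurable_fun setT (wpow f).
Proof.
move=> mf; apply: measurable_funM => //.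
exact: (measurableT_comp (measurable_powR a) (measurable_cmod mf)).
Qed.

Lemma wpow_finiteD f g : wpow_finite f -> wpow_finite g ->
  wpow_finite (fun x => f x + g x).
Proof.
move=> [mf If] [mg Ig]; have mfg := cmeasurableD mf mg; split => //.
apply: (integrable_le _ (integrableZlR (2 `^ a) (integrableDR If Ig))) => [|x].
  exact: measurable_wpow.
rewrite wpow_ge0/= /wpow -mulrDr mulrCA; apply: ler_wpM2l => //.
exact: cmodD_powR.
Qed.

Lemma wpowM (c : R[i]) f x : wpow (fun x => c * f x) x = cmod c `^ a * wpow f x.
Proof. by rewrite /wpow cmodM powRM ?cmod_ge0// mulrCA. Qed.

Lemma wpow_finiteM (c : R[i]) f : wpow_finite f -> wpow_finite (fun x => c * f x).
Proof.
move=> [mf If]; split.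
  by apply: cmeasurableM => //; exact: cmeasurable_cst.
rewrite (_ : wpow _ = fun x => cmod c `^ a * wpow f x); last first.
  by apply/funext => x; exact: wpowM.
exact: integrableZlR.
Qed.

Lemma wpow_intM (c : R[i]) f : wpow_finite f ->
  wpow_int (fun x => c * f x) = cmod c `^ a * wpow_int f.
Proof.
move=> [mf If]; rewrite /wpow_int -RintegralZl//.
by apply: eq_Rintegral => x _; exact: wpowM.
Qed.

Lemma wpow_finiteB f g : wpow_finite f -> wpow_finite g ->
  wpow_finite (fun x => f x - g x).
Proof.
move=> Ff Fg; rewrite (_ : (fun x => _) = fun x => f x + -1 * g x).
  by apply: wpow_finiteD => //; exact: wpow_finiteM.
by apply/funext => x; rewrite mulN1r.
Qed.

Lemma wpow_intD_le f g : wpow_finite f -> wpow_finite g ->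
  wpow_int (fun x => f x + g x) <= 2 `^ a * (wpow_int f + wpow_int g).
Proof.
move=> Ff Fg; have [_ Ifg] := wpow_finiteD Ff Fg; move: Ff Fg => [_ If] [_ Ig].
rewrite /wpow_int -RintegralD// -RintegralZl//; last exact: integrableDR.
apply: le_Rintegral => //; first exact/integrableZlR/integrableDR.
move=> x _; rewrite /wpow -mulrDr mulrCA; apply: ler_wpM2l => //.
exact: cmodD_powR.
Qed.

Lemma wpow_int_convex f g t : wpow_finite f -> wpow_finite g ->
  0 <= t -> t <= 1 ->
  wpow_int (fun x => f x + (t%:C)%C * g x) <=
  (1 - t) * wpow_int f + t * wpow_int (fun x => f x + g x).
Proof.
move=> Ff Fg t0 t1.
have [_ Ifg] := wpow_finiteD Ff Fg.
have [_ Iftg] := wpow_finiteD Ff (wpow_finiteM (t%:C)%C Fg).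
move: Ff Fg => [_ If] [_ Ig].
rewrite /wpow_int -!RintegralZl// -RintegralD//; try exact: integrableZlR.
apply: le_Rintegral => //; first by apply: integrableDR; exact: integrableZlR.
move=> x _; rewrite /wpow mulrCA [t * _]mulrCA -mulrDr; apply: ler_wpM2l => //.
apply: le_trans (cmod_powR_convex _ _ (ltW a1) t0 t1).
rewrite le_eqVlt; apply/orP; left; apply/eqP; congr (cmod _ `^ _).
case: (f x) (g x) => x1 y1 [x2 y2].
by apply/eqP; rewrite eq_complex /=; apply/andP; split; apply/eqP; ring.
Qed.

(** Dominated convergence: by [cmod_powR_slope] the difference quotients with steps in [(0, 1]] are
    bounded by the integrable function [D]. Integrability of the derivative comes with the limit,
    without Hölder's inequality. *)
Lemma wpow_derive f g : wpow_finite f -> wpow_finite g ->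
  mu.-integrable setT
    (EFin \o (fun x => w x * (a * complex.Re (cpow a (f x) * (g x)^*%C)))) /\
  (wpow_int (fun x => f x + ((harmonic n)%:C)%C * g x) - wpow_int f) / harmonic n
    @[n --> \oo] -->
  \int[mu]_x (w x * (a * complex.Re (cpow a (f x) * (g x)^*%C))).
Proof.
move=> Ff Fg.
have [_ Ifg] := wpow_finiteD Ff Fg; have [_ Ifg'] := wpow_finiteB Ff Fg.
have Ft n : wpow_finite (fun x => f x + ((harmonic n)%:C)%C * g x).
  by apply: wpow_finiteD => //; exact: wpow_finiteM.
pose q n x := (wpow (fun x => f x + ((harmonic n)%:C)%C * g x) x - wpow f x) / harmonic n.
pose l x := w x * (a * complex.Re (cpow a (f x) * (g x)^*%C)).
pose D x := wpow (fun x => f x + g x) x + wpow (fun x => f x - g x) x + wpow f x.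
have Iq n : mu.-integrable setT (EFin \o q n).
  rewrite (_ : q n = fun x => (harmonic n)^-1 *
    (wpow (fun x => f x + ((harmonic n)%:C)%C * g x) x - wpow f x)); last first.
    by apply/funext => x; rewrite mulrC.
  by apply: integrableZlR; apply: integrableBR; [exact: (Ft n).2|exact: Ff.2].
have ql x : q n x @[n --> \oo] --> l x.
  rewrite (_ : q ^~ x = fun n => w x *
    ((cmod (f x + ((harmonic n)%:C)%C * g x) `^ a - cmod (f x) `^ a) / harmonic n)); last first.
    by apply/funext => n; rewrite /q /wpow -mulrBr mulrA.
  by apply: cvgM; [exact: cvg_cst|exact: cmod_powR_slope_cvg].
have ID : mu.-integrable setT (EFin \o D).
  by apply: integrableDR; [exact: integrableDR|exact: Ff.2].
have qD n x : `|q n x| <= D x.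
  rewrite /q /wpow -mulrBr -mulrA normrM ger0_norm// /D /wpow -!mulrDr.
  apply: ler_wpM2l => //; apply: cmod_powR_slope (ltW a1) _ _.
    exact: harmonic_gt0.
  by rewrite /= invf_le1// ler1n.
have mq n : measurable_fun setT (EFin \o q n) by exact: measurable_int (Iq n).
have ml : measurable_fun setT (EFin \o l).
  apply/measurable_EFinP/measurable_funM => //; apply: measurable_funM.
    exact: measurable_cst.
  by have [] := cmeasurableM (cmeasurable_cpow a Ff.1) (cmeasurable_conj Fg.1).
have qlE x : (q n x)%:E @[n --> \oo] --> (l x)%:E.
  by apply: cvg_EFin; [exact: nearW|exact: ql].
have [Il _ cv] := @dominated_convergence _ _ _ mu setT measurableT
   (fun n => EFin \o q n) (EFin \o l) (EFin \o D) mq ml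
   (aeW _ (fun x _ => qlE x)) ID
   (aeW _ (fun x n _ => qD n x)).
split => //.
have {cv} : (\int[mu]_x (q n x)%:E)%E @[n --> \oo] --> (\int[mu]_x l x)%R%:E.
  by rewrite -(integrable_EFinK Il); exact: cv.
move=> /fine_cvgP[_]; apply: cvg_trans; apply: near_eq_cvg; apply: nearW => n /=.
rewrite /wpow_int -RintegralB//; [|exact: (Ft n).2|exact: Ff.2].
rewrite -RintegralZr//.
by apply: integrableBR; [exact: (Ft n).2|exact: Ff.2].
Qed.

End WeightedPower.

Section PowerConvergence.
Variable R : realType.

(** At a positive limit the power is differentiable; at [0] monotonicity is used instead. *)
Lemma cvg_powR (u : nat -> R) (l a : R) : 0 < a -> (forall n, 0 <= u n) ->
  u n @[n --> \oo] --> l -> u n `^ a @[n --> \oo] --> l `^ a.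
Proof.
move=> a0 u0 ul.
have l0 : 0 <= l.
  by rewrite -(cvg_lim _ ul)//; apply: limr_ge; [apply/cvg_ex; exists l|exact: nearW].
move: l0; rewrite le_eqVlt => /predU1P[l0|l0]; last first.
  apply: (@cvg_comp _ _ _ u (fun x : R => x `^ a) _ _ _ ul).
  have [dl _] := is_derive1_powR a l0.
  by have /derivable1_diffP/differentiable_continuous := dl.
rewrite -l0 powR0 ?gt_eqF//; rewrite -l0 in ul.
apply/cvgrPdist_lt => e e0.
have e'0 : 0 < e `^ a^-1 by exact: powR_gt0.
move/cvgrPdist_lt : ul => /(_ _ e'0); apply: filterS => n.
rewrite !sub0r !normrN !ger0_norm ?powR_ge0// => une.
have -> : e = (e `^ a^-1) `^ a by rewrite -powRrM mulVf ?gt_eqF// powRr1// ltW.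
by apply: gt0_ltr_powR => //; rewrite nnegrE// powR_ge0.
Qed.

Lemma cvg_cmod (u : nat -> R[i]) (l : R[i]) :
  cmod (u n - l) @[n --> \oo] --> 0 -> cmod (u n) @[n --> \oo] --> cmod l.
Proof.
move=> /cvgrPdist_lt ul; apply/cvgrPdist_lt => e e0.
move: (ul e e0); apply: filterS => n; rewrite sub0r normrN ger0_norm ?cmod_ge0//.
apply: le_lt_trans; rewrite ler_norml; apply/andP; split.
  by rewrite lerNl opprB; exact: cmodB_rev.
by rewrite -(cmodN (u n - l)) opprB; exact: cmodB_rev.
Qed.

(** Split at [w = e t^(b-q)]. Below it, [w t^q <= e t^b]. Above it, [t^q <= (w/e)^(q/(b-q))], and
    [1 + q/(b-q) = b/(b-q)], which for [b = P] is the exponent [r] of the assumption on [H]. *)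
Lemma powR_young (w t q b e : R) : 0 <= w -> 0 <= t -> 0 < q -> q < b -> 0 < e ->
  w * t `^ q <= e `^ (1 - b / (b - q)) * w `^ (b / (b - q)) + e * t `^ b.
Proof.
move=> w0 t0 q0 qb e0; have bq : 0 < b - q by rewrite subr_gt0.
have rE : b / (b - q) = 1 + q / (b - q) by field; rewrite gt_eqF.
have [h|h] := leP w (e * t `^ (b - q)).
  apply: (@le_trans _ _ (e * t `^ b)); last by rewrite lerDr mulr_ge0// powR_ge0.
  have -> : t `^ b = t `^ (b - q) * t `^ q.
    rewrite -powRD ?subrK//; apply/implyP => /eqP b0.
    by move: (lt_trans q0 qb); rewrite b0 ltxx.
  by rewrite mulrA ler_wpM2r// powR_ge0.
have w0' : 0 < w.
  by apply: le_lt_trans h; rewrite mulr_ge0 ?powR_ge0// ltW.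
apply: (@le_trans _ _ (e `^ (1 - b / (b - q)) * w `^ (b / (b - q)))); last first.
  by rewrite lerDl mulr_ge0 ?powR_ge0// ltW.
have -> : t `^ q = (t `^ (b - q)) `^ (q / (b - q)).
  by rewrite -powRrM; congr (_ `^ _); field; rewrite gt_eqF.
have -> : e `^ (1 - b / (b - q)) * w `^ (b / (b - q)) = w * (w / e) `^ (q / (b - q)).
  rewrite rE opprD addrA subrr add0r powRD ?(gt_eqF w0') ?implybT// powRr1//.
  rewrite powRM ?invr_ge0// ?(ltW e0)// -(powR_inv1 (ltW e0)) -powRrM mulN1r.
  by rewrite mulrC mulrA.
apply: ler_wpM2l => //; apply: ge0_ler_powR; rewrite ?nnegrE ?powR_ge0 ?divr_ge0 ?ltW//.
by rewrite ltr_pdivlMr// mulrC.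
Qed.

End PowerConvergence.

(** * One-sided Brezis-Lieb estimates along a pointwise limit *)

Section BrezisLieb.
Context d (T : measurableType d) (R : realType).
Variables (mu : {measure set T -> \bar R}) (w : T -> R) (a : R).
Hypotheses (mw : measurable_fun setT w) (w0 : forall x, 0 <= w x) (a1 : 1 < a).
Variables (f_ : nat -> T -> R[i]) (f : T -> R[i]).
Hypothesis ff : forall x, cmod (f_ n x - f x) @[n --> \oo] --> 0.

Let a0 : 0 < a. Proof. exact: lt_trans a1. Qed.

Lemma cvg_wpow x : wpow w a (f_ n) x @[n --> \oo] --> wpow w a f x.
Proof.
apply: cvgM; first exact: cvg_cst.
by apply: cvg_powR => //; [move=> n; exact: cmod_ge0|exact: cvg_cmod].
Qed.

Lemma cvg_wpowB x :
  wpow w a (fun x => f_ n x - f x) x @[n --> \oo] --> 0.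
Proof.
rewrite -(mulr0 (w x)) -(powR0 (lt0r_neq0 a0)); apply: cvgM; first exact: cvg_cst.
by apply: cvg_powR => //; move=> n; exact: cmod_ge0.
Qed.

Lemma wpow_finite_limit (M : R) :
  cmeasurable f -> (forall n, wpow_finite mu w a (f_ n)) ->
  (forall n, wpow_int mu w a (f_ n) <= M) ->
  wpow_finite mu w a f /\ wpow_int mu w a f <= M.
Proof.
move=> mf Ff_ fM.
have H : (\int[mu]_x (wpow w a f x)%:E <= M%:E)%E.
  apply: (fatou_le (h_ := fun n => wpow w a (f_ n))).
  - by move=> n; apply: measurable_wpow => //; exact: (Ff_ n).1.
  - by move=> n x; exact: wpow_ge0.
  - exact: cvg_wpow.
  - by move=> n; rewrite (integrable_EFinK (Ff_ n).2) lee_fin; exact: fM.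
have If : mu.-integrable setT (EFin \o wpow w a f).
  apply: ge0_integrable; first exact: measurable_wpow.
    by move=> x; exact: wpow_ge0.
  exact: le_lt_trans H (ltry _).
by split; [split|move: H; rewrite (integrable_EFinK If) lee_fin].
Qed.

Hypotheses (Ff : wpow_finite mu w a f) (Ff_ : forall n, wpow_finite mu w a (f_ n)).

Let FB n : wpow_finite mu w a (fun x => f_ n x - f x).
Proof. exact: wpow_finiteB. Qed.

(** Fatou for [|f_n|^a + |f|^a - 2^-a |f_n - f|^a], which is nonnegative by the crude triangle
    inequality and tends to [2 |f|^a]; one copy of [int |f|^a] cancels. *)
Lemma wpow_liminf (e : R) : 0 < e -> \forall n \near \oo,
  wpow_int mu w a f + (2 `^ a)^-1 * wpow_int mu w a (fun x => f_ n x - f x)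
  <= wpow_int mu w a (f_ n) + e.
Proof.
move=> e0; have c0 : 0 < 2 `^ a :> R by exact: powR_gt0.
pose X n x := wpow w a (f_ n) x + wpow w a f x
   - (2 `^ a)^-1 * wpow w a (fun x => f_ n x - f x) x.
have IX n : mu.-integrable setT (EFin \o X n).
  apply: integrableBR; first by apply: integrableDR; [exact: (Ff_ n).2|exact: Ff.2].
  by apply: integrableZlR; exact: (FB n).2.
have X0 n x : 0 <= X n x.
  rewrite subr_ge0 ler_pdivrMl// /wpow -mulrDr mulrCA; apply: ler_wpM2l => //.
  by rewrite -[in X in _ <= X](cmodN (f x)); apply: cmodD_powR; exact: ltW.
have Xl x : X n x @[n --> \oo] --> wpow w a f x + wpow w a f x.
  rewrite -[X in _ --> X]subr0; apply: cvgB.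
    by apply: cvgD; [exact: cvg_wpow|exact: cvg_cst].
  rewrite -(mulr0 (2 `^ a)^-1); apply: cvgM; first exact: cvg_cst.
  exact: cvg_wpowB.
have If2 : mu.-integrable setT (EFin \o (fun x => wpow w a f x + wpow w a f x)).
  by apply: integrableDR; exact: Ff.2.
have := fatou_eventually IX X0 Xl If2 e0.
apply: filterS => n; rewrite RintegralD//; [|exact: Ff.2|exact: Ff.2].
rewrite RintegralB//; last 2 first.
  by apply: integrableDR; [exact: (Ff_ n).2|exact: Ff.2].
  by apply: integrableZlR; exact: (FB n).2.
rewrite RintegralD//; [|exact: (Ff_ n).2|exact: Ff.2].
rewrite RintegralZl//; last exact: (FB n).2.
rewrite -/(wpow_int mu w a f) -/(wpow_int mu w a (f_ n)).
rewrite -/(wpow_int mu w a (fun x => f_ n x - f x)).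
by move=> H; lra.
Qed.

(** Fatou for [2^a (|f_n - f|^a + |f|^a) - |f_n|^a], whose limit is [2^a |f|^a - |f|^a]; the terms
    [2^a |f|^a] cancel. *)
Lemma wpow_limsup (e : R) : 0 < e -> \forall n \near \oo,
  wpow_int mu w a (f_ n) <= wpow_int mu w a f
    + 2 `^ a * wpow_int mu w a (fun x => f_ n x - f x) + e.
Proof.
move=> e0; have c0 : 0 < 2 `^ a :> R by exact: powR_gt0.
pose X n x := 2 `^ a * (wpow w a (fun x => f_ n x - f x) x + wpow w a f x)
   - wpow w a (f_ n) x.
have IS n : mu.-integrable setT
    (EFin \o (fun x => 2 `^ a * (wpow w a (fun x => f_ n x - f x) x + wpow w a f x))).
  by apply/integrableZlR/integrableDR; [exact: (FB n).2|exact: Ff.2].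
have IX n : mu.-integrable setT (EFin \o X n).
  by apply: integrableBR; [exact: IS|exact: (Ff_ n).2].
have X0 n x : 0 <= X n x.
  rewrite subr_ge0 /wpow -mulrDr mulrCA; apply: ler_wpM2l => //.
  by rewrite -{1}(subrK (f x) (f_ n x)); apply: cmodD_powR; exact: ltW.
have Xl x : X n x @[n --> \oo] --> 2 `^ a * (0 + wpow w a f x) - wpow w a f x.
  apply: cvgB; last exact: cvg_wpow.
  apply: cvgM; first exact: cvg_cst.
  by apply: cvgD; [exact: cvg_wpowB|exact: cvg_cst].
have I0 : mu.-integrable setT (EFin \o (fun x => 2 `^ a * (0 + wpow w a f x))).
  by under eq_fun do rewrite add0r; apply: integrableZlR; exact: Ff.2.
have If2 : mu.-integrable setT (EFin \o (fun x => 2 `^ a * (0 + wpow w a f x) - wpow w a f x)).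
  by apply: integrableBR => //; exact: Ff.2.
have := fatou_eventually IX X0 Xl If2 e0.
apply: filterS => n; rewrite RintegralB//; last exact: Ff.2.
under eq_Rintegral do rewrite add0r.
rewrite RintegralB//; last exact: (Ff_ n).2.
rewrite !RintegralZl//; [|by apply: integrableDR; [exact: (FB n).2|exact: Ff.2]|exact: Ff.2].
rewrite RintegralD//; [|exact: (FB n).2|exact: Ff.2].
rewrite -/(wpow_int mu w a f) -/(wpow_int mu w a (f_ n)).
rewrite -/(wpow_int mu w a (fun x => f_ n x - f x)).
by rewrite mulrDr => H; lra.
Qed.

End BrezisLieb.

Section Subcritical.
Context d (T : measurableType d) (R : realType).
Variables (mu : {measure set T -> \bar R}) (w : T -> R) (q b : R).
Hypotheses (mw : measurable_fun setT w) (w0 : forall x, 0 <= w x).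
Hypotheses (q1 : 1 < q) (qb : q < b).
Let r := b / (b - q).
Hypothesis Iw : mu.-integrable setT (EFin \o (fun x => w x `^ r)).

Let q0 : 0 < q. Proof. exact: lt_trans q1. Qed.

Lemma wpow_young f x (e : R) : 0 < e ->
  wpow w q f x <= e `^ (1 - r) * w x `^ r + e * wpow (fun=> 1) b f x.
Proof. by move=> e0; rewrite [wpow _ b f x]mul1r; apply: powR_young => //; exact: cmod_ge0. Qed.

Let Isum f (e : R) : wpow_finite mu (fun=> 1) b f ->
  mu.-integrable setT
    (EFin \o (fun x => e `^ (1 - r) * w x `^ r + e * wpow (fun=> 1) b f x)).
Proof. by move=> [_ If]; apply: integrableDR; exact: integrableZlR. Qed.

Lemma subcritical_finite f : wpow_finite mu (fun=> 1) b f -> wpow_finite mu w q f.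
Proof.
move=> Ff; split; first exact: Ff.1.
apply: (integrable_le _ (Isum 1 Ff)); first by apply: measurable_wpow => //; exact: Ff.1.
by move=> x; rewrite wpow_ge0//=; exact: wpow_young.
Qed.

Lemma subcritical_bound f (e : R) : wpow_finite mu (fun=> 1) b f -> 0 < e ->
  wpow_int mu w q f <=
  e `^ (1 - r) * \int[mu]_x w x `^ r + e * wpow_int mu (fun=> 1) b f.
Proof.
move=> Ff e0; have [_ If] := subcritical_finite Ff; have [_ If'] := Ff.
rewrite /wpow_int -!RintegralZl// -RintegralD//; try exact: integrableZlR.
apply: le_Rintegral => //; first exact: Isum.
by move=> x _; exact: wpow_young.
Qed.

(** Fatou is applied to the gap between the two sides of Young's inequality for [f_ n]. The [w^r]
    part of the majorant is the same for [f_ n] and [f] and cancels; the other part is small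
    uniformly in [n]. *)
Lemma subcritical_limsup (f_ : nat -> T -> R[i]) f (M e : R) :
  (forall x, cmod (f_ n x - f x) @[n --> \oo] --> 0) ->
  wpow_finite mu (fun=> 1) b f -> (forall n, wpow_finite mu (fun=> 1) b (f_ n)) ->
  (forall n, wpow_int mu (fun=> 1) b (f_ n) <= M) -> 0 < e ->
  \forall n \near \oo, wpow_int mu w q (f_ n) <= wpow_int mu w q f + e.
Proof.
move=> ff Ff Ff_ fM e0.
have M0 : 0 <= M by apply: le_trans (fM 0); apply: wpow_int_ge0.
(* Keeps [de * int |f_n|^b] below [e / 2]; the [+ 1] covers [M = 0]. *)
pose de := e / 2 / (M + 1).
have M1 : 0 < M + 1 by rewrite ltr_wpDl.
have de0 : 0 < de by rewrite !divr_gt0.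
pose S f x := de `^ (1 - r) * w x `^ r + de * wpow (fun=> 1) b f x.
have Sub g : wpow_finite mu (fun=> 1) b g -> \int[mu]_x (S g x - wpow w q g x) =
   de `^ (1 - r) * \int[mu]_x w x `^ r + de * wpow_int mu (fun=> 1) b g - wpow_int mu w q g.
  move=> Fg; have [_ Ig] := Fg; rewrite RintegralB//; [|exact: Isum|exact: (subcritical_finite Fg).2].
  rewrite RintegralD//; [|exact: integrableZlR|exact: integrableZlR].
  by rewrite RintegralZl// RintegralZl.
have IB g : wpow_finite mu (fun=> 1) b g ->
    mu.-integrable setT (EFin \o (fun x => S g x - wpow w q g x)).
  by move=> Fg; apply: integrableBR; [exact: Isum|exact: (subcritical_finite Fg).2].
have e20 : 0 < e / 2 by rewrite divr_gt0.
have cvX x : S (f_ n) x - wpow w q (f_ n) x @[n --> \oo] --> S f x - wpow w q f x.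
  apply: cvgB; last by apply: cvg_wpow.
  apply: cvgD; first exact: cvg_cst.
  by apply: cvgM; [exact: cvg_cst|apply: cvg_wpow => //; exact: lt_trans qb].
have X0 n x : 0 <= S (f_ n) x - wpow w q (f_ n) x by rewrite subr_ge0; exact: wpow_young.
have := fatou_eventually (fun n => IB _ (Ff_ n)) X0 cvX (IB _ Ff) e20.
apply: filterS => n; rewrite !Sub//.
have h1 : de * wpow_int mu (fun=> 1) b (f_ n) <= e / 2.
  rewrite /de mulrAC ler_pdivrMr// ler_wpM2l ?(ltW e20)//.
  by apply: le_trans (fM n) _; rewrite lerDl.
have h2 : 0 <= de * wpow_int mu (fun=> 1) b f.
  by rewrite mulr_ge0 ?(ltW de0)//; exact: wpow_int_ge0.
by move=> h3; lra.
Qed.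

End Subcritical.

(** * Measurability in three dimensions *)

Section Euclidean.
Variable R : realType.
Implicit Types (x y : R3 R) (A : R3 R -> R3 R).

(** The sigma-algebra of [R3] is generated by products, so an open set is written as the countable
    union of the rational boxes that it contains. *)
Lemma open3_measurable (U : set (R3 R)) : open U -> measurable U.
Proof.
pose I : countType := ((rat * rat) * (rat * rat) * (rat * rat))%type.
pose itv (i : rat * rat) : set R := [set` `]ratr i.1, ratr i.2[ ].
pose box (i : I) : set (R3 R) := (itv i.1.1 `*` itv i.1.2) `*` itv i.2.
move=> oU.
have -> : U = \bigcup_i (if `[< box i `<=` U >] then box i else set0).
  apply/seteqP; split => [x Ux|x [i _]]; last by case: asboolP => // + bx; exact.
  have /nbhs_ballP[e /= e0 eU] := open_nbhs_nbhs (conj oU Ux).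
  have ch (t : R) : exists i : rat * rat, itv i t /\ forall t', itv i t' -> `|t - t'| < e.
    have [|k1] := @rat_in_itvoo R (t - e) t; first by rewrite ltrBlDr ltrDl.
    have [|k2] := @rat_in_itvoo R t (t + e); first by rewrite ltrDl.
    rewrite !in_itv /= => /andP[h1 h2] /andP[h3 h4].
    exists (k1, k2); split => [|t']; rewrite /itv /= in_itv /=; first by rewrite h4 h1.
    by move=> /andP[h5 h6]; rewrite ltr_norml; apply/andP; split; lra.
  have [i1 [h1 k1]] := ch x.1.1; have [i2 [h2 k2]] := ch x.1.2.
  have [i3 [h3 k3]] := ch x.2.
  exists ((i1, i2), i3) => //; case: asboolP => // -[] y [[y1 y2] y3]; apply: eU.
  by split; [split|]; rewrite /ball /=; [exact: k1|exact: k2|exact: k3].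
apply: countable_bigcupT_measurable; first exact: countableP.
move=> i; case: asboolP => // _.
by apply: measurableX; [apply: measurableX|]; exact: measurable_itv.
Qed.

Lemma continuous3_measurable (f : R3 R -> R) : continuous f -> measurable_fun setT f.
Proof.
move=> cf; apply: (measurability _ (RGenOInfty.measurableE R)).
move=> _ [_ [a ->]] <-; rewrite setTI; apply: open3_measurable.
by move/continuousP : cf; apply; exact: interval_open.
Qed.

Lemma dotE x y : dot x y = x.1.1 * y.1.1 + x.1.2 * y.1.2 + x.2 * y.2.
Proof. by rewrite /dot !big_ord_recl big_ord0 addr0 /coord3 /= addrA. Qed.

Lemma enormE x : enorm x = Num.sqrt (x.1.1 ^+ 2 + x.1.2 ^+ 2 + x.2 ^+ 2).
Proof. by rewrite /enorm dotE !expr2. Qed.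

Lemma enorm_ge0 x : 0 <= enorm x. Proof. exact: sqrtr_ge0. Qed.

Lemma enorm_sqr x : enorm x ^+ 2 = x.1.1 ^+ 2 + x.1.2 ^+ 2 + x.2 ^+ 2.
Proof. by rewrite enormE sqr_sqrtr// !addr_ge0// sqr_ge0. Qed.

Lemma enorm_coord x : [/\ `|x.1.1| <= enorm x, `|x.1.2| <= enorm x & `|x.2| <= enorm x].
Proof.
have h (t : R) : t ^+ 2 <= enorm x ^+ 2 -> `|t| <= enorm x.
  by rewrite -[t ^+ 2]real_normK ?num_real// ler_sqr ?nnegrE ?enorm_ge0.
have := sqr_ge0 x.1.1; have := sqr_ge0 x.1.2; have := sqr_ge0 x.2 => h1 h2 h3.
by split; apply: h; rewrite enorm_sqr; lra.
Qed.

(** The factor [2] is a round upper bound for [sqrt 3]. *)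
Lemma enorm_le x (e : R) : 0 <= e ->
  `|x.1.1| <= e -> `|x.1.2| <= e -> `|x.2| <= e -> enorm x <= 2 * e.
Proof.
move=> e0 h1 h2 h3.
rewrite -ler_sqr ?nnegrE ?enorm_ge0 ?mulr_ge0// enorm_sqr.
have h (t : R) : `|t| <= e -> t ^+ 2 <= e ^+ 2.
  by rewrite -[t ^+ 2]real_normK ?num_real// ler_sqr ?nnegrE.
have := h _ h1; have := h _ h2; have := h _ h3; have := sqr_ge0 e.
by move=> H0 H1 H2 H3; rewrite exprMn; lra.
Qed.

Lemma enorm0 x : enorm x = 0 -> x = 0.
Proof.
move=> x0; have [] := enorm_coord x; rewrite x0 !normr_le0.
by case: x {x0} => -[a b] c /= /eqP -> /eqP -> /eqP ->.
Qed.

Lemma measurable_pair3 d (T : measurableType d) (f g h : T -> R) :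
  measurable_fun setT f -> measurable_fun setT g -> measurable_fun setT h ->
  measurable_fun setT (fun t => (f t, g t, h t)).
Proof. by move=> mf mg mh; do 2 apply: measurable_fun_pair => //. Qed.

Lemma measurable_coord1 : measurable_fun setT (fun x => x.1.1).
Proof. exact: (measurableT_comp measurable_fst measurable_fst). Qed.

Lemma measurable_coord2 : measurable_fun setT (fun x => x.1.2).
Proof. exact: (measurableT_comp measurable_snd measurable_fst). Qed.

Lemma measurable_coord3 : measurable_fun setT (fun x => x.2).
Proof. exact: measurable_snd. Qed.

Lemma measurable_dot d (T : measurableType d) (f g : T -> R3 R) :
  measurable_fun setT f -> measurable_fun setT g ->
  measurable_fun setT (fun t => dot (f t) (g t)).
Proof.
move=> mf mg; under eq_fun do rewrite dotE.
by apply: measurable_funD; [apply: measurable_funD|]; apply: measurable_funM;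
 [exact: (measurableT_comp measurable_coord1 mf)|exact: (measurableT_comp measurable_coord1 mg)
 |exact: (measurableT_comp measurable_coord2 mf)|exact: (measurableT_comp measurable_coord2 mg)
 |exact: (measurableT_comp measurable_coord3 mf)|exact: (measurableT_comp measurable_coord3 mg)].
Qed.

Lemma measurable_sub3 : measurable_fun setT (fun z : R3 R * R3 R => z.1 - z.2).
Proof.
have -> : (fun z : R3 R * R3 R => z.1 - z.2) =
  (fun z => (z.1.1.1 - z.2.1.1, z.1.1.2 - z.2.1.2, z.1.2 - z.2.2)) by [].
by apply: measurable_pair3; apply: measurable_funB;
 [exact: (measurableT_comp measurable_coord1 measurable_fst)
 |exact: (measurableT_comp measurable_coord1 measurable_snd)
 |exact: (measurableT_comp measurable_coord2 measurable_fst)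
 |exact: (measurableT_comp measurable_coord2 measurable_snd)
 |exact: (measurableT_comp measurable_coord3 measurable_fst)
 |exact: (measurableT_comp measurable_coord3 measurable_snd)].
Qed.

Lemma measurable_mid3 :
  measurable_fun setT (fun z : R3 R * R3 R => (2^-1 : R) *: (z.1 + z.2)).
Proof.
have -> : (fun z : R3 R * R3 R => (2^-1 : R) *: (z.1 + z.2)) =
  (fun z => (2^-1 * (z.1.1.1 + z.2.1.1), 2^-1 * (z.1.1.2 + z.2.1.2), 2^-1 * (z.1.2 + z.2.2))) by [].
by apply: measurable_pair3; (apply: measurable_funM; first exact: measurable_cst); apply: measurable_funD;
 [exact: (measurableT_comp measurable_coord1 measurable_fst)
 |exact: (measurableT_comp measurable_coord1 measurable_snd)
 |exact: (measurableT_comp measurable_coord2 measurable_fst)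
 |exact: (measurableT_comp measurable_coord2 measurable_snd)
 |exact: (measurableT_comp measurable_coord3 measurable_fst)
 |exact: (measurableT_comp measurable_coord3 measurable_snd)].
Qed.

Lemma measurable_enorm d (T : measurableType d) (f : T -> R3 R) :
  measurable_fun setT f -> measurable_fun setT (fun t => enorm (f t)).
Proof.
move=> mf.
have -> : (fun t => enorm (f t)) = Num.sqrt \o (fun t => dot (f t) (f t)) by [].
apply: measurableT_comp.
  by apply: continuous_measurable_fun; exact: sqrt_continuous.
exact: measurable_dot.
Qed.

Lemma cmeasurable_cis d (T : measurableType d) (h : T -> R) :
  measurable_fun setT h -> cmeasurable (fun t => cis (h t)).
Proof.
move=> mh; split.
  apply: (measurableT_comp (f := @cos R) _ mh).
  by apply: continuous_measurable_fun; exact: continuous_cos.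
apply: (measurableT_comp (f := @sin R) _ mh).
by apply: continuous_measurable_fun; exact: continuous_sin.
Qed.

Lemma continuous3_measurable3 A : continuous A -> measurable_fun setT A.
Proof.
move=> cA.
have -> : A = fun x => ((A x).1.1, (A x).1.2, (A x).2).
  by apply/funext => x; case: (A x) => -[].
apply: measurable_pair3; apply: continuous3_measurable => x.
- have h : {for A x, continuous (fun y : R3 R => y.1.1)}.
    apply: (@cvg_comp _ _ _ fst fst _ (nbhs (A x).1)); [exact: cvg_fst|exact: cvg_fst].
  exact: (continuous_comp (cA x) h).
- have h : {for A x, continuous (fun y : R3 R => y.1.2)}.
    apply: (@cvg_comp _ _ _ fst snd _ (nbhs (A x).1)); [exact: cvg_fst|exact: cvg_snd].
  exact: (continuous_comp (cA x) h).
- have h : {for A x, continuous (fun y : R3 R => y.2)} by exact: cvg_snd.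
  exact: (continuous_comp (cA x) h).
Qed.

Lemma cmeasurable_mdiff A (u : R3 R -> R[i]) : continuous A -> cmeasurable u ->
  cmeasurable (mdiff A u).
Proof.
move=> cA mu.
have m1 : cmeasurable (fun z : R3 R * R3 R => u z.1) by exact: (cmeasurable_comp measurable_fst mu).
have m2 : cmeasurable (fun z : R3 R * R3 R => -1 * u z.2).
  by apply: cmeasurableM; [exact: cmeasurable_cst|exact: (cmeasurable_comp measurable_snd mu)].
have mc : cmeasurable (fun z : R3 R * R3 R => cis (- dot (z.1 - z.2) (A (2^-1 *: (z.1 + z.2))))).
  apply: cmeasurable_cis.
  have md : measurable_fun setT (fun z : R3 R * R3 R => dot (z.1 - z.2) (A (2^-1 *: (z.1 + z.2)))).
    apply: measurable_dot; first exact: measurable_sub3.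
    exact: (measurableT_comp (continuous3_measurable3 cA) measurable_mid3).
  exact: (measurableT_comp (@oppr_measurable R setT) md).
rewrite (_ : mdiff A u = fun z => cis (- dot (z.1 - z.2) (A (2^-1 *: (z.1 + z.2)))) * u z.1
  + -1 * u z.2); last first.
  by apply/funext => z; rewrite /mdiff mulN1r.
by apply: cmeasurableD => //; apply: cmeasurableM.
Qed.

Definition box (x : R3 R) (r : R) : set (R3 R) :=
  ([set` `[x.1.1 - r, x.1.1 + r]] `*` [set` `[x.1.2 - r, x.1.2 + r]])
  `*` [set` `[x.2 - r, x.2 + r]].

Lemma boxP x r y : box x r y <->
  [/\ `|x.1.1 - y.1.1| <= r, `|x.1.2 - y.1.2| <= r & `|x.2 - y.2| <= r].
Proof.
by rewrite /box /setX /= !in_itv /= !ler_distlC; split=> [[[-> ->] ->]|[-> -> ->]].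
Qed.

Lemma measurable_box x r : measurable (box x r).
Proof. by apply: measurableX; [apply: measurableX|]; exact: measurable_itv. Qed.

Lemma leb3_box x r : 0 <= r -> leb3 (box x r) = (8 * r ^+ 3)%:E.
Proof.
move=> r0; have h t : leb1 [set` `[t - r, t + r]] = (2 * r)%:E.
  rewrite /leb1 lebesgue_measure_itv /= lte_fin.
  case: ifPn => [_|]; first by rewrite -EFinB; congr EFin; ring.
  rewrite -leNgt => h; congr EFin; lra.
rewrite /leb3 product_measure1E//=; [|exact: measurableX].
rewrite /leb2 product_measure1E//= !h -!EFinM; congr EFin; ring.
Qed.

Lemma continuous_box_bounded A (r : R) : continuous A ->
  exists2 a : R, 0 <= a & forall x, box 0 r x ->
   [/\ `|(A x).1.1| <= a, `|(A x).1.2| <= a & `|(A x).2| <= a].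
Proof.
move=> cA.
have cB : compact (box 0 r).
  by apply: compact_setX; [apply: compact_setX|]; exact: segment_compact.
have /compact_bounded[M [_ HM]] : compact (A @` box 0 r).
  by apply: continuous_compact => //; exact: continuous_subspaceT.
exists (`|M| + 1); first by rewrite addr_ge0.
move=> x Bx; have := HM (`|M| + 1); rewrite (le_lt_trans (ler_norm M)) ?ltrDl// => /(_ isT).
move=> /(_ (A x)); rewrite /= => H; have : `|A x| <= `|M| + 1 by apply: H; exists x.
by rewrite !prod_normE !ge_max => /andP[/andP[]].
Qed.

End Euclidean.

(** * The magnetic fractional Sobolev inequality *)

Section Sobolev.
Variable R : realType.
Variables (s p : R) (A : R3 R -> R3 R).
Hypotheses (s0 : 0 < s) (p1 : 1 < p) (sp3 : s * p < 3) (cA : continuous A).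
Implicit Types u : R3 R -> R[i].

(** On the diagonal the value is [0^-1 = 0]. Upper bounds can therefore ignore the diagonal, while
    lower bounds must exclude it. *)
Definition gagliardo_kernel (z : R3 R * R3 R) : R :=
  (enorm (z.1 - z.2) `^ (3 + s * p))^-1.

Local Notation mu3 := (@leb3 R).
Local Notation P := (pstar s p).
Local Notation K := gagliardo_kernel.

Let p0 : 0 < p. Proof. exact: lt_trans p1. Qed.
Let sp0 : 0 < s * p. Proof. exact: mulr_gt0. Qed.
Let d0 : 0 < 3 - s * p. Proof. by rewrite subr_gt0. Qed.

Lemma pstar_gt : p < P.
Proof. by rewrite /pstar ltr_pdivlMr// mulrC ltr_pM2r// ltrBlDr ltrDl. Qed.

Let P0 : 0 < P. Proof. exact: lt_trans pstar_gt. Qed.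

Lemma gagliardo_kernel_ge0 z : 0 <= K z.
Proof. by rewrite invr_ge0 powR_ge0. Qed.

Lemma measurable_gagliardo_kernel : measurable_fun setT K.
Proof.
rewrite (_ : K = fun z => (enorm (z.1 - z.2) `^ (3 + s * p)) `^ (-1)); last first.
  by apply/funext => z; rewrite powR_inv1// powR_ge0.
apply: (measurableT_comp (measurable_powR (-1))).
apply: (measurableT_comp (measurable_powR (3 + s * p))).
exact: (measurable_enorm (@measurable_sub3 R)).
Qed.

Lemma mdiff_ge u x y : cmod (u x) - cmod (u y) <= cmod (mdiff A u (x, y)).
Proof.
by apply: le_trans (cmodB_rev _ _); rewrite /= cmodM cmod_cis mul1r.
Qed.

Lemma powR_expR (x y : R) : 0 < x -> x `^ y = expR (y * ln x).
Proof. by move=> x0; rewrite /powR (gt_eqF x0). Qed.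

(** Here [r^3] is proportional to [n a^-P], so [r^(-3-sp) a^p r^3] scales like
    [n^(-sp/3) a^(p + P sp/3)], and [p + P sp/3 = P] by the choice of [pstar]. Every factor is the
    exponential of a linear form in [ln 2], [ln n], [ln a], which reduces both identities to
    identities between exponents. *)
Let sobolev_const (n a : R) : 0 < n -> 0 < a ->
  let r := (n / 4 * (2 / a) `^ P) `^ 3^-1 in
  [/\ 0 < r, 4 * r ^+ 3 = n / (a / 2) `^ P &
  ((2 * r) `^ (3 + s * p))^-1 * (a / 2) `^ p * (4 * r ^+ 3) =
  (4 / 2 `^ (3 + s * p) * 4 `^ (s * p / 3) / 2 `^ P) * n `^ (- (s * p / 3)) * a `^ P].
Proof.
move=> n0 a0 r.
have q0 : 0 < n / 4 * (2 / a) `^ P by rewrite mulr_gt0 ?divr_gt0 ?powR_gt0 ?divr_gt0.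
have r0 : 0 < r by exact: powR_gt0.
have l4 : ln 4 = 2 * ln 2 :> R.
  by rewrite (_ : 4 = 2 * 2 :> R) ?lnM ?posrE//; ring.
have lr : ln r = 3^-1 * (ln n - 2 * ln 2 + P * (ln 2 - ln a)).
  rewrite /r ln_powR lnM ?posrE ?divr_gt0 ?powR_gt0 ?divr_gt0// ln_powR.
  by rewrite !ln_div ?posrE// l4.
have e4 : 4 = expR (2 * ln 2) :> R by rewrite -l4 lnK ?posrE.
have en : n = expR (ln n) by rewrite lnK ?posrE.
split => //.
  rewrite -powR_mulrn ?ltW// !powR_expR ?divr_gt0// lr ln_div ?posrE//.
  rewrite {1}e4 {2}en -!expRN -!expRD; congr expR; by field.
rewrite -powR_mulrn ?ltW// !powR_expR ?divr_gt0 ?mulr_gt0// lnM ?posrE// lr ln_div ?posrE//.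
rewrite {1 2}e4 l4 -!expRN -!expRD; congr expR.
by rewrite /pstar; field; rewrite gt_eqF.
Qed.

(* On at least half of a box of volume [8 r^3] centred at [x], with [8 r^3] twice
   the Chebyshev bound for [|{ |u| > |u x| / 2 }|], one has [|u| <= |u x| / 2]. *)
Lemma sobolev_pointwise u (n : R) : cmeasurable u -> 0 < n ->
  (\int[mu3]_y (cmod (u y) `^ P)%:E <= n%:E)%E -> forall x,
  (((4 / 2 `^ (3 + s * p) * 4 `^ (s * p / 3) / 2 `^ P) * n `^ (- (s * p / 3)) * cmod (u x) `^ P)%:E
   <= \int[mu3]_y (wpow K p (mdiff A u) (x, y))%:E)%E.
Proof.
move=> mu n0 un x.
have [ux0|ux0] := eqVneq (cmod (u x)) 0.
  rewrite ux0 powR0 ?gt_eqF// mulr0; apply: integral_ge0 => y _.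
  by rewrite lee_fin; apply: wpow_ge0; exact: gagliardo_kernel_ge0.
pose a := cmod (u x); have a0 : 0 < a by rewrite lt_neqAle eq_sym ux0 cmod_ge0.
have [] := sobolev_const n0 a0; set r := (_ `^ 3^-1) => r0 r3 rE.
have mcu : measurable_fun setT (@cmod R \o u) by exact: measurable_cmod.
have a20 : 0 < a / 2 by rewrite divr_gt0.
pose G := [set y | a / 2 < cmod (u y)].
have mG : measurable G.
  rewrite (_ : G = (@cmod R \o u) @^-1` [set` `]a / 2, +oo[]); last first.
    by apply/seteqP; split => y /=; rewrite in_itv /= andbT.
  by rewrite -[X in measurable X]setTI; apply: mcu => //; exact: measurable_itv.
have muP : measurable_fun setT (fun y => (cmod (u y) `^ P)%:E).
  by apply/measurable_EFinP; exact: (measurableT_comp (measurable_powR P) mcu).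
have Gle : (mu3 G <= (4 * r ^+ 3)%:E)%E.
  rewrite r3 EFinM lee_pdivlMr ?powR_gt0// muleC.
  rewrite -(integral_cst mu3 mG); apply: le_trans un.
  apply: le_trans (ge0_subset_integral _ mG measurableT muP _ _) => //; last first.
    by move=> y _; rewrite lee_fin powR_ge0.
  apply: ge0_le_integral => //.
  - by move=> y _; rewrite lee_fin powR_ge0.
  - exact: measurable_funS muP.
  - move=> y Gy; rewrite lee_fin; apply: ge0_ler_powR; rewrite ?nnegrE ?cmod_ge0 ?ltW//.
pose D := box x r `\` G.
have mD : measurable D by apply: measurableD => //; exact: measurable_box.
have Dge : ((4 * r ^+ 3)%:E <= mu3 D)%E.
  have : (mu3 (box x r) <= mu3 D + mu3 G)%E.
    apply: le_trans (measureU2 _ mD mG); apply: le_measure; rewrite ?inE.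
    - exact: measurable_box.
    - exact: measurableU.
    - by move=> y By; have [Gy|nGy] := pselect (G y); [right|left].
  rewrite (leb3_box _ (ltW r0)) => /le_trans/(_ (leeD2l _ Gle)).
  have := measure_ge0 mu3 D; case: (mu3 D) => [t| |] //; last by move=> *; rewrite leey.
  by rewrite -EFinD !lee_fin => _ h; lra.
have mF : measurable_fun setT (fun y => (wpow K p (mdiff A u) (x, y))%:E).
  apply/measurable_EFinP.
  have mw := measurable_wpow p measurable_gagliardo_kernel (cmeasurable_mdiff cA mu).
  exact: (measurableT_comp mw (pair1_measurable x)).
have F0 y : (0 <= (wpow K p (mdiff A u) (x, y))%:E)%E.
  by rewrite lee_fin; apply: wpow_ge0; exact: gagliardo_kernel_ge0.
apply: (@le_trans _ _ (\int[mu3]_(y in D) (wpow K p (mdiff A u) (x, y))%:E)%E); last first.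
  by apply: ge0_subset_integral.
pose m := ((2 * r) `^ (3 + s * p))^-1 * (a / 2) `^ p.
have m0 : 0 <= m by rewrite mulr_ge0 ?invr_ge0 ?powR_ge0.
rewrite -rE -/m EFinM; apply: (@le_trans _ _ (m%:E * mu3 D)%E).
  by apply: lee_wpmul2l.
rewrite -(integral_cst mu3 mD); apply: ge0_le_integral => //.
- exact: measurable_funS mF.
move=> y [/boxP[b1 b2 b3] /negP]; rewrite -leNgt => uy.
rewrite lee_fin /m /wpow; apply: ler_pM; rewrite ?invr_ge0 ?powR_ge0//.
  (* A lower bound on the kernel is wanted, and the kernel is [0] on the diagonal;
     [|u y| <= |u x| / 2] with [u x != 0] rules out [x = y]. *)
  have xy : x != y.
    apply: contra_leN uy => /eqP <-; rewrite -/a ltr_pdivrMr// mulr2n mulrDr mulr1.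
    by rewrite ltrDl.
  have e0 : 0 < enorm (x - y).
    rewrite lt_neqAle enorm_ge0 andbT eq_sym; apply: contra_neq xy => /enorm0/eqP.
    by rewrite subr_eq0 => /eqP.
  have r20 : 0 < 2 * r by exact: mulr_gt0.
  have sp30 : 0 <= 3 + s * p by rewrite addr_ge0 ?ltW.
  have exy : enorm (x - y) <= 2 * r by apply: (enorm_le (ltW r0)); [exact: b1|exact: b2|exact: b3].
  have h : enorm (x - y) `^ (3 + s * p) <= (2 * r) `^ (3 + s * p).
    exact: (ge0_ler_powR sp30 (enorm_ge0 _) (ltW r20) exy).
  by rewrite lef_pV2 ?posrE; [exact: h|exact: powR_gt0|exact: powR_gt0].
have h : a / 2 <= cmod (mdiff A u (x, y)).
  by apply: le_trans (mdiff_ge _ _ _); rewrite -/a; lra.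
exact: (ge0_ler_powR (ltW p0) (ltW a20) (cmod_ge0 _) h).
Qed.

(** The pointwise bound is integrated in [x]: its left side becomes a multiple of [n^(-sp/3) n], and
    [1 - sp/3 = p/P]. *)
Lemma sobolev : exists2 C : R, 0 < C & forall u,
  wpow_finite mu3 (fun=> 1) P u ->
  wpow_finite (mu3 \x mu3)%E K p (mdiff A u) ->
  wpow_int mu3 (fun=> 1) P u `^ (p / P)
    <= C * wpow_int (mu3 \x mu3)%E K p (mdiff A u).
Proof.
pose c := (4 / 2 `^ (3 + s * p) * 4 `^ (s * p / 3) / 2 `^ P) : R.
have c0 : 0 < c by rewrite !(divr_gt0, mulr_gt0, powR_gt0).
exists c^-1; first by rewrite invr_gt0.
move=> u [mu Iu] [_ Im]; rewrite ler_pdivlMl//.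
set n := wpow_int _ _ _ u; set F := wpow_int _ _ _ _.
have : 0 <= n by apply: wpow_int_ge0.
rewrite le_eqVlt => /predU1P[n0|n0].
  rewrite -n0 powR0 ?mulr0 ?mulf_neq0 ?invr_eq0 ?gt_eqF//.
  by apply: wpow_int_ge0; exact: gagliardo_kernel_ge0.
have un : (\int[mu3]_y (cmod (u y) `^ P)%:E <= n%:E)%E.
  rewrite -(integrable_EFinK Iu) le_eqVlt; apply/orP; left; apply/eqP.
  by apply: eq_integral => y _; rewrite /wpow mul1r.
have H := sobolev_pointwise mu n0 un; rewrite -/c in H.
have mw := measurable_wpow p measurable_gagliardo_kernel (cmeasurable_mdiff cA mu).
have mwE : measurable_fun setT (fun z => (wpow K p (mdiff A u) z)%:E) by exact/measurable_EFinP.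
have w0 z : (0 <= (wpow K p (mdiff A u) z)%:E)%E.
  by rewrite lee_fin; apply: wpow_ge0; exact: gagliardo_kernel_ge0.
rewrite -lee_fin /F -(integrable_EFinK Im) (fubini_tonelli1 _ mwE w0).
have -> : c * n `^ (p / P) = c * n `^ (- (s * p / 3)) * n.
  rewrite -mulrA -{3}(powRr1 (ltW n0)) -powRD ?(gt_eqF n0) ?implybT//.
  congr (_ * _ `^ _); rewrite /pstar; field.
  by rewrite !gt_eqF//.
rewrite EFinM /n -(integrable_EFinK Iu) -ge0_integralZl//; last 3 first.
- exact: measurable_int Iu.
- by move=> y _; rewrite lee_fin; apply: wpow_ge0.
- by rewrite lee_fin mulr_ge0 ?powR_ge0 ?(ltW c0).
apply: ge0_le_integral => //.
- by move=> y _; rewrite -EFinM lee_fin !mulr_ge0 ?powR_ge0 ?(ltW c0)//.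
- apply/measurable_EFinP/measurable_funM; first exact: measurable_cst.
  by apply/measurable_EFinP; exact: measurable_int Iu.
- exact: measurable_fun_fubini_tonelli_F.
by move=> x _; rewrite -EFinM /wpow mul1r; exact: H.
Qed.

End Sobolev.

(** * Local compactness *)

Section AlmostEverywhereLimit.
Context d (T : measurableType d) (R : realType).
Variable mu : {measure set T -> \bar R}.

(** The sum over [n] of the increments restricted to [B n] has finite integral, hence is finite
    almost everywhere. Each point lies in [B n] for all large [n], so only finitely many increments
    escape this sum and the telescoping series converges absolutely. *)
Lemma ae_cvg_of_summable (v : nat -> T -> R) (B : nat -> set T) (c : R) :
  (forall n, measurable_fun setT (v n)) -> (forall n, measurable (B n)) ->
  (forall x, exists m, forall n, (m <= n)%N -> B n x) -> 0 <= c ->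
  (forall n, \int[mu]_(x in B n) (`|v n.+1 x - v n x|)%:E <= (c / 2 ^+ n)%:E)%E ->
  exists (Z : set T) (f : T -> R), [/\ measurable Z, mu Z = 0%E, measurable_fun setT f &
    forall x, ~ Z x -> v n x @[n --> \oo] --> f x].
Proof.
move=> mv mB exB c0 vB.
pose h n x : R := `|v n.+1 x - v n x| * \1_(B n) x.
have h0 n x : 0 <= h n x by rewrite mulr_ge0.
have mh n : measurable_fun setT (h n).
  apply: measurable_funM; last exact: measurable_indic.
  by apply: measurableT_comp => //; apply: measurable_funB.
have mhE n : measurable_fun setT (fun x => (h n x)%:E) by exact/measurable_EFinP.
have h0E n x : setT x -> (0 <= (h n x)%:E)%E by rewrite lee_fin.
pose S x := (\sum_(0 <= n <oo) (h n x)%:E)%E.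
have mS : measurable_fun setT S.
  by apply: ge0_emeasurable_sum => // n x _ _; rewrite lee_fin.
have S0 x : (0 <= S x)%E by apply: nneseries_ge0 => n _ _; rewrite lee_fin.
have Soo : (\int[mu]_x S x < +oo)%E.
  rewrite integral_nneseries//.
  apply: (@le_lt_trans _ _ (\sum_(0 <= n <oo) (2 * c / (2 ^ (n + 1))%:R)%:E)%E).
    apply: lee_nneseries => [n _ _|n _].
      by apply: integral_ge0 => x _; rewrite lee_fin.
    apply: le_trans (le_trans (vB n) _); last first.
      rewrite lee_fin addn1 natrX exprS invfM mulrACA divff// mul1r.
      by rewrite lexx.
    rewrite [X in (_ <= X)%E]integral_mkcond le_eqVlt; apply/orP; left; apply/eqP.
    apply: eq_integral => x _; rewrite /h patchE indicE.
    by case: (x \in B n); rewrite ?mulr1 ?mulr0.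
  have := @cvg_geometric_eseries_half R (2 * c) 0.
  by move/cvg_lim => ->//; rewrite ltry.
have IS : mu.-integrable setT S.
  by apply/integrableP; split => //; under eq_integral do rewrite gee0_abs//.
have [Z [mZ Z0 ZS]] := integrable_ae measurableT IS.
have cv x : ~ Z x -> cvgn (fun n => v n x).
  move=> nZ; have Sx : S x \is a fin_num.
    by apply: contrapT => nS; apply: nZ; apply: ZS => /= /(_ Logic.I).
  have [m mP] := exB x.
  suff : cvgn (series (telescope (fun n => v n x))).
    move=> /(is_cvgD (is_cvg_cst (v 0%N x))); rewrite telescopeK.
    rewrite (_ : (fun n => v n x) = cst (v 0%N x) + [sequence v n x - v 0%N x]_n)//.
    by apply/funext => n; rewrite /= fctE addrC subrK.
  apply: normed_cvg; apply: nondecreasing_is_cvgn.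
    apply/nondecreasing_seqP => n /=.
    by rewrite /series /= big_nat_recr//= lerDl.
  exists (fine (S x) + \sum_(0 <= k < m) `|v k.+1 x - v k x|) => _ [n _ <-].
  rewrite /series /=.
  have hS : \sum_(0 <= k < n) h k x <= fine (S x).
    rewrite -lee_fin fineK// -sumEFin; apply: nneseries_lim_ge => k _ _.
    by rewrite lee_fin.
  apply: le_trans (lerD hS (lexx _)).
  have hm k : `|v k.+1 x - v k x| <= h k x + (if (k < m)%N then `|v k.+1 x - v k x| else 0).
    case: ltnP => km; first by rewrite lerDr.
    by rewrite addr0 /h indicE mem_set ?mulr1//; exact: mP.
  apply: (le_trans (ler_sum _ (fun k _ => hm k))).
  rewrite big_split /= lerD2l -big_mkcond /=.
  have [nm|mn] := leqP n m.
    rewrite [X in _ <= X](big_cat_nat (leq0n n) nm)//=.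
    rewrite big_nat_cond (eq_bigl (fun k => (0 <= k < n)%N && true)); last first.
      by move=> k; rewrite /= andbT; case: ltnP => //= kn; rewrite (leq_trans kn).
    by rewrite -big_nat_cond lerDl sumr_ge0.
  rewrite (big_cat_nat (leq0n m) (ltnW mn))//= [X in _ + X]big1_seq ?addr0; last first.
    by move=> k /andP[km]; rewrite mem_index_iota leqNgt km.
  rewrite big_mkcond big_nat_cond [X in _ <= X]big_nat_cond; apply: ler_sum => k.
  by rewrite andbT => /andP[_ ->].
(* Replaced by [0] on [Z], the sequence converges everywhere, so its limit is measurable. *)
pose f x := limn (fun n => if x \in Z then 0 else v n x).
have ff x : (if x \in Z then 0 else v n x) @[n --> \oo] --> f x.
  rewrite /f; case: (boolP (x \in Z)) => xZ.
    rewrite (_ : limn _ = 0); first exact: cvg_cst.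
    exact: (@lim_cst R).
  by apply: cv => Zx; rewrite mem_set in xZ.
exists Z, f; split => //; last first.
  by move=> x nZ; have := ff x; rewrite memNset.
apply: (measurable_fun_cvg (h := fun n x => if x \in Z then 0 else v n x)) => [n|x _]; last exact: ff.
apply: (eq_measurable_fun (fun x => v n x * \1_(~` Z) x)) => [x _|].
  by rewrite indicE in_setC; case: (x \in Z); rewrite ?mulr0 ?mulr1.
by apply: measurable_funM => //; apply: measurable_indic; exact: measurableC.
Qed.

End AlmostEverywhereLimit.

Section Diagonal.
Variables (R : realType) (I : countType).

(* Convergence along a nonprincipal ultrafilter replaces nested subsequences. *)
Lemma bounded_diagonal (a : I -> nat -> R) :
  (forall i, exists M : R, forall n, `|a i n| <= M) ->
  exists (g : nat -> nat) (l : I -> R), (forall n, (n <= g n)%N) /\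
    forall i, a i (g n) @[n --> \oo] --> l i.
Proof.
move=> aM; have [U [uU ooU]] := @ultraFilterLemma nat \oo _.
have exl i : exists l : R, forall e, 0 < e -> U [set n | `|a i n - l| < e].
  have [M HM] := aM i.
  have FU : (a i @ U) [set` `[- M, M]].
    by apply: (@filterE _ U) => n /=; rewrite in_itv /= -ler_norml.
  have [l [_ cl]] := @segment_compact R (- M) M (a i @ U) _ FU.
  exists l => e e0.
  have [//|nU] := in_ultra_setVsetC [set n | `|a i n - l| < e] uU.
  have [y [/= + ly]] := cl [set y | ~ (`|y - l| < e)] (ball l e) nU (nbhsx_ballx _ _ e0).
  by rewrite distrC; case.
have [l Hl] := choice exl.
(* Only finitely many [i] have [pickle i <= m], and a filter is closed under finite intersections. A
   point [n >= m] of this set will serve as [g m]. *)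
have key m : U [set n | forall i, (pickle i <= m)%N -> `|a i n - l i| < m.+1%:R^-1].
  have m0 : 0 < m.+1%:R^-1 :> R by [].
  have : forall k, U [set n | forall i, (pickle i < k)%N -> `|a i n - l i| < m.+1%:R^-1].
    elim=> [|k IH]; first by apply: filterE.
    have : U [set n | forall i, pickle i = k -> `|a i n - l i| < m.+1%:R^-1].
      case E : (@pickle_inv I k) => [i|].
        apply: filterS (Hl i _ m0) => n /= Hn j jk.
        have : pickle_inv (pickle j) = Some i by rewrite jk.
        by rewrite pickleK_inv => -[->].
      apply: filterE => n j jk.
      by have := pickleK_inv j; rewrite jk E.
    move: IH; apply: filterS2 => n h1 h2 i; rewrite ltnS leq_eqVlt => /predU1P[/h2//|/h1//].
  by move=> /(_ m.+1).
have exg m : exists n, (m <= n)%N /\ forall i, (pickle i <= m)%N -> `|a i n - l i| < m.+1%:R^-1.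
  have Um : U [set n | (m <= n)%N] by apply: ooU; exists m.
  by have [n [h1 h2]] := filter_ex (filterI Um (key m)); exists n.
have [g Hg] := choice exg.
exists g, l; split => [n|i]; first by have [] := Hg n.
apply/cvgrPdist_lt => e e0.
have := @cvg_harmonic R => /cvgrPdist_lt/(_ e e0) he.
near=> n; have [_ /(_ i)] := Hg n; rewrite distrC => H.
apply: lt_le_trans (H _) _; first by near: n; exists (pickle i).
have : `|0 - harmonic n| < e by near: n.
by rewrite sub0r normrN ger0_norm//= => /ltW.
Unshelve. all: by end_near. Qed.

End Diagonal.

(** * Dyadic cells *)

Section DyadicCells.
Variable R : realType.
Local Notation mu3 := (@leb3 R).
Implicit Types (x y : R3 R) (j : nat).

(** The dyadic cube of side [2^-j] around [x] is coded by integers, so that functions constant on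
    cells factor through a countable type. *)
Definition cell_index j x : int * int * int :=
  (Num.floor (2 ^+ j * x.1.1), Num.floor (2 ^+ j * x.1.2), Num.floor (2 ^+ j * x.2)).

Definition cell j (k : int * int * int) : set (R3 R) := [set x | cell_index j x = k].

Let side j (k : int) : set R :=
  [set` `[2 ^- j * k%:~R, 2 ^- j * (k + 1)%:~R[ ].

Lemma cellE j k : cell j k = (side j k.1.1 `*` side j k.1.2) `*` side j k.2.
Proof.
have j0 : 0 < 2 ^+ j :> R by exact: exprn_gt0.
have h (t : R) m : (Num.floor (2 ^+ j * t) == m) = (t \in `[2 ^- j * m%:~R, 2 ^- j * (m + 1)%:~R[).
  by rewrite floor_eq in_itv /= ler_pdivrMl// ltr_pdivlMl.
apply/seteqP; split => -[[x1 x2] x3]; rewrite /cell /cell_index /side /=.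
  by move=> <-; rewrite /= -!h.
by case: k => -[k1 k2] k3 /= [[]]; rewrite -!h => /eqP <- /eqP <- /eqP <-.
Qed.

Lemma measurable_cell j k : measurable (cell j k).
Proof. by rewrite cellE; apply: measurableX; [apply: measurableX|]; exact: measurable_itv. Qed.

Lemma leb3_cell j k : mu3 (cell j k) = ((8 ^+ j)^-1)%:E.
Proof.
have j0 : 0 < 2 ^- j :> R by rewrite invr_gt0 exprn_gt0.
have h m : leb1 (side j m) = (2 ^- j)%:E.
  rewrite /leb1 /side lebesgue_measure_itv /= lte_fin ltr_pM2l// ltr_int ltrDl ltr01.
  by rewrite -EFinB -mulrBr intrD addrAC subrr add0r mulr1.
have mside m : measurable (side j m) by exact: measurable_itv.
rewrite cellE /leb3 product_measure1E//=; last exact: measurableX.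
rewrite /leb2 product_measure1E//= !h -!EFinM; congr EFin.
rewrite -!invfM -!exprMn; congr ((_ ^+ _)^-1); ring.
Qed.

Lemma cell_close j x y : cell_index j x = cell_index j y ->
  [/\ `|x.1.1 - y.1.1| <= 2 ^- j, `|x.1.2 - y.1.2| <= 2 ^- j & `|x.2 - y.2| <= 2 ^- j].
Proof.
have j0 : 0 < 2 ^+ j :> R by exact: exprn_gt0.
have h (t t' : R) : Num.floor (2 ^+ j * t) = Num.floor (2 ^+ j * t') -> `|t - t'| <= 2 ^- j.
  move=> e; have := floor_itv (2 ^+ j * t); have := floor_itv (2 ^+ j * t').
  rewrite e intrD => /andP[h1 h2] /andP[h3 h4].
  rewrite -[2 ^- j]mulr1 ler_pdivlMl// -{1}(gtr0_norm j0) -normrM mulrBr ler_norml.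
  by apply/andP; split; lra.
by case=> /h h1 /h h2 /h h3.
Qed.

Lemma measurable_cell_fun j (psi : int * int * int -> R) :
  measurable_fun setT (psi \o cell_index j).
Proof.
move=> _ Y mY; rewrite setTI.
rewrite (_ : _ @^-1` _ = \bigcup_k (if `[< Y (psi k) >] then cell j k else set0)).
  apply: countable_bigcupT_measurable; first exact: countableP.
  by move=> k; case: asboolP => // _; exact: measurable_cell.
apply/seteqP; split => [x /= Yx|x [k _]].
  by exists (cell_index j x) => //; case: asboolP.
by case: asboolP => // Yk /= xk; rewrite /preimage /= xk.
Qed.

Lemma measurable_same_cell j :
  measurable_fun setT (fun z : R3 R * R3 R => (cell_index j z.1 == cell_index j z.2)%:R : R).
Proof.
pose W := \bigcup_k (cell j k `*` cell j k).
have mW : measurable W.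
  apply: countable_bigcupT_measurable; first exact: countableP.
  by move=> k; apply: measurableX; exact: measurable_cell.
apply: (eq_measurable_fun (\1_W : _ -> R)); last exact: measurable_indic.
move=> z _; rewrite indicE; congr (_%:R); congr nat_of_bool; apply/idP/idP.
  by rewrite inE => -[k _ [/= e1 e2]]; rewrite e1 e2.
by move=> /eqP e; rewrite inE; exists (cell_index j z.1) => //; split.
Qed.

Lemma cell_sub_box j (m : nat) x y : box 0 m%:R x -> cell_index j x = cell_index j y ->
  box 0 m.+1%:R y.
Proof.
move=> /boxP /= [b1 b2 b3] /cell_close[c1 c2 c3]; apply/boxP => /=.
have j1 : 2 ^- j <= 1 :> R by rewrite invf_le1 ?exprn_gt0// exprn_ege1// ler1n.
have h (t t' : R) : `|0 - t| <= m%:R -> `|t - t'| <= 2 ^- j -> `|0 - t'| <= m.+1%:R.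
  move=> h1 h2.
  have -> : m.+1%:R = m%:R + 1 :> R by rewrite natr1.
  have -> : 0 - t' = (0 - t) + (t - t') by ring.
  exact: le_trans (ler_normD _ _) (lerD h1 (le_trans h2 j1)).
by split; [exact: h b1 c1|exact: h b2 c2|exact: h b3 c3].
Qed.

End DyadicCells.

Lemma integrable_cst_finite d (T : measurableType d) (R : realType)
    (mu : {measure set T -> \bar R}) (D : set T) (c : R) :
  measurable D -> (mu D < +oo)%E -> mu.-integrable D (EFin \o (fun=> c)).
Proof.
move=> mD Doo; apply/integrableP; split; first exact: measurable_cst.
rewrite (_ : (fun x => _) = cst `|c|%:E)// integral_cst// lte_mul_pinfty//.
Qed.

Section LocalCompactness.
Variable R : realType.
Local Notation mu3 := (@leb3 R).
Local Notation B m := (box (0 : R3 R) m%:R).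
Implicit Types (x y : R3 R) (j m : nat) (f : R3 R -> R).

Definition cell_average j f x : R :=
  8 ^+ j * \int[mu3]_(y in cell j (cell_index j x)) f y.

(** [8^j] is the inverse volume of a cell. The cell enters as an indicator on the product space, so
    that measurability of the mean oscillation in [x] follows from Tonelli's theorem. *)
Definition cell_osc_kernel j f (z : R3 R * R3 R) : R :=
  8 ^+ j * (cell_index j z.1 == cell_index j z.2)%:R * `|f z.1 - f z.2|.

Definition cell_osc j f x : \bar R :=
  (\int[mu3]_y (cell_osc_kernel j f (x, y))%:E)%E.

Lemma cell_osc_kernel_ge0 j f z : 0 <= cell_osc_kernel j f z.
Proof. by rewrite !mulr_ge0// exprn_ge0. Qed.

Lemma measurable_cell_osc_kernel j f : measurable_fun setT f ->
  measurable_fun setT (cell_osc_kernel j f).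
Proof.
move=> mf; apply: measurable_funM.
  apply: measurable_funM; first exact: measurable_cst.
  exact: measurable_same_cell.
apply: measurableT_comp => //; apply: measurable_funB.
  exact: (measurableT_comp mf measurable_fst).
exact: (measurableT_comp mf measurable_snd).
Qed.

Lemma measurable_cell_osc j f : measurable_fun setT f ->
  measurable_fun setT (cell_osc j f).
Proof.
move=> mf; apply: (measurable_fun_fubini_tonelli_F
  (fun z => (cell_osc_kernel j f z)%:E)).
  by apply/measurable_EFinP; exact: measurable_cell_osc_kernel.
by move=> z; rewrite lee_fin cell_osc_kernel_ge0.
Qed.

Lemma cell_average_dist j f x : measurable_fun setT f ->
  mu3.-integrable (cell j (cell_index j x)) (EFin \o f) ->
  ((`|f x - cell_average j f x|)%:E <= cell_osc j f x)%E.
Proof.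
move=> mf If; pose C := @cell R j (cell_index j x).
have j0 : 0 < 8 ^+ j :> R by exact: exprn_gt0.
have mC : measurable C by exact: measurable_cell.
have Coo : (mu3 C < +oo)%E by rewrite leb3_cell ltry.
have Ic : mu3.-integrable C (EFin \o (fun=> f x)).
  exact: integrable_cst_finite.
have ID : mu3.-integrable C (EFin \o (fun y => f x - f y)).
  by have := integrableB mC Ic If.
have -> : f x - cell_average j f x = 8 ^+ j * \int[mu3]_(y in C) (f x - f y).
  have fC : fine (mu3 C) = (8 ^+ j)^-1 by rewrite /C leb3_cell.
  rewrite RintegralB// Rintegral_cst// [fine _]fC /cell_average mulrBr; congr (_ - _).
  by rewrite mulrCA divff ?mulr1// gt_eqF.
rewrite normrM (gtr0_norm j0).
have H := le_normr_Rintegral mC ID.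
apply: (@le_trans _ _ (8 ^+ j * \int[mu3]_(y in C) `|f x - f y|)%:E).
  by rewrite lee_fin ler_pM2l.
have IN : mu3.-integrable C (EFin \o (fun y => `|f x - f y|)) by exact: integrable_norm.
rewrite -RintegralZl// /Rintegral fineK; last first.
  apply: (integrable_fin_num mC); exact: (integrableZl mC _ IN).
rewrite integral_mkcond /cell_osc le_eqVlt; apply/orP; left; apply/eqP.
apply: eq_integral => y _; rewrite patchE /cell_osc_kernel /=.
have -> : (y \in C) = (cell_index j x == cell_index j y).
  apply/idP/eqP => [|xy]; first by rewrite inE => ->.
  by rewrite inE; exact: esym xy.
by case: eqP => _; rewrite ?mulr1 ?mulr0 ?mul0r.
Qed.

Lemma box_exhaust x : exists m, forall n, (m <= n)%N -> B n x.
Proof.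
have [m Hm] : exists m : nat, `|x| <= m%:R.
  by exists (Num.truncn `|x|).+1; rewrite ltW// truncnS_gt.
exists m => n mn; have {Hm} : `|x| <= n%:R by apply: le_trans Hm _; rewrite ler_nat.
rewrite !prod_normE !ge_max => /andP[/andP[h1 h2] h3].
by apply/boxP; rewrite !sub0r !normrN.
Qed.

Lemma cell_in_box j k : exists m, cell j k `<=` B m.
Proof.
have [[x xk]|nk] := pselect (exists x : R3 R, cell j k x); last first.
  by exists 0%N => x xk; exfalso; apply: nk; exists x.
have [m /(_ m (leqnn m)) xm] := box_exhaust x; exists m.+1 => y yk.
exact: (cell_sub_box xm (etrans xk (esym yk))).
Qed.

Variable f_ : nat -> R3 R -> R.
Hypothesis mf : forall n, measurable_fun setT (f_ n).
Hypothesis f_bound : forall m, exists M : R, forall n,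
  (\int[mu3]_(x in B m) (`|f_ n x|)%:E <= M%:E)%E.
Hypothesis f_osc : forall m (e : R), 0 < e -> exists j, forall n,
  (\int[mu3]_(x in B m) cell_osc j (f_ n) x <= e%:E)%E.

Let mB m : measurable (B m). Proof. exact: measurable_box. Qed.

Let IB m n : mu3.-integrable (B m) (EFin \o f_ n).
Proof.
have [M /(_ n) HM] := f_bound m; apply/integrableP; split.
  by apply/measurable_EFinP; apply: measurable_funS (mf n).
by apply: le_lt_trans HM (ltry _).
Qed.

Let IC j k n : mu3.-integrable (cell j k) (EFin \o f_ n).
Proof.
have [m Hm] := cell_in_box j k.
by apply: integrableS (IB m n) => //; exact: measurable_cell.
Qed.

Let cell_bound m : exists M : R, forall j k n, cell j k `<=` B m ->
  `|\int[mu3]_(y in cell j k) f_ n y| <= M.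
Proof.
have [M HM] := f_bound m; exists M => j k n km.
have mc := @measurable_cell R j k.
apply: le_trans (le_normr_Rintegral mc (IC j k n)) _.
have IN : mu3.-integrable (cell j k) (EFin \o (fun y => `|f_ n y|)) by exact: integrable_norm.
rewrite -lee_fin /Rintegral fineK; last exact: integrable_fin_num IN.
apply: le_trans (HM n).
apply: ge0_subset_integral => //.
apply: measurable_funS (measurableT) _ _ => //.
by apply/measurable_EFinP; apply: measurableT_comp.
Qed.

(* The averages over the countably many dyadic cells converge along a diagonal
   subsequence; as each [f_ n] is close in [L^1(B m)] to its averages on fine
   cells, a further subsequence is summably Cauchy in every [L^1(B m)]. *)
Lemma local_compactness : exists (g : nat -> nat) (Z : set (R3 R)) (f : R3 R -> R),
  [/\ forall n, (n <= g n)%N, measurable Z, mu3 Z = 0%E, measurable_fun setT f &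
    forall x, ~ Z x -> f_ (g n) x @[n --> \oo] --> f x].
Proof.
pose a (i : nat * (int * int * int)) n : R := \int[mu3]_(y in cell i.1 i.2) f_ n y.
have [g0 [l [g0n al]]] : exists (g : nat -> nat) (l : nat * (int * int * int) -> R),
    (forall n, (n <= g n)%N) /\ forall i, a i (g n) @[n --> \oo] --> l i.
  apply: bounded_diagonal => -[j k]; have [m Hm] := cell_in_box j k.
  by have [M HM] := cell_bound m; exists M => n; apply: HM.
pose L j x := 8 ^+ j * l (j, cell_index j x).
have avgL j x : cell_average j (f_ (g0 n)) x @[n --> \oo] --> L j x.
  by apply: cvgM; [exact: cvg_cst|exact: (al (j, _))].
have mavg j n : measurable_fun setT (cell_average j (f_ n)).
  exact: (measurable_cell_fun j (fun k => 8 ^+ j * \int[mu3]_(y in cell j k) f_ n y)).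
have mL j : measurable_fun setT (L j).
  exact: (measurable_cell_fun j (fun k => 8 ^+ j * l (j, k))).
have cvL m j (e : R) : 0 < e -> exists N, forall n, (N <= n)%N ->
    (\int[mu3]_(x in B m) (`|cell_average j (f_ (g0 n)) x - L j x|)%:E <= e%:E)%E.
  (* Cells that meet [B m] lie in [B m.+1]; this gives a constant dominating all the averages on
     [B m]. *)
  move=> e0; have [M HM] := cell_bound m.+1.
  have mavgE n : measurable_fun (B m) (EFin \o cell_average j (f_ (g0 n))).
    by apply/measurable_EFinP; exact: measurable_funS (mavg j (g0 n)).
  have mLE : measurable_fun (B m) (EFin \o L j).
    by apply/measurable_EFinP; exact: measurable_funS (mL j).
  have cvE x : B m x -> (EFin \o cell_average j (f_ (g0 n))) x @[n --> \oo] --> (EFin \o L j) x.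
    by move=> _; apply: cvg_EFin; [exact: nearW|exact: avgL].
  have Icst : mu3.-integrable (B m) (EFin \o (fun=> 8 ^+ j * M)).
    have Boo : (mu3 (B m) < +oo)%E by rewrite leb3_box// ltry.
    exact: integrable_cst_finite.
  have dom x n : B m x -> (`|(EFin \o cell_average j (f_ (g0 n))) x| <= (8 ^+ j * M)%R%:E)%E.
    move=> Bx; rewrite /= lee_fin normrM ger0_norm ?exprn_ge0//.
    apply: ler_wpM2l; first by rewrite exprn_ge0.
    by apply: HM => y yk; exact: cell_sub_box Bx (esym yk).
  have [_ + _] := dominated_convergence (mB m) mavgE mLE
    (aeW _ cvE) Icst (aeW _ dom).
  move=> /fine_cvgP[fin /cvgrPdist_lt/(_ e e0)] H.
  have [N _ HN] := filterI fin H; exists N => n Nn; have [/= h1 h2] := HN n Nn.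
  rewrite -(fineK h1) lee_fin; move: h2; rewrite sub0r normrN => /ltW.
  exact: le_trans (ler_norm _).
have tri (D : set (R3 R)) (h1 h2 h3 : R3 R -> R) (e1 e2 : R) : measurable D ->
    measurable_fun setT h1 -> measurable_fun setT h2 -> measurable_fun setT h3 ->
    (\int[mu3]_(x in D) (`|h1 x - h2 x|)%:E <= e1%:E)%E ->
    (\int[mu3]_(x in D) (`|h2 x - h3 x|)%:E <= e2%:E)%E ->
    (\int[mu3]_(x in D) (`|h1 x - h3 x|)%:E <= (e1 + e2)%:E)%E.
  move=> mD m1 m2 m3 H1 H2.
  have mdf (k k' : R3 R -> R) : measurable_fun setT k -> measurable_fun setT k' ->
      measurable_fun D (fun x => (`|k x - k' x|)%:E).
    move=> mk mk'; apply/measurable_EFinP; apply: (@measurable_funS _ _ _ _ setT) => //.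
    by apply: measurableT_comp => //; exact: measurable_funB.
  rewrite EFinD; apply: le_trans (leeD H1 H2).
  rewrite -ge0_integralD//; [|exact: mdf|exact: mdf].
  apply: ge0_le_integral => //; [exact: mdf| |].
    by apply: emeasurable_funD; exact: mdf.
  move=> x _; rewrite -EFinD lee_fin (_ : h1 x - h3 x = (h1 x - h2 x) + (h2 x - h3 x)); last ring.
  exact: ler_normD.
have step m : exists jn : nat * nat, forall n, (jn.2 <= n)%N ->
    (\int[mu3]_(x in B m) (`|f_ (g0 n) x - L jn.1 x|)%:E <= (2 / 2 ^+ m)%:E)%E.
  have e0 : 0 < (2 ^+ m)^-1 :> R by rewrite invr_gt0 exprn_gt0.
  have [j Hj] := f_osc m e0; have [N HN] := cvL m j _ e0.
  exists (j, N) => n /= Nn.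
  rewrite mulr2n mulrDl mul1r; apply: (tri _ _ (cell_average j (f_ (g0 n)))) => //; last exact: HN.
  apply: le_trans (Hj (g0 n)); apply: ge0_le_integral => //.
  - apply/measurable_EFinP; apply: (@measurable_funS _ _ _ _ setT) => //.
    by apply: measurableT_comp => //; exact: measurable_funB.
  - by apply: (@measurable_funS _ _ _ _ setT) => //; exact: measurable_cell_osc.
  - by move=> x _; apply: cell_average_dist => //; exact: IC.
have [jn Hjn] := choice step.
(* The partial sum makes both [N m] and [N m.+1] exceed the threshold [(jn m).2], so [v m] and
   [v m.+1] are both close to the same [L (jn m).1]; the summand [m] keeps the extraction above the
   identity. *)
pose N m := (\sum_(i < m.+1) (jn i).2 + m)%N.
have N1 m : ((jn m).2 <= N m)%N.
  by rewrite /N big_ord_recr /= -addnA addnCA leq_addr.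
have N2 m : ((jn m).2 <= N m.+1)%N.
  by rewrite /N 2!big_ord_recr /= -!addnA addnCA leq_addr.
pose v m := f_ (g0 (N m)).
have v4 m : (\int[mu3]_(x in B m) (`|v m.+1 x - v m x|)%:E <= (4 / 2 ^+ m)%:E)%E.
  rewrite (_ : 4 / 2 ^+ m = 2 / 2 ^+ m + 2 / 2 ^+ m :> R); last first.
    by rewrite -mulrDl; congr (_ / _); ring.
  apply: (tri _ _ (L (jn m).1)) => //; [exact: mf|exact: mf|exact: Hjn|].
  by under eq_integral do rewrite distrC; exact: Hjn.
have [Z [f [mZ Z0 mff vf]]] := ae_cvg_of_summable (fun m => mf (g0 (N m))) mB box_exhaust (ler0n R 4) v4.
exists (fun m => g0 (N m)), Z, f; split => // m.
by apply: leq_trans (g0n _); exact: leq_addl.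
Qed.

End LocalCompactness.

Section CisLipschitz.
Variable R : realType.

Lemma mvt_lipschitz (f df : R -> R) (t : R) :
  (forall x : R, is_derive x 1 f (df x)) -> (forall x, `|df x| <= 1) ->
  `|f t - f 0| <= `|t|.
Proof.
move=> fdf df1; have cf : continuous f.
  move=> x; apply: differentiable_continuous; apply/derivable1_diffP.
  by have [] := fdf x.
have key (a b : R) : a <= b -> `|f b - f a| <= b - a.
  move=> ab.
  have [c _ ->] := MVT_segment ab (fun x _ => fdf x) (continuous_subspaceT cf).
  have ba : 0 <= b - a by rewrite subr_ge0.
  by rewrite normrM (ger0_norm ba) -[leRHS]mul1r; apply: ler_wpM2r.
have [t0|t0] := leP 0 t.
  by have := key _ _ t0; rewrite subr0 (ger0_norm t0).
by have := key _ _ (ltW t0); rewrite sub0r (ltr0_norm t0) distrC.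
Qed.

(** Both coordinates are bounded by [|t|] through the mean value theorem, which costs the factor
    [2]. *)
Lemma cis_lipschitz (t : R) : cmod (1 - cis t) <= 2 * `|t|.
Proof.
have hs : `|sin t| <= `|t|.
  have := @mvt_lipschitz sin cos t (@is_derive_sin R) (@cos_max R).
  by rewrite sin0 subr0.
have hc : `|1 - cos t| <= `|t|.
  have := @mvt_lipschitz cos (fun x => - sin x) t (@is_derive_cos R).
  rewrite cos0 distrC; apply => x.
  by rewrite normrN ler_norml sin_le1 sin_geN1.
rewrite -ler_sqr ?nnegrE ?cmod_ge0 ?mulr_ge0// cmod_sqr /= sub0r sqrrN.
have h (x : R) : `|x| <= `|t| -> x ^+ 2 <= `|t| ^+ 2.
  by rewrite -[x ^+ 2]real_normK ?num_real// ler_sqr ?nnegrE.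
have := h _ hs; have := h _ hc; have := sqr_ge0 `|t|.
by move=> H0 H1 H2; rewrite exprMn; lra.
Qed.

End CisLipschitz.

(** * Oscillation of functions of bounded magnetic energy *)

Section MagneticOscillation.
Variable R : realType.
Variables (s p : R) (A : R3 R -> R3 R).
Hypotheses (s0 : 0 < s) (p1 : 1 < p) (sp3 : s * p < 3) (cA : continuous A).
Local Notation mu3 := (@leb3 R).
Local Notation P := (pstar s p).
Local Notation K := (gagliardo_kernel s p).
Local Notation B m := (box (0 : R3 R) m%:R).
Implicit Types (u : R3 R -> R[i]) (f : R3 R -> R) (m j : nat).

Let p0 : 0 < p. Proof. exact: lt_trans p1. Qed.
Let sp0 : 0 < s * p. Proof. exact: mulr_gt0. Qed.
Let P1 : 1 < P. Proof. exact: lt_trans p1 (pstar_gt s0 p1 sp3). Qed.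

(** The price for removing the phase is proportional to [|x - y|] where [A] is bounded, hence
    negligible inside small cells. The bound on [||u x| - |u y||] alone would give no limit for the
    phases of [u]. *)
Lemma mdiff_dist u x y : cmod (u x - u y) <= cmod (mdiff A u (x, y)) +
  2 * `|dot (x - y) (A (2^-1 *: (x + y)))| * cmod (u x).
Proof.
have -> : u x - u y = mdiff A u (x, y) +
    (1 - cis (- dot (x - y) (A (2^-1 *: (x + y))))) * u x.
  by rewrite /mdiff /=; ring.
apply: le_trans (cmodD _ _) _; rewrite lerD2l cmodM ler_wpM2r ?cmod_ge0//.
by apply: le_trans (cis_lipschitz _) _; rewrite normrN.
Qed.

Lemma mdiff_diag u x : mdiff A u (x, x) = 0.
Proof.
rewrite /mdiff /= subrr dotE /= !mul0r !addr0 oppr0.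
by rewrite (_ : cis 0 = 1) ?mul1r ?subrr// /cis cos0 sin0.
Qed.

Lemma dot_le x y (e a : R) : 0 <= e ->
  [/\ `|x.1.1| <= e, `|x.1.2| <= e & `|x.2| <= e] ->
  [/\ `|y.1.1| <= a, `|y.1.2| <= a & `|y.2| <= a] ->
  `|dot x y| <= 3 * (e * a).
Proof.
move=> e0 [x1 x2 x3] [y1 y2 y3]; rewrite dotE.
have h (b c : R) : `|b| <= e -> `|c| <= a -> `|b * c| <= e * a.
  by move=> h1 h2; rewrite normrM ler_pM.
rewrite (_ : 3 * (e * a) = e * a + e * a + e * a); last ring.
apply: le_trans (ler_normD _ _) (lerD (le_trans (ler_normD _ _) (lerD _ _)) _);
  exact: h.
Qed.

Lemma mid_in_box m j (x y : R3 R) : B m x -> cell_index j x = cell_index j y ->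
  B m.+1 (2^-1 *: (x + y)).
Proof.
move=> Bx xy; have /boxP[/= y1 y2 y3] := cell_sub_box Bx xy.
have /boxP[/= x1 x2 x3] := Bx; apply/boxP => /=.
have h (t t' : R) : `|0 - t| <= m%:R -> `|0 - t'| <= m.+1%:R -> `|0 - 2^-1 * (t + t')| <= m.+1%:R.
  have -> : m.+1%:R = m%:R + 1 :> R by rewrite natr1.
  rewrite !sub0r !normrN normrM gtr0_norm// => h1 h2.
  by have := ler_normD t t' => h3; rewrite mulrC ler_pdivrMr//; lra.
by split; exact: h.
Qed.

(* By Young, [D <= delta + delta^(1-p) D^p], and [D^p] is at most
   [(2 t)^(3 + s p)] times the Gagliardo integrand when [x], [y] are in the
   same cell of side [t]. *)
Lemma osc_kernel_le m j u f (a de : R) x y : 0 <= a -> 0 < de ->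
  (forall x, B m.+1 x -> [/\ `|(A x).1.1| <= a, `|(A x).1.2| <= a & `|(A x).2| <= a]) ->
  (forall x y, `|f x - f y| <= cmod (u x - u y)) -> B m x ->
  cell_osc_kernel j f (x, y) <=
    (de + 6 * a * 2 ^- j * cmod (u x)) * (8 ^+ j * (cell_index j x == cell_index j y)%:R)
    + de `^ (1 - p) * (8 ^+ j * (2 * 2 ^- j) `^ (3 + s * p)) * wpow K p (mdiff A u) (x, y).
Proof.
move=> a0 de0 Aa fu Bx; rewrite /cell_osc_kernel /=.
have j0 : 0 < 2 ^- j :> R by rewrite invr_gt0 exprn_gt0.
have e80 : 0 <= 8 ^+ j :> R by exact: exprn_ge0.
have w0 : 0 <= wpow K p (mdiff A u) (x, y) by apply: wpow_ge0; exact: gagliardo_kernel_ge0.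
have c0 : 0 <= de `^ (1 - p) * (8 ^+ j * (2 * 2 ^- j) `^ (3 + s * p)).
  by rewrite !mulr_ge0 ?powR_ge0.
case: eqP => [xy|_]; last by rewrite !mulr0 mul0r add0r mulr_ge0.
rewrite !mulr1; set D := cmod (mdiff A u (x, y)).
have D0 : 0 <= D by exact: cmod_ge0.
have h1 : `|f x - f y| <= D + 6 * a * 2 ^- j * cmod (u x).
  apply: le_trans (fu x y) (le_trans (mdiff_dist _ _ _) _).
  rewrite lerD2l ler_wpM2r ?cmod_ge0//.
  have h := @dot_le (x - y) _ _ _ (ltW j0) (cell_close xy) (Aa _ (mid_in_box Bx xy)).
  by move: h; set X := `|dot _ _| => h; lra.
have h2 : D <= de + de `^ (1 - p) * D `^ p.
  have [Dde|deD] := leP D de.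
    by rewrite (le_trans Dde)// lerDl mulr_ge0// powR_ge0.
  apply: (@le_trans _ _ (de `^ (1 - p) * D `^ p)); last by rewrite lerDr ltW.
  have D0' : 0 < D by exact: lt_trans deD.
  apply: (@le_trans _ _ (D `^ (1 - p) * D `^ p)).
    by rewrite -powRD ?(gt_eqF D0') ?implybT// subrK powRr1.
  apply: ler_wpM2r; first exact: powR_ge0.
  rewrite -(opprB p 1) !powRN lef_pV2 ?posrE ?powR_gt0//.
  by apply: ge0_ler_powR; rewrite ?nnegrE ?subr_ge0 ?(ltW p1) ?(ltW de0) ?(ltW deD).
have h3 : D `^ p <= (2 * 2 ^- j) `^ (3 + s * p) * wpow K p (mdiff A u) (x, y).
  have [xye|xye] := eqVneq x y.
    rewrite (_ : D = 0) ?powR0 ?gt_eqF//; first by rewrite mulr_ge0 ?powR_ge0.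
    by rewrite /D xye mdiff_diag cmod0.
  have en0 : 0 < enorm (x - y).
    rewrite lt_neqAle enorm_ge0 andbT eq_sym; apply: contra_neq xye => /enorm0/eqP.
    by rewrite subr_eq0 => /eqP.
  rewrite /wpow mulrA -/D -[leLHS]mul1r ler_wpM2r ?powR_ge0//.
  rewrite /gagliardo_kernel /= ler_pdivlMr ?powR_gt0// mul1r.
  have [b1 b2 b3] := cell_close xy.
  have sp30 : 0 <= 3 + s * p by rewrite addr_ge0 ?ltW.
  have t0 : 0 <= 2 * 2 ^- j :> R by rewrite mulr_ge0 ?ltW.
  have ext : enorm (x - y) <= 2 * 2 ^- j.
    by apply: (enorm_le (ltW j0)); [exact: b1|exact: b2|exact: b3].
  exact: (ge0_ler_powR sp30 (enorm_ge0 _) t0 ext).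
have h4 : `|f x - f y| <= de + 6 * a * 2 ^- j * cmod (u x)
    + de `^ (1 - p) * ((2 * 2 ^- j) `^ (3 + s * p) * wpow K p (mdiff A u) (x, y)).
  have := ler_wpM2l (powR_ge0 de (1 - p)) h3; lra.
apply: le_trans (ler_wpM2l e80 h4) _; rewrite le_eqVlt; apply/orP; left; apply/eqP; ring.
Qed.

(** The factor [8^j] from averaging cancels the cube of the side; the remaining [2^(-spj)] is the
    decay that makes the oscillation small. *)
Lemma scale_powR j : 8 ^+ j * (2 * 2 ^- j) `^ (3 + s * p)
  = 2 `^ (3 + s * p) * (2^-1 `^ (s * p)) ^+ j.
Proof.
have j0 : 0 < 2 ^- j :> R by rewrite invr_gt0 exprn_gt0.
rewrite powRM ?(ltW j0)// mulrCA; congr (_ * _).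
rewrite powRD ?(gt_eqF j0) ?implybT// powR_mulrn ?(ltW j0)// mulrA.
rewrite -exprVn -exprM mulnC exprM -exprMn.
have -> : 8 * 2^-1 ^+ 3 = 1 :> R by field.
rewrite expr1n mul1r -!powR_mulrn ?powR_ge0// -!powRrM; congr (_ `^ _); ring.
Qed.

Lemma integral_same_cell j (x : R3 R) :
  (\int[mu3]_y (8 ^+ j * (cell_index j x == cell_index j y)%:R)%:E = 1)%E.
Proof.
have mc := @measurable_cell R j (cell_index j x).
under eq_integral.
  move=> y _.
  rewrite (_ : (cell_index j x == cell_index j y)%:R = \1_(cell j (cell_index j x)) y); last first.
    rewrite indicE; congr (_%:R); congr nat_of_bool; apply/eqP/idP.
      by move=> e; rewrite inE; exact: esym e.
    by rewrite inE => ->.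
  rewrite EFinM; over.
rewrite ge0_integralZl//; last by apply/measurable_EFinP; exact: measurable_indic.
rewrite integral_indic// setIT.
rewrite [X in (_ * X)%E](leb3_cell R j).
by rewrite -EFinM divff// gt_eqF// exprn_gt0.
Qed.

(** From [t <= 1 + t^P]; the first term of the bound is the volume of the box. *)
Lemma box_L1_bound m u (M : R) : wpow_finite mu3 (fun=> 1) P u ->
  wpow_int mu3 (fun=> 1) P u <= M ->
  (\int[mu3]_(x in B m) (cmod (u x))%:E <= (8 * m%:R ^+ 3 + M)%:E)%E.
Proof.
move=> [mu Iu] uM; have mB : measurable (B m) by exact: measurable_box.
have mw : measurable_fun setT (fun x => (wpow (fun=> 1) P u x)%:E) by exact: measurable_int Iu.
apply: (@le_trans _ _ (\int[mu3]_(x in B m) (1 + (wpow (fun=> 1) P u x)%:E))%E).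
  apply: ge0_le_integral => //.
  - by move=> x _; rewrite lee_fin cmod_ge0.
  - apply/measurable_EFinP; apply: (@measurable_funS _ _ _ _ setT) => //; exact: measurable_cmod.
  - by apply: emeasurable_funD; [exact: measurable_cst|exact: measurable_funS mw].
  move=> x _; rewrite -EFinD lee_fin /wpow mul1r.
  have [u1|u1] := leP (cmod (u x)) 1.
    by rewrite (le_trans u1)// lerDl powR_ge0.
  apply: (@le_trans _ _ (cmod (u x) `^ P)); last by rewrite lerDr.
  rewrite -{1}(powRr1 (cmod_ge0 (u x))).
  by apply: ler_powR; [exact: ltW|exact: ltW].
rewrite ge0_integralD//; last 2 first.
- by move=> x _; rewrite lee_fin; apply: wpow_ge0.
- exact: measurable_funS mw.
rewrite EFinD; apply: leeD.
  by rewrite integral_cst// mul1e [leLHS](leb3_box (0 : R3 R) (ler0n R m)).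
apply: (@le_trans _ _ (\int[mu3]_x (wpow (fun=> 1) P u x)%:E)%E).
  apply: ge0_subset_integral => //.
  by move=> x _; rewrite lee_fin; apply: wpow_ge0.
by rewrite (integrable_EFinK Iu) lee_fin.
Qed.

(** [osc_kernel_le] is integrated over [y] and then over [x] in the box, each of its three terms
    contributing at most [e / 3]. The level [j] depends on [u] only through [M], and [f] will be the
    real or the imaginary part of [u]. *)
Lemma magnetic_oscillation m (M e : R) : 0 <= M -> 0 < e -> exists j, forall u f,
  wpow_finite mu3 (fun=> 1) P u -> wpow_int mu3 (fun=> 1) P u <= M ->
  wpow_finite (mu3 \x mu3)%E K p (mdiff A u) ->
  wpow_int (mu3 \x mu3)%E K p (mdiff A u) <= M ->
  measurable_fun setT f -> (forall x y, `|f x - f y| <= cmod (u x - u y)) ->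
  (\int[mu3]_(x in B m) cell_osc j f x <= e%:E)%E.
Proof.
move=> M0 e0; have [a a0 Aa] := continuous_box_bounded (m.+1%:R) cA.
pose V : R := 8 * m%:R ^+ 3; have V0 : 0 <= V by rewrite mulr_ge0 ?exprn_ge0.
pose de := e / 3 / (V + 1).
have V1 : 0 < V + 1 by rewrite ltr_wpDl.
have de0 : 0 < de by rewrite !divr_gt0.
have deV : de * V <= e / 3.
  by rewrite /de mulrAC ler_pdivrMr// ler_wpM2l ?divr_ge0 ?(ltW e0)// lerDl.
have e30 : 0 < e / 3 by rewrite divr_gt0.
(* [C1] belongs to the phase error and [C2] to the Gagliardo part; both carry a factor decaying
   geometrically in [j]. Since [C2] contains the negative power [de^(1-p)], [de] has to be fixed
   before [j]. *)
pose C1 := 6 * a * (V + M); pose C2 := de `^ (1 - p) * 2 `^ (3 + s * p) * M.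
have [j [j1 j2]] : exists j, 2^-1 ^+ j * C1 <= e / 3 /\ (2^-1 `^ (s * p)) ^+ j * C2 <= e / 3.
  have geo (z C : R) : 0 <= z -> z < 1 -> \forall j \near \oo, z ^+ j * C <= e / 3.
    move=> z0 z1; have : z ^+ j * C @[j --> \oo] --> 0 * C.
      by apply: cvgM; [apply: cvg_expr; rewrite ger0_norm|exact: cvg_cst].
    rewrite mul0r => /cvgrPdist_lt/(_ _ e30); apply: filterS => j.
    by rewrite sub0r normrN => /ltW; apply: le_trans; exact: ler_norm.
  have h1 : 2^-1 `^ (s * p) < 1 :> R.
    have : 2^-1 `^ (s * p) < 1 `^ (s * p) :> R.
      by apply: gt0_ltr_powR => //; rewrite ?nnegrE ?invf_lt1 ?ltr1n.
    by rewrite powR1.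
  have g1 := geo 2^-1 C1; have g2 := geo _ C2 (powR_ge0 _ _) h1.
  have [||j Hj] := filter_ex (filterI (g1 _ _) g2); rewrite ?invr_ge0 ?invf_lt1 ?ltr1n//.
  by exists j.
exists j => u f Fu uM [mm Im] UM mf fu; have [mu Iu] := Fu.
have mB : measurable (B m) by exact: measurable_box.
pose c := de `^ (1 - p) * (8 ^+ j * (2 * 2 ^- j) `^ (3 + s * p)).
have c0 : 0 <= c by rewrite !mulr_ge0 ?powR_ge0 ?exprn_ge0 ?invr_ge0 ?exprn_ge0.
pose al x := de + 6 * a * 2 ^- j * cmod (u x).
have al0 x : 0 <= al x.
  by rewrite addr_ge0 ?(ltW de0)// !mulr_ge0 ?cmod_ge0 ?invr_ge0 ?exprn_ge0.
pose W z := (wpow K p (mdiff A u) z)%:E.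
have mW : measurable_fun setT W by exact: measurable_int Im.
have W0 z : (0 <= W z)%E by rewrite lee_fin; apply: wpow_ge0; exact: gagliardo_kernel_ge0.
pose F := fubini_F mu3 W.
have mF : measurable_fun setT F by exact: measurable_fun_fubini_tonelli_F.
have F0 x : (0 <= F x)%E by apply: integral_ge0.
have mcu : measurable_fun setT (@cmod R \o u) by exact: measurable_cmod.
have inner x : B m x -> (cell_osc j f x <= (al x)%:E + c%:E * F x)%E.
  move=> Bx; rewrite /cell_osc.
  have mWx : measurable_fun setT (fun y => W (x, y)).
    exact: (measurableT_comp mW (pair1_measurable x)).
  have msame : measurable_fun setT
      (fun y : R3 R => (8 ^+ j * (cell_index j x == cell_index j y)%:R : R)%:E).
    apply/measurable_EFinP/measurable_funM; first exact: measurable_cst.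
    exact: (measurableT_comp (@measurable_same_cell R j) (pair1_measurable x)).
  have same0 y : (0 <= (8 ^+ j * (cell_index j x == cell_index j y)%:R : R)%:E)%E.
    by rewrite lee_fin mulr_ge0 ?exprn_ge0.
  rewrite -[((al x)%:E)%E]mule1 -(integral_same_cell j x).
  rewrite -ge0_integralZl ?lee_fin//.
  rewrite -[(c%:E * _)%E]ge0_integralZl ?lee_fin//.
  rewrite -ge0_integralD//; last 4 first.
  - by move=> y _; apply: mule_ge0; [rewrite lee_fin; exact: al0|exact: same0].
  - by apply: emeasurable_funM => //; exact: measurable_cst.
  - by move=> y _; apply: mule_ge0; [rewrite lee_fin; exact: c0|exact: W0].
  - by apply: emeasurable_funM => //; exact: measurable_cst.
  apply: ge0_le_integral => //.
  - by move=> y _; rewrite lee_fin cell_osc_kernel_ge0.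
  - apply/measurable_EFinP.
    exact: (measurableT_comp (measurable_cell_osc_kernel j mf) (pair1_measurable x)).
  - by apply: emeasurable_funD; apply: emeasurable_funM => //; exact: measurable_cst.
  by move=> y _; rewrite /W -!EFinM -EFinD lee_fin;
    exact: (@osc_kernel_le m j u f a de x y a0 de0 Aa fu Bx).
have malE : measurable_fun (B m) (fun x => (al x)%:E).
  apply/measurable_EFinP; apply: (@measurable_funS _ _ _ _ setT) => //.
  apply: measurable_funD; first exact: measurable_cst.
  by apply: measurable_funM => //; exact: measurable_cst.
have mFB : measurable_fun (B m) (fun x => c%:E * F x)%E.
  by apply: emeasurable_funM; [exact: measurable_cst|exact: measurable_funS mF].
apply: (@le_trans _ _ (\int[mu3]_(x in B m) ((al x)%:E + c%:E * F x))%E).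
  apply: ge0_le_integral => //.
  - by move=> x _; apply: integral_ge0 => y _; rewrite lee_fin cell_osc_kernel_ge0.
  - by apply: measurable_funS (measurable_cell_osc j mf).
  - exact: emeasurable_funD.
rewrite ge0_integralD//; [|by move=> x _; rewrite lee_fin|
  by move=> x _; apply: mule_ge0; [rewrite lee_fin; exact: c0|exact: F0]].
rewrite (_ : e = (e / 3 + e / 3) + e / 3); last by field.
rewrite EFinD; apply: leeD.
  apply: (@le_trans _ _ (de * V + 2^-1 ^+ j * C1)%:E); last by rewrite lee_fin lerD.
  pose c1 := 6 * a * 2 ^- j.
  have c10 : 0 <= c1 by rewrite !mulr_ge0 ?invr_ge0 ?exprn_ge0.
  have -> : (\int[mu3]_(x in B m) (al x)%:E =
      \int[mu3]_(x in B m) (de%:E + c1%:E * (cmod (u x))%:E))%E.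
    by apply: eq_integral => x _; rewrite -EFinM -EFinD.
  rewrite ge0_integralD//; last 3 first.
  - by move=> x _; rewrite lee_fin ltW.
  - by move=> x _; apply: mule_ge0; rewrite lee_fin// cmod_ge0.
  - apply: emeasurable_funM; first exact: measurable_cst.
    by apply/measurable_EFinP; exact: measurable_funS mcu.
  rewrite integral_cst// ge0_integralZl//; last 2 first.
  - by apply/measurable_EFinP; exact: measurable_funS mcu.
  - by move=> x _; rewrite lee_fin cmod_ge0.
  have muB := @leb3_box R 0 m%:R (ler0n _ _).
  rewrite EFinD; apply: leeD.
    by rewrite (EFinM de V); apply: lee_wpmul2l; [rewrite lee_fin ltW|rewrite [leLHS]muB].
  rewrite (_ : 2^-1 ^+ j * C1 = c1 * (V + M)); last by rewrite /C1 /c1 exprVn; ring.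
  rewrite (EFinM c1 (V + M)); apply: lee_wpmul2l; first by rewrite lee_fin.
  exact: box_L1_bound.
rewrite ge0_integralZl ?lee_fin//; last exact: measurable_funS mF.
apply: (@le_trans _ _ (c%:E * M%:E)%E).
  apply: lee_wpmul2l; first by rewrite lee_fin.
  apply: (@le_trans _ _ (\int[mu3]_x F x)%E); first exact: ge0_subset_integral.
  by rewrite /F -fubini_tonelli1// (integrable_EFinK Im) lee_fin.
rewrite -EFinM lee_fin; apply: le_trans j2.
rewrite /c scale_powR /C2 le_eqVlt; apply/orP; left; apply/eqP; ring.
Qed.

End MagneticOscillation.

(** * Integrability of a truncated singular kernel *)

Section SingularKernel.
Variable R : realType.
Variables (s p : R).
Hypotheses (s0 : 0 < s) (s1 : s < 1) (p1 : 1 < p).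
Local Notation mu3 := (@leb3 R).
Implicit Types (x y : R3 R) (j : nat).

Let p0 : 0 < p. Proof. exact: lt_trans p1. Qed.
Let sp0 : 0 < s * p. Proof. exact: mulr_gt0. Qed.
Let spp : s * p < p. Proof. by rewrite -[ltRHS]mul1r ltr_pM2r. Qed.
Let e0 : 0 < 3 + s * p. Proof. by rewrite addr_gt0. Qed.

Lemma geometric_eseries_le (c z : R) : 0 <= c -> 0 <= z -> z < 1 ->
  (\sum_(0 <= j <oo) (c * z ^+ j)%:E <= (c / (1 - z))%:E)%E.
Proof.
move=> c0 z0 z1; have z10 : 0 < 1 - z by rewrite subr_gt0.
apply: lime_le.
  by apply: is_cvg_nneseries => j _ _; rewrite lee_fin mulr_ge0// exprn_ge0.
apply: nearW => n; rewrite sumEFin lee_fin.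
have z1' : z != 1 by rewrite lt_eqF.
have /(congr1 (fun f => f n)) := geometric_seriesE c z1'.
rewrite /series /= => ->; rewrite ler_pM2r ?invr_gt0// -[leRHS]mulr1.
by rewrite ler_wpM2l// gerBl exprn_ge0.
Qed.

(** The profile of the Gagliardo integrand of a bounded Lipschitz function: [|x - y|^p] near the
    diagonal, bounded far from it. *)
Definition singular_kernel (t : R) : R := Num.min (t `^ p) 1 / t `^ (3 + s * p).

Lemma singular_kernel_ge0 t : 0 <= singular_kernel t.
Proof. by rewrite divr_ge0 ?powR_ge0// le_min powR_ge0 ler01. Qed.

(** [al j] bounds the kernel for [2^-(j+1) < t <= 2^-j], and [be j] for [2^j <= t <= 2^(j+1)]: the
    minimum is replaced by [(2^-j)^p], respectively [1], and the denominator by its value at the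
    inner radius. *)
Let al j : R := (2 ^- j) `^ p / (2 ^- j.+1) `^ (3 + s * p).
Let be j : R := ((2 ^+ j) `^ (3 + s * p))^-1.

Let ln2X j : ln (2 ^+ j) = j%:R * ln 2 :> R.
Proof. by rewrite lnXn// mulr_natl. Qed.

(** The bound times the volume of the enclosing box; the ratio [2^(sp-p)] is below [1] because
    [s < 1]. *)
Let alE j : al j * (8 * (2 ^- j) ^+ 3) = 8 * 2 `^ (3 + s * p) * (2 `^ (s * p - p)) ^+ j.
Proof.
rewrite /al; have r0 : 0 < 2 ^- j :> R by rewrite invr_gt0 exprn_gt0.
have r'0 : 0 < 2 ^- j.+1 :> R by rewrite invr_gt0 exprn_gt0.
have lr : ln (2 ^- j) = - (j%:R * ln 2) :> R by rewrite lnV ?posrE ?exprn_gt0// ln2X.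
have lr' : ln (2 ^- j.+1) = - ((j%:R + 1) * ln 2) :> R.
  by rewrite lnV ?posrE ?exprn_gt0// ln2X natr1.
move: (2 ^- j) (2 ^- j.+1) r0 r'0 lr lr' => r r' r0 r'0 lr lr'.
rewrite -!powR_mulrn ?powR_ge0 ?(ltW r0)//.
rewrite !powR_expR ?powR_gt0 ?expR_gt0// ?ln_powR ?expRK lr lr'.
rewrite mulrCA -[RHS]mulrA; congr (8 * _).
by rewrite -!expRN -!expRD; congr expR; ring.
Qed.

(** The same for the outer shells, with ratio [2^(-sp)], below [1] because [sp > 0]. *)
Let beE j : be j * (8 * (2 ^+ j.+1) ^+ 3) = 64 * (2 `^ (- (s * p))) ^+ j.
Proof.
rewrite /be (exprS 2 j) exprMn; have r0 : 0 < 2 ^+ j :> R by rewrite exprn_gt0.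
move: (2 ^+ j) r0 (ln2X j) => r r0 lr.
rewrite (_ : 8 * (2 ^+ 3 * r ^+ 3) = 64 * r ^+ 3); last by ring.
rewrite -!powR_mulrn ?powR_ge0 ?(ltW r0)//.
rewrite !powR_expR ?powR_gt0 ?expR_gt0// ?ln_powR ?expRK lr.
rewrite mulrCA; congr (64 * _).
by rewrite -!expRN -!expRD; congr expR; ring.
Qed.

Let shell (t : R) : 0 < t -> exists j,
  (t <= 2 ^- j /\ singular_kernel t <= al j) \/
  (t <= 2 ^+ j.+1 /\ singular_kernel t <= be j).
Proof.
move=> t0; have h k : 0 < 2 ^+ k :> R by exact: exprn_gt0.
have m1 : Num.min (t `^ p) 1 <= 1 by rewrite ge_min lexx orbT.
have mp : Num.min (t `^ p) 1 <= t `^ p by rewrite ge_min lexx.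
have m0 : 0 <= Num.min (t `^ p) 1 by rewrite le_min powR_ge0 ler01.
have [t1|t1] := leP t 1.
  have ex : exists j, 2 ^- j.+1 < t.
    have [N _ HN] := near_infty_natSinv_expn_lt (PosNum t0).
    by exists N; have := HN N.+1 (leqnSn N); rewrite /= mul1r.
  have [j Hj jmin] := ex_minnP ex; exists j; left.
  have tj : t <= 2 ^- j.
    case: j Hj jmin => [|j] Hj jmin; first by rewrite expr0 invr1.
    by rewrite leNgt; apply/negP => /jmin; rewrite ltnn.
  split=> //; apply: ler_pM => //; first by rewrite invr_ge0 powR_ge0.
    apply: le_trans mp _; apply: ge0_ler_powR => //; rewrite ?nnegrE ?invr_ge0 ltW//.
  rewrite lef_pV2 ?posrE ?powR_gt0 ?invr_gt0//.
  by apply: ge0_ler_powR; rewrite ?nnegrE ?invr_ge0 ?ltW.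
have ex : exists j : nat, t <= 2 ^+ j.+1.
  exists (Num.truncn t); apply: (@le_trans _ _ (Num.truncn t).+1%:R).
    by rewrite ltW// truncnS_gt.
  by rewrite -natrX ler_nat ltnW// ltn_expl.
have [j Hj jmin] := ex_minnP ex; exists j; right; split => //.
have tj : 2 ^+ j <= t.
  case: j Hj jmin => [|j] Hj jmin; first by rewrite expr0 ltW.
  by rewrite leNgt; apply/negP => /ltW/jmin; rewrite ltnn.
rewrite /singular_kernel -[be j]mul1r; apply: ler_pM => //; first by rewrite invr_ge0 powR_ge0.
rewrite lef_pV2 ?posrE ?powR_gt0//.
exact: (ge0_ler_powR (ltW e0) (ltW (h j)) (ltW t0) tj).
Qed.

Lemma measurable_singular_kernel d (T : measurableType d) (f : T -> R3 R) :
  measurable_fun setT f -> measurable_fun setT (fun t => singular_kernel `|f t|).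
Proof.
move=> mf; have mn : measurable_fun setT (fun t => `|f t|).
  have cn : measurable_fun setT (fun x : R3 R => `|x|).
    by apply: continuous3_measurable; exact: norm_continuous.
  exact: (measurableT_comp cn mf).
apply: measurable_funM.
  apply: measurable_minr; last exact: measurable_cst.
  exact: (measurableT_comp (measurable_powR p) mn).
rewrite (_ : (fun t => (`|f t| `^ (3 + s * p))^-1) = fun t => (`|f t| `^ (3 + s * p)) `^ (-1)).
  apply: (measurableT_comp (measurable_powR (-1))).
  exact: (measurableT_comp (measurable_powR (3 + s * p)) mn).
by apply/funext => y; rewrite powR_inv1// powR_ge0.
Qed.

Lemma norm3_le x (e : R) : `|x| <= e ->
  [/\ `|x.1.1| <= e, `|x.1.2| <= e & `|x.2| <= e].
Proof. by rewrite !prod_normE !ge_max => /andP[/andP[]]. Qed.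

(** Each shell is enlarged to a box centred at [x], whose volume does not depend on [x]; the two
    resulting geometric series bound the integral. *)
Lemma singular_kernel_int : exists2 C : R, 0 <= C & forall x,
  (\int[mu3]_y (singular_kernel `|x - y|)%:E <= C%:E)%E.
Proof.
have h k : 0 < 2 ^+ k :> R by exact: exprn_gt0.
have al0 j : 0 <= al j by rewrite divr_ge0 ?powR_ge0.
have be0 j : 0 <= be j by rewrite invr_ge0 powR_ge0.
pose z1 : R := 2 `^ (s * p - p); pose z2 : R := 2 `^ (- (s * p)).
have z_lt1 (a : R) : a < 0 -> 2 `^ a < 1 :> R.
  by move=> a0; rewrite powR_expR// expR_lt1 nmulr_rlt0//; apply: ln_gt0; rewrite ltr1n.
have z11 : z1 < 1 by apply: z_lt1; rewrite subr_lt0.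
have z21 : z2 < 1 by apply: z_lt1; rewrite oppr_lt0.
pose c1 : R := 8 * 2 `^ (3 + s * p).
have c10 : 0 <= c1 by rewrite mulr_ge0// powR_ge0.
exists (c1 / (1 - z1) + 64 / (1 - z2)).
  by rewrite addr_ge0// divr_ge0// subr_ge0 ltW.
move=> x; pose T j y : R := al j * \1_(box x (2 ^- j)) y + be j * \1_(box x (2 ^+ j.+1)) y.
have T0 j y : 0 <= T j y by rewrite addr_ge0// mulr_ge0.
have mT j : measurable_fun setT (T j).
  by apply: measurable_funD; apply: measurable_funM => //; apply: measurable_indic; exact: measurable_box.
apply: (@le_trans _ _ (\int[mu3]_y \sum_(0 <= j <oo) (T j y)%:E)%E).
  apply: ge0_le_integral => //.
  - by move=> y _; rewrite lee_fin singular_kernel_ge0.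
  - apply/measurable_EFinP; apply: measurable_singular_kernel.
    exact: (measurableT_comp (@measurable_sub3 R) (pair1_measurable x)).
  - apply: ge0_emeasurable_sum => [j y _ _|j _]; first by rewrite lee_fin.
    exact/measurable_EFinP.
  move=> y _; have [xy|xy] := eqVneq x y.
    rewrite xy subrr normr0 /singular_kernel powR0 ?gt_eqF//.
    rewrite min_l// mul0r; apply: nneseries_ge0 => j _ _; by rewrite lee_fin.
  have t0 : 0 < `|x - y| by rewrite normr_gt0 subr_eq0.
  have [j Hj] := shell t0.
  apply: le_trans (nneseries_lim_ge j.+1 _); last by move=> k _ _; rewrite lee_fin.
  rewrite big_nat_recr//=; apply: (@le_trans _ _ (T j y)%:E); last first.
    by rewrite leeDr// sume_ge0// => k _; rewrite lee_fin.
  rewrite lee_fin /T !indicE; case: Hj => -[tj kj].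
    have [a b c] := norm3_le tj.
    rewrite (mem_set (_ : box x (2 ^- j) y)) ?mulr1; last by apply/boxP.
    by apply: le_trans kj _; rewrite lerDl mulr_ge0.
  have [a b c] := norm3_le tj.
  rewrite (mem_set (_ : box x (2 ^+ j.+1) y)) ?mulr1; last by apply/boxP.
  by apply: le_trans kj _; rewrite lerDr mulr_ge0.
rewrite integral_nneseries//; last 2 first.
- by move=> j; exact/measurable_EFinP.
- by move=> j y _; rewrite lee_fin.
have IT j : (\int[mu3]_y (T j y)%:E = (c1 * z1 ^+ j)%:E + (64 * z2 ^+ j)%:E)%E.
  rewrite /T; under eq_integral do rewrite EFinD (EFinM (al j)) (EFinM (be j)).
  have mb r : measurable (box x r) by exact: measurable_box.
  have mi r : measurable_fun setT (fun y => (\1_(box x r) y : R)%:E).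
    by apply/measurable_EFinP; exact: measurable_indic.
  rewrite ge0_integralD//; last 4 first.
  - by move=> y _; rewrite -EFinM lee_fin mulr_ge0.
  - by apply: emeasurable_funM => //; exact: measurable_cst.
  - by move=> y _; rewrite -EFinM lee_fin mulr_ge0.
  - by apply: emeasurable_funM => //; exact: measurable_cst.
  rewrite !ge0_integralZl ?lee_fin//; try by move=> y _; rewrite lee_fin.
  rewrite !integral_indic// !setIT.
  rewrite [X in (_ * X + _)%E](leb3_box x (ltW _)) ?invr_gt0//.
  rewrite [X in (_ + _ * X)%E](leb3_box x (ltW (h _))).
  by rewrite -!EFinM alE beE.
apply: (@le_trans _ _ (\sum_(0 <= j <oo) ((c1 * z1 ^+ j)%:E + (64 * z2 ^+ j)%:E))%E).
  apply: lee_nneseries => [j _ _|j _]; last by rewrite IT.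
  by apply: integral_ge0 => y _; rewrite lee_fin.
rewrite nneseriesD; last 2 first.
- by move=> j _ _; rewrite lee_fin mulr_ge0// exprn_ge0// powR_ge0.
- by move=> j _ _; rewrite lee_fin mulr_ge0// exprn_ge0// powR_ge0.
by rewrite EFinD leeD// geometric_eseries_le// powR_ge0.
Qed.

End SingularKernel.

(** * Test functions *)

Section Tent.
Variable R : realType.
Variables (s p : R) (A : R3 R -> R3 R).
Hypotheses (s0 : 0 < s) (s1 : s < 1) (p1 : 1 < p) (sp3 : s * p < 3) (cA : continuous A).
Local Notation mu3 := (@leb3 R).
Local Notation P := (pstar s p).
Local Notation K := (gagliardo_kernel s p).
Local Notation k := (singular_kernel s p).
Local Notation B m := (box (0 : R3 R) m%:R).
Implicit Types (x y : R3 R) (n : nat).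

Let p0 : 0 < p. Proof. exact: lt_trans p1. Qed.
Let sp0 : 0 < s * p. Proof. exact: mulr_gt0. Qed.
Let P0 : 0 < P. Proof. exact: lt_trans p0 (pstar_gt s0 p1 sp3). Qed.

(** With the maximum norm the support is the box [B n]. Lipschitz continuity suffices for finite
    energy, and the positivity sets of the tents exhaust the space. *)
Definition tent_fun n x : R := Num.max 0 (n%:R - `|x|).

Definition tent n x : R[i] := (tent_fun n x)%:C%C.

Lemma tent_fun_ge0 n x : 0 <= tent_fun n x.
Proof. by rewrite le_max lexx. Qed.

Lemma tent_fun_le n x : tent_fun n x <= n%:R.
Proof. by rewrite ge_max ler0n gerBl normr_ge0. Qed.

Lemma tent_fun_lip n x y : `|tent_fun n x - tent_fun n y| <= `|x - y|.
Proof.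
have key x' y' : tent_fun n x' - tent_fun n y' <= `|x' - y'|.
  rewrite lerBlDr ge_max addr_ge0 ?normr_ge0 ?tent_fun_ge0//=.
  have h : n%:R - `|y'| <= tent_fun n y' by rewrite le_max lexx orbT.
  have := ler_normB x' (x' - y'); rewrite opprB addrC subrK => h2.
  by move: h h2; lra.
rewrite ler_norml lerNl opprB key andbT.
by rewrite -(normrN (x - y)) opprB key.
Qed.

Lemma mem_box0 n x : (x \in B n) = (`|x| <= n%:R).
Proof.
apply/idP/idP => [|h].
  by rewrite inE => /boxP; rewrite !sub0r !normrN !prod_normE !ge_max => -[-> -> ->].
by rewrite inE; apply/boxP; rewrite !sub0r !normrN; exact: norm3_le.
Qed.

Lemma tent_fun_out n x : x \notin B n -> tent_fun n x = 0.
Proof. by rewrite mem_box0 -ltNge => h; apply: max_l; rewrite subr_le0 ltW. Qed.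

Lemma measurable_tent_fun n : measurable_fun setT (tent_fun n).
Proof.
apply: measurable_maxr; first exact: measurable_cst.
apply: measurable_funB; first exact: measurable_cst.
by apply: continuous3_measurable; exact: norm_continuous.
Qed.

Lemma cmeasurable_tent n : cmeasurable (tent n).
Proof. exact: cmeasurable_real (measurable_tent_fun n). Qed.

Lemma cmod_tent n x : cmod (tent n x) = tent_fun n x.
Proof. by rewrite cmod_real ger0_norm// tent_fun_ge0. Qed.

Lemma tent_Lp n : wpow_finite mu3 (fun=> 1) P (tent n).
Proof.
split; first exact: cmeasurable_tent.
have mB : measurable (B n) by exact: measurable_box.
have I : mu3.-integrable setT (EFin \o (fun x => n%:R `^ P * \1_(B n) x)).
  apply: integrableZlR; apply: ge0_integrable => //.
  have Boo : (mu3 (B n) < +oo)%E by rewrite leb3_box// ltry.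
  by rewrite integral_indic// setIT.
apply: (integrable_le _ I); first exact: (measurable_wpow _ (measurable_cst _) (cmeasurable_tent n)).
move=> x; rewrite wpow_ge0//= /wpow mul1r cmod_tent indicE.
have [xB|/tent_fun_out ->] := boolP (x \in B n); last by rewrite powR0 ?gt_eqF// mulr0.
by rewrite mulr1; apply: ge0_ler_powR; rewrite ?nnegrE ?(ltW P0)// ?tent_fun_ge0 ?tent_fun_le.
Qed.

(** If neither point is in the box, the difference vanishes. Otherwise it is at most [2 n], and at
    most [c |x - y|] when [|x - y| <= 1]. The sum of two indicators lets each part be integrated
    first in the variable that is not confined to the box. *)
Lemma tent_pointwise n : exists2 C : R, 0 <= C & forall x y,
  wpow K p (mdiff A (tent n)) (x, y) <=
  C * (\1_(B n) x * k `|x - y|) + C * (\1_(B n) y * k `|x - y|).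
Proof.
have [a a0 Aa] := continuous_box_bounded (n.+1%:R) cA.
(* The slope [1] of the tent, plus the phase error [6 a |x - y|] times the height [n]. *)
pose c : R := 1 + 6 * a * n%:R.
have c0 : 0 <= c by rewrite addr_ge0// !mulr_ge0.
pose C := c `^ p + (2 * n%:R) `^ p.
have C0 : 0 <= C by rewrite addr_ge0 ?powR_ge0.
exists C => // x y.
have k0 := singular_kernel_ge0 s p `|x - y|.
rewrite -mulrDr -mulrDl /wpow; set D := cmod _.
have [xy|xy] := eqVneq x y.
  rewrite (_ : D = 0) ?powR0 ?gt_eqF// ?mulr0; first by rewrite !mulr_ge0// addr_ge0.
  by rewrite /D xy mdiff_diag cmod0.
have [xyB|] := boolP ((x \in B n) || (y \in B n)); last first.
  rewrite negb_or => /andP[xB yB].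
  rewrite (_ : D = 0) ?powR0 ?gt_eqF// ?mulr0; first by rewrite !mulr_ge0// addr_ge0.
  have z0 x' : x' \notin B n -> tent n x' = 0 by move=> ?; rewrite /tent tent_fun_out.
  by rewrite /D /mdiff !z0// mulr0 subrr cmod0.
have ind1 : 1 <= (\1_(B n) x + \1_(B n) y : R).
  by rewrite !indicE; case: (x \in B n) xyB => /= [|->]; rewrite ?lerDl ?lerDr.
apply: (@le_trans _ _ (C * k `|x - y|)); last first.
  by rewrite mulrA ler_wpM2r// -[leLHS]mulr1 ler_wpM2l.
have t0 : 0 < `|x - y| by rewrite normr_gt0 subr_eq0.
have [d1 d2 d3] := norm3_le (lexx `|x - y|).
have et : `|x - y| <= enorm (x - y).
  by rewrite [leLHS]prod_normE [`|(x - y).1|]prod_normE !ge_max; have [-> -> ->] := enorm_coord (x - y).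
have Kle : K (x, y) <= (`|x - y| `^ (3 + s * p))^-1.
  have sp30 : 0 <= 3 + s * p by rewrite addr_ge0 ?ltW.
  have h := ge0_ler_powR sp30 (ltW t0) (enorm_ge0 _) et.
  rewrite /gagliardo_kernel /= lef_pV2 ?posrE; [exact: h|apply: powR_gt0|exact: powR_gt0].
  exact: lt_le_trans et.
rewrite /singular_kernel mulrA mulrC; apply: ler_pM; rewrite ?powR_ge0 ?gagliardo_kernel_ge0//.
have D0 : 0 <= D by exact: cmod_ge0.
have D2n : D <= 2 * n%:R.
  apply: le_trans (cmodB _ _) _; rewrite cmodM cmod_cis mul1r !cmod_tent.
  by rewrite mulr2n mulrDl mul1r lerD// tent_fun_le.
have [t1|t1] := leP `|x - y| 1; last first.
  have tp1 : 1 <= `|x - y| `^ p.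
    by have := ge0_ler_powR (ltW p0) ler01 (ltW t0) (ltW t1); rewrite powR1.
  rewrite min_r//.
  rewrite mulr1; apply: (@le_trans _ _ ((2 * n%:R) `^ p)); last by rewrite lerDr powR_ge0.
  exact: (ge0_ler_powR (ltW p0) D0 (mulr_ge0 _ _) D2n).
have tp1 : `|x - y| `^ p <= 1.
  by have := ge0_ler_powR (ltW p0) (ltW t0) ler01 t1; rewrite powR1.
rewrite min_l//.
apply: (@le_trans _ _ (c `^ p * `|x - y| `^ p)); last first.
  by rewrite ler_wpM2r ?powR_ge0// lerDl powR_ge0.
rewrite -powRM//; apply: (ge0_ler_powR (ltW p0) D0); first by rewrite nnegrE mulr_ge0.
have midB : B n.+1 (2^-1 *: (x + y)).
  apply/set_mem; rewrite mem_box0 normrZ gtr0_norm ?invr_gt0//.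
  have e1 : n.+1%:R = n%:R + 1 :> R by rewrite natr1.
  have h1 : `|x| <= `|y| + `|x - y| by rewrite -{1}(subrK y x) addrC ler_normD.
  have h2 : `|y| <= `|x| + `|x - y|.
    by rewrite -{1}(subrK x y) addrC (le_trans (ler_normD _ _))// -(normrN (x - y)) opprB.
  have h3 := ler_normD x y; rewrite ler_pdivrMl// e1.
  by move: xyB; rewrite !mem_box0 => /orP[] h4; lra.
have dl := @dot_le R (x - y) (A (2^-1 *: (x + y))) _ a (ltW t0) (And3 d1 d2 d3) (Aa _ midB).
have -> : D = cmod ((tent n x - tent n y) -
    (1 - cis (- dot (x - y) (A (2^-1 *: (x + y))))) * tent n x).
  by rewrite /D /mdiff; congr cmod; rewrite [(x, y).1]/= [(x, y).2]/=; ring.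
apply: le_trans (cmodB _ _) _.
rewrite (_ : c * `|x - y| = `|x - y| + 6 * a * n%:R * `|x - y|); last by rewrite /c; ring.
apply: lerD.
  have -> : tent n x - tent n y = (tent_fun n x - tent_fun n y)%:C%C.
    by rewrite /tent; apply/eqP; rewrite eq_complex /= subrr !eqxx.
  by rewrite cmod_real tent_fun_lip.
rewrite cmodM cmod_tent.
apply: (@le_trans _ _ (2 * (3 * (`|x - y| * a)) * n%:R)); last first.
  by rewrite le_eqVlt; apply/orP; left; apply/eqP; ring.
apply: ler_pM; rewrite ?cmod_ge0 ?tent_fun_ge0 ?tent_fun_le//.
apply: le_trans (cis_lipschitz _) _; rewrite normrN; apply: ler_wpM2l => //.
Qed.

Lemma tent_gagliardo n : wpow_finite (mu3 \x mu3)%E K p (mdiff A (tent n)).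
Proof.
have mm := cmeasurable_mdiff cA (cmeasurable_tent n); split => //.
have mw := measurable_wpow p (measurable_gagliardo_kernel s p) mm.
apply: ge0_integrable => //; first by move=> z; apply: wpow_ge0; exact: gagliardo_kernel_ge0.
have [C C0 HC] := tent_pointwise n.
have [L L0 HL] := singular_kernel_int s0 s1 p1.
have mB : measurable (B n) by exact: measurable_box.
have kge0 t := singular_kernel_ge0 s p t.
have mk : measurable_fun setT (fun z : R3 R * R3 R => k `|z.1 - z.2|).
  by apply: measurable_singular_kernel; exact: measurable_sub3.
have mi : measurable_fun setT (\1_(B n) : R3 R -> R) by exact: measurable_indic.
pose G1 (z : R3 R * R3 R) := (C * (\1_(B n) z.1 * k `|z.1 - z.2|))%:E.
pose G2 (z : R3 R * R3 R) := (C * (\1_(B n) z.2 * k `|z.1 - z.2|))%:E.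
have mG1 : measurable_fun setT G1.
  apply/measurable_EFinP; apply: measurable_funM; first exact: measurable_cst.
  by apply: measurable_funM => //; exact: (measurableT_comp mi measurable_fst).
have mG2 : measurable_fun setT G2.
  apply/measurable_EFinP; apply: measurable_funM; first exact: measurable_cst.
  by apply: measurable_funM => //; exact: (measurableT_comp mi measurable_snd).
have G10 z : (0 <= G1 z)%E by rewrite lee_fin !mulr_ge0.
have G20 z : (0 <= G2 z)%E by rewrite lee_fin !mulr_ge0.
have muB : (\int[mu3]_x (\1_(B n) x)%:E = (8 * n%:R ^+ 3)%:E)%E.
  by rewrite integral_indic// setIT; exact: leb3_box.
pose M : R := C * L * (8 * n%:R ^+ 3).
have bnd (g : R3 R -> \bar R) : measurable_fun setT g -> (forall x, (0 <= g x)%E) ->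
   (forall x, (g x <= (C * L)%:E * (\1_(B n) x)%:E)%E) -> (\int[mu3]_x g x <= M%:E)%E.
  move=> mg g0 gle; rewrite /M EFinM -muB -ge0_integralZl ?lee_fin ?mulr_ge0//;
    last exact/measurable_EFinP.
  apply: ge0_le_integral => //.
  by apply: emeasurable_funM; [exact: measurable_cst|exact/measurable_EFinP].
apply: (@le_lt_trans _ _ (M + M)%:E); last exact: ltry.
apply: (@le_trans _ _ (\int[mu3 \x mu3]_z (G1 z + G2 z))%E).
  apply: ge0_le_integral => //.
  - by move=> z _; rewrite lee_fin; apply: wpow_ge0; exact: gagliardo_kernel_ge0.
  - exact/measurable_EFinP.
  - exact: emeasurable_funD.
  by move=> [x y] _; rewrite -EFinD lee_fin; exact: HC.
rewrite ge0_integralD// EFinD; apply: leeD.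
- rewrite fubini_tonelli1//; apply: bnd.
  + exact: measurable_fun_fubini_tonelli_F.
  + by move=> x; apply: integral_ge0.
  move=> x; rewrite /fubini_F /G1 /=.
  have mkx : measurable_fun setT (fun y => (k `|x - y|)%:E).
    by apply/measurable_EFinP; exact: (measurableT_comp mk (pair1_measurable x)).
  under eq_integral do rewrite mulrA EFinM.
  rewrite ge0_integralZl//; last 2 first.
  + by move=> y _; rewrite lee_fin.
  + by rewrite lee_fin mulr_ge0.
  rewrite -EFinM (_ : C * L * \1_(B n) x = C * \1_(B n) x * L); last ring.
  by rewrite [leRHS]EFinM; apply: lee_wpmul2l; rewrite ?lee_fin ?mulr_ge0.
- rewrite fubini_tonelli2//; apply: bnd.
  + exact: measurable_fun_fubini_tonelli_G.
  + by move=> x; apply: integral_ge0.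
  move=> y; rewrite /fubini_G /G2 /=.
  have mky : measurable_fun setT (fun x => (k `|y - x|)%:E).
    apply/measurable_EFinP; apply: measurable_singular_kernel.
    exact: (measurableT_comp (@measurable_sub3 R) (pair1_measurable y)).
  under eq_integral => x _ do rewrite -normrN opprB mulrA EFinM.
  rewrite ge0_integralZl//; last 2 first.
  + by move=> x _; rewrite lee_fin.
  + by rewrite lee_fin mulr_ge0.
  rewrite -EFinM (_ : C * L * \1_(B n) y = C * \1_(B n) y * L); last ring.
  by rewrite [leRHS]EFinM; apply: lee_wpmul2l; rewrite ?lee_fin ?mulr_ge0.
Qed.

(** Were all the integrals zero, [H] would vanish almost everywhere on each set where a tent is
    positive, and every [x] is in such a set once [n > |x|]. *)
Lemma tent_positive (H : R3 R -> R) (q : R) : measurable_fun setT H ->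
  (forall x, 0 <= H x) -> ~ (H = cst 0 %[ae mu3]) ->
  (forall n, wpow_finite mu3 H q (tent n)) ->
  exists n, 0 < wpow_int mu3 H q (tent n).
Proof.
move=> mH H0 Hn0 FH; apply: contrapT => /forallNP no; apply: Hn0.
have z n : {ae mu3, forall x, wpow H q (tent n) x = 0}.
  have /eqP In0 : wpow_int mu3 H q (tent n) == 0.
    by rewrite eq_le wpow_int_ge0// andbT leNgt; apply/negP/no.
  have mE : measurable_fun setT (EFin \o wpow H q (tent n)) by exact: measurable_int (FH n).2.
  have /(ae_eq_integral_abs mu3 measurableT mE) : (\int[mu3]_x `|(EFin \o wpow H q (tent n)) x| = 0)%E.
    under eq_integral do rewrite /= ger0_norm ?wpow_ge0//.
    by rewrite (integrable_EFinK (FH n).2) -/(wpow_int _ _ _ _) In0.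
  by apply: filterS => x /= /(_ Logic.I)[].
have := ae_foralln z; apply: filterS => x Hx.
have [n xn] : exists n : nat, `|x| < n%:R by exists (Num.truncn `|x|).+1; exact: truncnS_gt.
have := Hx n; rewrite /wpow cmod_tent => /eqP; rewrite mulf_eq0 => /predU1P[->//|].
rewrite powR_eq0 => /andP[/eqP t0 _]; exfalso; move: t0; apply/eqP; rewrite gt_eqF//.
by rewrite /tent_fun lt_max subr_gt0 xn orbT.
Qed.

End Tent.

(** * Minimisation on a small ball *)

Section Auxiliary.
Variable R : realType.

Lemma powR_small (a c : R) : 0 < a -> 0 < c -> exists2 t0 : R, 0 < t0 &
  forall t, 0 <= t -> t <= t0 -> t `^ a <= c.
Proof.
move=> a0 c0; exists (c `^ a^-1); first exact: powR_gt0.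
move=> t t0 tc; have := ge0_ler_powR (ltW a0) t0 (powR_ge0 _ _) tc.
by rewrite -powRrM mulVf ?gt_eqF// powRr1// ltW.
Qed.

(** The arithmetic of lower semicontinuity: [a], [b], [c] are [1/p], [lam/q], [1/P]; the suffixes
    [n], [u], [w] stand for a term of the sequence, its limit and their difference. [Gw] and [kw]
    include the factors [2^-p] and [2^P], and [c * kw <= a * Gw] removes the difference. *)
Lemma energy_estimate (a b c d e : R) (Gn Gu Gw hn hu kn ku kw m h h' : R) :
  0 < a -> 0 < b -> 0 < c -> Gu + Gw <= Gn + d -> kn <= ku + kw + d ->
  hn <= hu + d -> c * kw <= a * Gw -> a * Gn - b * hn - c * kn < m + h' ->
  h' <= h -> h < d -> e = a * d + b * d + c * d + d ->
  a * Gu - b * hu - c * ku <= m + e.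
Proof.
move=> a0 b0 c0 /(ler_wpM2l (ltW a0)) h1 /(ler_wpM2l (ltW c0)) h2.
move=> /(ler_wpM2l (ltW b0)) h3 h4 h5 h6 h7 ->.
by move: h1 h2 h3; rewrite !mulrDr; lra.
Qed.

Lemma wpow_int_null d (T : measurableType d) (mu : {measure set T -> \bar R})
    (w : T -> R) (a : R) (Z : set T) (f g : T -> R[i]) :
  measurable_fun setT w -> measurable Z -> mu Z = 0%E ->
  (forall x, ~ Z x -> f x = g x) -> cmeasurable g -> wpow_finite mu w a f ->
  wpow_finite mu w a g /\ wpow_int mu w a g = wpow_int mu w a f.
Proof.
move=> mw mZ Z0 fg mg [mf If].
have ae : ae_eq mu setT (EFin \o wpow w a f) (EFin \o wpow w a g).
  exists Z; split => // x /= h; apply: contrapT => nZ; apply: h => _.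
  by rewrite /wpow fg.
have m1 : measurable_fun setT (EFin \o wpow w a f) by exact: measurable_int If.
have m2 : measurable_fun setT (EFin \o wpow w a g).
  by apply/measurable_EFinP; exact: measurable_wpow.
have Ig : mu.-integrable setT (EFin \o wpow w a g).
  move/integrableP : If => [_ fin]; apply/integrableP; split; first exact: m2.
  rewrite (ae_eq_integral (fun x => `|(EFin \o wpow w a f) x|%E))//.
  - exact: measurableT_comp.
  - exact: measurableT_comp.
  - by move: ae; apply: filterS => x /= h _; have [->] := h Logic.I.
split; first by split.
by rewrite /wpow_int /Rintegral; congr fine; apply/esym; exact: ae_eq_integral.
Qed.

End Auxiliary.

Section Mdiff.
Variables (R : realType) (A : R3 R -> R3 R).
Implicit Types u v : R3 R -> R[i].

Lemma mdiffD u v : mdiff A (fun x => u x + v x) = fun z => mdiff A u z + mdiff A v z.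
Proof. by apply/funext => z; rewrite /mdiff mulrDr opprD addrACA. Qed.

Lemma mdiffM (c : R[i]) u : mdiff A (fun x => c * u x) = fun z => c * mdiff A u z.
Proof. by apply/funext => z; rewrite /mdiff mulrBr mulrCA. Qed.

Lemma mdiffB u v : mdiff A (fun x => u x - v x) = fun z => mdiff A u z - mdiff A v z.
Proof. by apply/funext => z; rewrite /mdiff; ring. Qed.

Lemma cvg_mdiff (u_ : nat -> R3 R -> R[i]) u :
  (forall x, cmod (u_ n x - u x) @[n --> \oo] --> 0) ->
  forall z, cmod (mdiff A (u_ n) z - mdiff A u z) @[n --> \oo] --> 0.
Proof.
move=> uu z; have H : cmod (u_ n z.1 - u z.1) + cmod (u_ n z.2 - u z.2) @[n --> \oo] --> 0.
  by rewrite -[0](addr0 0); exact: cvgD.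
apply: (@squeeze_cvgr _ _ _ _ (cst 0)
  (fun n => cmod (u_ n z.1 - u z.1) + cmod (u_ n z.2 - u z.2))) => //; last exact: cvg_cst.
apply: nearW => n; rewrite cmod_ge0 /=.
have -> : mdiff A (u_ n) z - mdiff A u z =
  cis (- dot (z.1 - z.2) (A (2^-1 *: (z.1 + z.2)))) * (u_ n z.1 - u z.1) - (u_ n z.2 - u z.2).
  by rewrite /mdiff; ring.
by apply: le_trans (cmodB _ _) _; rewrite cmodM cmod_cis mul1r.
Qed.

End Mdiff.

Section Minimisation.
Variable R : realType.
Variables (s p q : R) (A : R3 R -> R3 R) (H K : R3 R -> R) (Mk : R).
Hypotheses (s0 : 0 < s) (s1 : s < 1) (p1 : 1 < p) (sp3 : s * p < 3).
Hypotheses (q1 : 1 < q) (qp : q < p) (cA : continuous A).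
Local Notation mu3 := (@leb3 R).
Local Notation mu6 := (mu3 \x mu3)%E.
Local Notation P := (pstar s p).
Local Notation W := (gagliardo_kernel s p).
Local Notation one := (fun=> 1 : R).
Hypotheses (mH : measurable_fun setT H) (H0 : forall x, 0 <= H x).
Hypothesis IH : mu3.-integrable setT (EFin \o (fun x => H x `^ (P / (P - q)))).
Hypothesis Hn0 : ~ (H = cst 0 %[ae mu3]).
Hypotheses (mK : measurable_fun setT K) (K0 : forall x, 0 <= K x) (KM : forall x, K x <= Mk).
Implicit Types u v : R3 R -> R[i].

(** Membership in the space, restated through integrability of real functions; [in_D_admissible] and
    [admissible_in_D] give the equivalence. *)
Definition admissible u :=
  wpow_finite mu3 one P u /\ wpow_finite mu6 W p (mdiff A u).

(** The [p]-th power of the seminorm, as [admissible_seminorm] shows. *)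
Definition gagliardo u := wpow_int mu6 W p (mdiff A u).

Definition functional (lam : R) u : R :=
  p^-1 * gagliardo u - lam / q * wpow_int mu3 H q u - P^-1 * wpow_int mu3 K P u.

Let p0 : 0 < p. Proof. exact: lt_trans p1. Qed.
Let q0 : 0 < q. Proof. exact: lt_trans q1. Qed.
Let sp0 : 0 < s * p. Proof. exact: mulr_gt0. Qed.
Let pP : p < P. Proof. exact: pstar_gt. Qed.
Let qP : q < P. Proof. exact: lt_trans pP. Qed.
Let P1 : 1 < P. Proof. exact: lt_trans pP. Qed.
Let P0 : 0 < P. Proof. exact: lt_trans P1. Qed.
Let Mk0 : 0 <= Mk. Proof. exact: le_trans (KM 0). Qed.
Let mW := measurable_gagliardo_kernel s p.
Let W0 := @gagliardo_kernel_ge0 R s p.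
Let m1 : measurable_fun setT (one : R3 R -> R). Proof. exact: measurable_cst. Qed.
Let one0 (x : R3 R) : 0 <= 1 :> R. Proof. exact: ler01. Qed.

Lemma gagliardo_ge0 u : 0 <= gagliardo u.
Proof. exact: wpow_int_ge0. Qed.

Lemma admissible_K u : admissible u -> wpow_finite mu3 K P u.
Proof.
move=> [[mu Iu] _]; split => //.
apply: (integrable_le (measurable_wpow _ mK mu) (integrableZlR Mk Iu)) => x.
rewrite wpow_ge0//= /wpow mul1r; apply: ler_wpM2r => //; exact: powR_ge0.
Qed.

Lemma admissible_K_le u : admissible u -> wpow_int mu3 K P u <= Mk * wpow_int mu3 one P u.
Proof.
move=> Du; have [_ IK] := admissible_K Du; move: Du => [[mu Iu] _].
rewrite /wpow_int -RintegralZl//; apply: le_Rintegral => //; first exact: integrableZlR.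
by move=> x _; rewrite /wpow mul1r; apply: ler_wpM2r => //; exact: powR_ge0.
Qed.

Lemma admissible_H u : admissible u -> wpow_finite mu3 H q u.
Proof. by move=> [Fu _]; exact: (subcritical_finite mH H0 q1 qP IH Fu). Qed.

Lemma admissibleD u v : admissible u -> admissible v -> admissible (fun x => u x + v x).
Proof.
by move=> [Nu Gu] [Nv Gv]; split; rewrite ?mdiffD; exact: wpow_finiteD.
Qed.

Lemma admissibleM c u : admissible u -> admissible (fun x => c * u x).
Proof. by move=> [Nu Gu]; split; rewrite ?mdiffM; exact: wpow_finiteM. Qed.

Lemma admissibleB u v : admissible u -> admissible v -> admissible (fun x => u x - v x).
Proof.
by move=> [Nu Gu] [Nv Gv]; split; rewrite ?mdiffB; exact: wpow_finiteB.
Qed.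

Lemma functionalM_unit (lam : R) c u : cmod c = 1 -> admissible u ->
  functional lam (fun x => c * u x) = functional lam u /\
  gagliardo (fun x => c * u x) = gagliardo u.
Proof.
move=> c1 Du; have [Nu Gu] := Du.
have g : gagliardo (fun x => c * u x) = gagliardo u.
  by rewrite /gagliardo mdiffM wpow_intM// c1 powR1 mul1r.
split; last exact: g.
rewrite /functional g.
by rewrite (wpow_intM _ (admissible_H Du)) (wpow_intM _ (admissible_K Du)) c1 !powR1 !mul1r.
Qed.

Lemma sobolev_power : exists2 S : R, 0 <= S & forall u, admissible u ->
  wpow_int mu3 one P u <= S * gagliardo u `^ (P / p).
Proof.
have [C C0 HC] := sobolev s0 p1 sp3 cA.
exists (C `^ (P / p)); first exact: powR_ge0.
move=> u [Nu Gu]; have N0 : 0 <= wpow_int mu3 one P u by exact: wpow_int_ge0.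
have Pp : 0 <= P / p by rewrite divr_ge0 ?ltW.
have := ge0_ler_powR Pp (powR_ge0 _ _) (mulr_ge0 (ltW C0) (gagliardo_ge0 u)) (HC u Nu Gu).
rewrite -powRrM (_ : p / P * (P / p) = 1) ?powRr1//; last by field; rewrite !gt_eqF.
by rewrite powRM ?(ltW C0)// gagliardo_ge0.
Qed.

(** Solves [small_BL], the balance between the two Fatou constants, and by [small_half] leaves half
    of [G / p] available on the sphere. *)
Definition smallness : R := 2 `^ (- (p + P)) * (P / p).

Let smallness_gt0 : 0 < smallness.
Proof. by apply: mulr_gt0; [exact: powR_gt0|exact: (divr_gt0 P0 p0)]. Qed.

(** By Sobolev the left side is at most a constant times [G^(P/p) = G^(P/p - 1) G], and [P > p]
    makes the first factor small with [G]. *)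
Lemma critical_small : exists2 eta : R, 0 < eta & forall u, admissible u ->
  gagliardo u <= eta -> wpow_int mu3 K P u <= smallness * gagliardo u.
Proof.
have [S S_ge0 HS] := sobolev_power.
have MS : 0 <= Mk * S by exact: mulr_ge0.
have MS1 : 0 < Mk * S + 1 by rewrite ltr_wpDl.
have a0 : 0 < P / p - 1 by rewrite subr_gt0 ltr_pdivlMr// mul1r.
have c0 : 0 < smallness / (Mk * S + 1) by rewrite divr_gt0.
have [eta eta0 Heta] := powR_small a0 c0.
exists eta => // u Du ue; have G0 := gagliardo_ge0 u.
apply: le_trans (admissible_K_le Du) _.
apply: le_trans (ler_wpM2l Mk0 (HS u Du)) _.
have -> : gagliardo u `^ (P / p) = gagliardo u `^ (P / p - 1) * gagliardo u.
  move: G0; rewrite le_eqVlt => /predU1P[<-|G0].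
    have Pp0 : P / p != 0 by rewrite mulf_neq0 ?invr_eq0 ?gt_eqF.
    by rewrite mulr0 powR0.
  by rewrite -{3}(powRr1 (ltW G0)) -powRD ?subrK// (gt_eqF G0) implybT.
rewrite !mulrA; apply: ler_wpM2r => //.
apply: le_trans (ler_wpM2l MS (Heta _ G0 ue)) _.
rewrite mulrA ler_pdivrMr// mulrC ler_wpM2l ?(ltW smallness_gt0)// lerDl//.
Qed.

Let small_half : smallness <= P / (2 * p).
Proof.
rewrite /smallness (_ : P / (2 * p) = 2^-1 * (P / p)); last by field; rewrite gt_eqF.
apply: ler_wpM2r; first by rewrite divr_ge0 ?ltW.
rewrite -(powR_inv1 (ltW (ltr0n R 2)%R)) ler_powR ?ler1n// lerN2.
by have := p1; have := P1; lra.
Qed.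

Let small_BL : P^-1 * (2 `^ P * smallness) = p^-1 * (2 `^ p)^-1.
Proof.
rewrite /smallness opprD powRD ?pnatr_eq0 ?implybT// !powRN.
by field; rewrite !gt_eqF ?powR_gt0.
Qed.

(** Young's inequality with parameter [1]. The constant [c] does not shrink with the energy, which
    is harmless because [lam] is chosen after the radius. *)
Lemma subcritical_gagliardo : exists2 S : R, 0 <= S & exists2 c : R, 0 <= c &
  forall u, admissible u ->
    wpow_int mu3 H q u <= c + S * gagliardo u `^ (P / p).
Proof.
have [S S_ge0 HS] := sobolev_power; exists S => //.
exists (\int[mu3]_x H x `^ (P / (P - q))).
  by apply: Rintegral_ge0 => x _; exact: powR_ge0.
move=> u Du; have := subcritical_bound mH H0 q1 qP IH Du.1 ltr01.
rewrite powR1 !mul1r => /le_trans; apply; rewrite lerD2l; exact: HS.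
Qed.

(** The magnetic difference changes only where one of the two points lies in [Z], a null set for the
    product measure. *)
Lemma modify_null (Z : set (R3 R)) u v : measurable Z -> mu3 Z = 0%E ->
  (forall x, ~ Z x -> u x = v x) -> cmeasurable v -> admissible u ->
  [/\ admissible v, gagliardo v = gagliardo u &
    forall lam, functional lam v = functional lam u].
Proof.
move=> mZ Z0 uv mv Du; have [Nu Gu] := Du.
have [Nv _] := wpow_int_null m1 mZ Z0 uv mv Nu.
pose Z2 : set (R3 R * R3 R) := (Z `*` setT) `|` (setT `*` Z).
have mZ2 : measurable Z2 by apply: measurableU; exact: measurableX.
have Z20 : mu6 Z2 = 0%E.
  apply/eqP; rewrite -measure_le0; apply: le_trans (measureU2 _ _ _) _; try exact: measurableX.
  have e1 : mu6 (Z `*` setT) = 0%E.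
    by rewrite [LHS]product_measure1E// [X in (X * _)%E]Z0 mul0e.
  have e2 : mu6 (setT `*` Z) = 0%E.
    by rewrite [LHS]product_measure1E// [X in (_ * X)%E]Z0 mule0.
  by rewrite [X in (X + _)%E]e1 [X in (_ + X)%E]e2 adde0.
have muv z : ~ Z2 z -> mdiff A u z = mdiff A v z.
  move=> nz; have nz1 : ~ Z z.1 by move=> h; apply: nz; left; split.
  have nz2 : ~ Z z.2 by move=> h; apply: nz; right; split.
  by rewrite /mdiff !uv.
have [Gv Gvu] := wpow_int_null mW mZ2 Z20 muv (cmeasurable_mdiff cA mv) Gu.
split; [by []|exact: Gvu|move=> lam; rewrite /functional [gagliardo v]Gvu].
by rewrite (wpow_int_null mH mZ Z0 uv mv (admissible_H Du)).2
  (wpow_int_null mK mZ Z0 uv mv (admissible_K Du)).2.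
Qed.

Lemma Re_lip (z w : R[i]) : `|complex.Re z - complex.Re w| <= cmod (z - w).
Proof. by apply: le_trans (cmod_Re (z - w)); case: z w => ? ? []. Qed.

Lemma Im_lip (z w : R[i]) : `|complex.Im z - complex.Im w| <= cmod (z - w).
Proof. by apply: le_trans (cmod_Im (z - w)); case: z w => ? ? []. Qed.

Lemma cmod_le_ReIm (z : R[i]) : cmod z <= `|complex.Re z| + `|complex.Im z|.
Proof.
rewrite -ler_sqr ?nnegrE ?cmod_ge0 ?addr_ge0// cmod_sqr sqrrD.
rewrite !real_normK ?num_real// -addrA lerD2l lerDr.
by rewrite mulrn_wge0// mulr_ge0.
Qed.

(** [c] will be [Re] and then [Im]: the oscillation estimate asks only that it be 1-Lipschitz and
    dominated by the modulus. *)
Lemma rellich_component (c : R[i] -> R) (u_ : nat -> R3 R -> R[i]) (rho : R) :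
  (forall z w, `|c z - c w| <= cmod (z - w)) -> (forall z, `|c z| <= cmod z) ->
  (forall n, measurable_fun setT (c \o u_ n)) ->
  (forall n, admissible (u_ n)) -> (forall n, gagliardo (u_ n) <= rho) ->
  exists (g : nat -> nat) (Z : set (R3 R)) (f : R3 R -> R),
  [/\ forall n, (n <= g n)%N, measurable Z, mu3 Z = 0%E, measurable_fun setT f &
    forall x, ~ Z x -> c (u_ (g n) x) @[n --> \oo] --> f x].
Proof.
move=> clip c_le mc Du Gu; have [S S_ge0 HS] := sobolev_power.
have rho0 : 0 <= rho := le_trans (gagliardo_ge0 _) (Gu 0%N).
have Pp : 0 <= P / p by exact: (divr_ge0 (ltW P0) (ltW p0)).
pose M := S * rho `^ (P / p) + rho.
have Srho : 0 <= S * rho `^ (P / p) by rewrite mulr_ge0// powR_ge0.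
have M0 : 0 <= M by exact: addr_ge0.
have NM n : wpow_int mu3 one P (u_ n) <= M.
  apply: le_trans (HS _ (Du n)) _; apply: (@le_trans _ _ (S * rho `^ (P / p))); last by rewrite lerDl.
  by apply: ler_wpM2l => //; exact: (ge0_ler_powR Pp (gagliardo_ge0 _) rho0 (Gu n)).
have GM n : gagliardo (u_ n) <= M by apply: le_trans (Gu n) _; rewrite lerDr.
apply: (@local_compactness R (fun n => c \o u_ n)) => //.
- move=> m; exists (8 * m%:R ^+ 3 + M) => n.
  apply: le_trans (box_L1_bound s0 p1 sp3 m (Du n).1 (NM n)).
  apply: ge0_le_integral => //.
  + exact: measurable_box.
  + apply/measurable_EFinP; apply: (@measurable_funS _ _ _ _ setT) => //.
    by apply: measurableT_comp => //; exact: mc.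
  + apply/measurable_EFinP; apply: (@measurable_funS _ _ _ _ setT) => //.
    exact: measurable_cmod (Du n).1.1.
  by move=> x _; rewrite lee_fin; exact: c_le.
- move=> m e e0; have [j Hj] := magnetic_oscillation s0 p1 sp3 cA m M0 e0.
  exists j => n; apply: (Hj (u_ n)) => //; [exact: (Du n).1|exact: (Du n).2|exact: GM|].
  by move=> x y; exact: clip.
Qed.

Lemma rellich (u_ : nat -> R3 R -> R[i]) (rho : R) :
  (forall n, admissible (u_ n)) -> (forall n, gagliardo (u_ n) <= rho) ->
  exists (g : nat -> nat) (v_ : nat -> R3 R -> R[i]) (u : R3 R -> R[i]),
  [/\ forall n, (n <= g n)%N, cmeasurable u,
    forall x, cmod (v_ n x - u x) @[n --> \oo] --> 0 &
    forall n, [/\ admissible (v_ n), gagliardo (v_ n) = gagliardo (u_ (g n)) &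
      forall lam, functional lam (v_ n) = functional lam (u_ (g n))]].
Proof.
move=> Du Gu.
have [g1 [Z1 [fr [g1n mZ1 Z10 mfr cr]]]] := rellich_component Re_lip (@cmod_Re R)
  (fun n => (Du n).1.1.1) Du Gu.
have [g2 [Z2 [fi [g2n mZ2 Z20 mfi ci]]]] := rellich_component Im_lip (@cmod_Im R)
  (fun n => (Du (g1 n)).1.1.2) (fun n => Du (g1 n)) (fun n => Gu (g1 n)).
pose g n := g1 (g2 n); pose Z := Z1 `|` Z2.
have mZ : measurable Z by exact: measurableU.
have Z0 : mu3 Z = 0%E.
  apply/eqP; rewrite -measure_le0; apply: le_trans (measureU2 _ mZ1 mZ2) _.
  by rewrite [X in (X + _)%E]Z10 [X in (_ + X)%E]Z20 adde0.
have mi : cmeasurable (fun x => (\1_(~` Z) x : R)%:C%C).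
  by apply: cmeasurable_real; apply: measurable_indic; exact: measurableC.
(* Cutting off on the null set turns convergence almost everywhere into convergence at every point,
   the form used by the Fatou estimates; by [modify_null] no energy changes. *)
pose v_ n x := (\1_(~` Z) x : R)%:C%C * u_ (g n) x.
pose u x := (\1_(~` Z) x : R)%:C%C * (fr x +i* fi x)%C.
have indN x : ~ Z x -> (\1_(~` Z) x : R) = 1 by move=> nZ; rewrite indicE mem_set.
have ind0 x : Z x -> (\1_(~` Z) x : R) = 0.
  by move=> Zx; rewrite indicE memNset//= => h; exact: h.
exists g, v_, u; split.
- by move=> n; exact: leq_trans (g2n n) (g1n _).
- by apply: cmeasurableM => //; split.
- move=> x; have [Zx|nZ] := pselect (Z x).
    rewrite (_ : (fun n => _) = cst 0); first exact: cvg_cst.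
    by apply/funext => n; rewrite /v_ /u (ind0 _ Zx) !mul0r subrr cmod0.
  have nZ1 : ~ Z1 x by move=> h; apply: nZ; left.
  have nZ2 : ~ Z2 x by move=> h; apply: nZ; right.
  have g2oo : g2 n @[n --> \oo] --> \oo.
    move=> B [N _ NB]; exists N => // n /= Nn; apply: NB => /=.
    exact: leq_trans Nn (g2n n).
  have cr' : complex.Re (u_ (g n) x) @[n --> \oo] --> fr x.
    exact: (cvg_comp _ _ g2oo (cr x nZ1)).
  have cv : `|complex.Re (u_ (g n) x) - fr x| + `|complex.Im (u_ (g n) x) - fi x| @[n --> \oo] --> 0.
    rewrite -[X in _ --> X](addr0 0) -(normr0 R); apply: cvgD; apply: cvg_norm.
      by rewrite -(subrr (fr x)); apply: cvgB => //; exact: cvg_cst.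
    by rewrite -(subrr (fi x)); apply: cvgB; [exact: ci|exact: cvg_cst].
  apply: (@squeeze_cvgr _ _ _ _ (cst 0) (fun n =>
    `|complex.Re (u_ (g n) x) - fr x| + `|complex.Im (u_ (g n) x) - fi x|)) => //; last exact: cvg_cst.
  apply: nearW => n; rewrite cmod_ge0 /= /v_ /u (indN _ nZ) -mulrBr mul1r.
  apply: le_trans (cmod_le_ReIm _) _.
  by case: (u_ (g n) x).
move=> n; have [Dv Gv Fv] := @modify_null Z (u_ (g n)) (v_ n) mZ Z0
  (fun x nZ => esym (etrans (congr1 (fun t => t%:C%C * _) (indN x nZ)) (mul1r _)))
  (cmeasurableM mi (Du (g n)).1.1) (Du (g n)).
by split.
Qed.

Lemma gagliardoM c u : admissible u ->
  gagliardo (fun x => c * u x) = cmod c `^ p * gagliardo u.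
Proof. by move=> [_ Gu]; rewrite /gagliardo mdiffM wpow_intM. Qed.

Lemma gagliardoD_le u v : admissible u -> admissible v ->
  gagliardo (fun x => u x + v x) <= 2 `^ p * (gagliardo u + gagliardo v).
Proof. by move=> [_ Gu] [_ Gv]; rewrite /gagliardo mdiffD; exact: wpow_intD_le. Qed.

Lemma gagliardoB_le u v : admissible u -> admissible v ->
  gagliardo (fun x => u x - v x) <= 2 `^ p * (gagliardo u + gagliardo v).
Proof.
move=> Du Dv; have := gagliardoD_le Du (admissibleM (-1) Dv).
rewrite (gagliardoM _ Dv) cmodN (_ : cmod 1 = 1); last first.
  by have := @cmod_real R 1; rewrite normr1.
rewrite powR1 mul1r.
by rewrite (_ : (fun x => u x + -1 * v x) = fun x => u x - v x)//; apply/funext => x; rewrite mulN1r.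
Qed.

Lemma admissible_tent n : admissible (@tent R n).
Proof. by split; [exact: tent_Lp|exact: tent_gagliardo]. Qed.

Lemma admissible0 : admissible (fun=> 0) /\ gagliardo (fun=> 0) = 0.
Proof.
have -> : (fun=> 0) = (fun x => 0 * @tent R 0 x) :> (R3 R -> R[i]).
  by apply/funext => x; rewrite mul0r.
split; first exact/admissibleM/admissible_tent.
by rewrite (gagliardoM _ (admissible_tent 0)) cmod0 powR0 ?mul0r// gt_eqF.
Qed.

(** Fatou keeps the limit [u] in the ball, and its energy is compared with that of one far term of
    the sequence. The hypothesis on [K] is applied to the difference of these two, hence its larger
    radius. *)
Lemma functional_minimiser (rho lam : R) : 0 <= rho -> 0 < lam ->
  (forall u, admissible u -> gagliardo u <= 2 `^ p * (rho + rho) ->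
     wpow_int mu3 K P u <= smallness * gagliardo u) ->
  exists u, [/\ admissible u, gagliardo u <= rho &
    forall v, admissible v -> gagliardo v <= rho -> functional lam u <= functional lam v].
Proof.
move=> rho0 lam0 small.
have rho_le : rho <= 2 `^ p * (rho + rho).
  have h1 : 1 <= 2 `^ p :> R.
    by have := ge0_ler_powR (ltW p0) ler01 (ler0n R 2) (ler1n R 2); rewrite powR1; apply.
  have h2 : 0 <= rho + rho by exact: addr_ge0.
  by apply: le_trans (ler_wpM2r h2 h1); rewrite mul1r lerDl.
pose ball : set (R3 R -> R[i]) := [set u | admissible u /\ gagliardo u <= rho].
pose E : set R := [set functional lam u | u in ball].
have [S S_ge0 [c c_ge0 HS]] := subcritical_gagliardo.
have [S0 S00 HS0] := sobolev_power.
have Pp : 0 <= P / p by exact: (divr_ge0 (ltW P0) (ltW p0)).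
have lq0 : 0 < lam / q by rewrite divr_gt0.
have hasE : has_inf E.
  split.
    have [D0 G0] := admissible0.
    by exists (functional lam (fun=> 0)); exists (fun=> 0) => //; split; rewrite ?G0.
  exists (- (lam / q * (c + S * rho `^ (P / p))) - P^-1 * (smallness * rho)).
  move=> _ [u [Du Gu] <-]; rewrite /functional; apply: lerB.
    rewrite -[leLHS]add0r; apply: lerB.
      by rewrite mulr_ge0 ?gagliardo_ge0// invr_ge0 ltW.
    apply: ler_wpM2l; first exact: ltW.
    apply: le_trans (HS u Du) _; rewrite lerD2l; apply: ler_wpM2l => //.
    exact: (ge0_ler_powR Pp (gagliardo_ge0 _) rho0 Gu).
  apply: ler_wpM2l; first by rewrite invr_ge0 (ltW P0).
  apply: le_trans (small u Du (le_trans Gu rho_le)) _.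
  by apply: ler_wpM2l => //; exact: (ltW smallness_gt0).
have exu n : exists u, ball u /\ functional lam u < inf E + harmonic n.
  have [_ [u bu <-] ltu] := inf_adherent (@harmonic_gt0 R n) hasE.
  by exists u.
have [u_ Hu] := choice exu.
have [g [v_ [u [gn mu cu Hv]]]] := rellich (fun n => (Hu n).1.1) (fun n => (Hu n).1.2).
have Dv n : admissible (v_ n) by have [] := Hv n.
have Gv n : gagliardo (v_ n) <= rho by have [_ -> _] := Hv n; exact: (Hu (g n)).1.2.
have Ev n : functional lam (v_ n) < inf E + harmonic (g n).
  by have [_ _ ->] := Hv n; exact: (Hu (g n)).2.
have cm := cvg_mdiff A cu.
pose MN := S0 * rho `^ (P / p).
have Nv n : wpow_int mu3 one P (v_ n) <= MN.
  apply: le_trans (HS0 _ (Dv n)) _; apply: ler_wpM2l => //.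
  exact: (ge0_ler_powR Pp (gagliardo_ge0 _) rho0 (Gv n)).
have Du : admissible u /\ gagliardo u <= rho.
  have [Nu _] := wpow_finite_limit m1 one0 P1 cu mu (fun n => (Dv n).1) Nv.
  have [Gu Gule] := wpow_finite_limit mW W0 p1 cm (cmeasurable_mdiff cA mu) (fun n => (Dv n).2) Gv.
  by split; [split|exact: Gule].
have [{}Du Gu] := Du.
have FE : functional lam u <= inf E.
  apply/ler_addgt0Pr => e e0.
  (* The coefficients with which the error [d] enters the three terms, and [1] for the excess of the
     sequence over the infimum. *)
  pose C := p^-1 + lam / q + P^-1 + 1.
  have C0 : 0 < C by rewrite !addr_gt0 ?invr_gt0.
  pose d := e / C; have d0 : 0 < d by rewrite divr_gt0.
  have e1 := wpow_liminf mW W0 p1 cm Du.2 (fun n => (Dv n).2) d0.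
  have e2 := wpow_limsup mK K0 P1 cu (admissible_K Du) (fun n => admissible_K (Dv n)) d0.
  have e3 := subcritical_limsup mH H0 q1 qP IH cu Du.1 (fun n => (Dv n).1) Nv d0.
  have e4 : \forall n \near \oo, harmonic n < d.
    have /cvgrPdist_lt/(_ d d0) := @cvg_harmonic R.
    by apply: filterS => n; rewrite sub0r normrN ger0_norm// harmonic_ge0.
  have [n [[h1 h2] [h3 h4]]] := filter_ex (filterI (filterI e1 e2) (filterI e3 e4)).
  have h5 : harmonic (g n) <= harmonic n :> R.
    by rewrite lef_pV2 ?posrE ?ltr0n// ler_nat ltnS gn.
  have h6 := Ev n.
  pose wn x := v_ n x - u x.
  have Dw : admissible wn by exact: admissibleB.
  have Gw : gagliardo wn <= 2 `^ p * (rho + rho).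
    apply: le_trans (gagliardoB_le (Dv n) Du) _; apply: ler_wpM2l; first exact: powR_ge0.
    exact: (lerD (Gv n) Gu).
  have h7 := small wn Dw Gw.
  have h8 : P^-1 * (2 `^ P * wpow_int mu3 K P wn) <= p^-1 * ((2 `^ p)^-1 * gagliardo wn).
    have -> : p^-1 * ((2 `^ p)^-1 * gagliardo wn) = P^-1 * (2 `^ P * (smallness * gagliardo wn)).
      by rewrite mulrA -small_BL -(mulrA P^-1) -(mulrA (2 `^ P)).
    apply: ler_wpM2l; first by rewrite invr_ge0 (ltW P0).
    by apply: ler_wpM2l; [exact: powR_ge0|exact: h7].
  have h1' : gagliardo u + (2 `^ p)^-1 * gagliardo wn <= gagliardo (v_ n) + d.
    have -> : gagliardo wn = wpow_int mu6 W p (fun z => mdiff A (v_ n) z - mdiff A u z).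
      by rewrite /gagliardo /wn mdiffB.
    exact: h1.
  have i1 : 0 < p^-1 by rewrite invr_gt0.
  have i2 : 0 < P^-1 by rewrite invr_gt0.
  have eE : e = p^-1 * d + lam / q * d + P^-1 * d + d.
    by rewrite -!mulrDl -[X in _ = (_ + X)]mul1r -mulrDl /d mulrC divfK// gt_eqF.
  exact: (energy_estimate i1 lq0 i2 h1' h2 h3 h8 (Ev n) h5 h4 eE).
exists u; split; [exact: Du|exact: Gu|move=> v Dv' Gv'].
apply: le_trans FE _; apply: ge_inf; first exact: hasE.2.
by exists v; first split.
Qed.

(** The directional derivative of [wpow_int] at [f] along [g], divided by [a]. *)
Definition pairing d (T : measurableType d) (mu : {measure set T -> \bar R})
    (w : T -> R) (a : R) (f g : T -> R[i]) : R :=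
  \int[mu]_x (w x * complex.Re (cpow a (f x) * (g x)^*%C)).

Lemma pairing_derive d (T : measurableType d) (mu : {measure set T -> \bar R})
    (w : T -> R) (a : R) (f g : T -> R[i]) :
  measurable_fun setT w -> (forall x, 0 <= w x) -> 1 < a ->
  wpow_finite mu w a f -> wpow_finite mu w a g ->
  mu.-integrable setT
    (EFin \o (fun x => w x * complex.Re (cpow a (f x) * (g x)^*%C))) /\
  (wpow_int mu w a (fun x => f x + ((harmonic n)%:C)%C * g x) - wpow_int mu w a f) / harmonic n
    @[n --> \oo] --> a * pairing mu w a f g.
Proof.
move=> mw w0 a1 Ff Fg; have [Id cv] := wpow_derive mw w0 a1 Ff Fg.
have an0 : a != 0 by rewrite gt_eqF// (lt_trans _ a1).
have I : mu.-integrable setT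
    (EFin \o (fun x => w x * complex.Re (cpow a (f x) * (g x)^*%C))).
  have := integrableZlR a^-1 Id.
  rewrite (_ : (fun x => a^-1 * _) = fun x => w x * complex.Re (cpow a (f x) * (g x)^*%C))//.
  by apply/funext => x; rewrite mulrCA mulKf.
split; first exact: I.
have -> : a * pairing mu w a f g =
    \int[mu]_x (w x * (a * complex.Re (cpow a (f x) * (g x)^*%C))).
  rewrite -(@RintegralZl _ _ _ mu setT _ a measurableT I).
  by apply: eq_Rintegral => x _; rewrite mulrCA.
exact: cv.
Qed.

Lemma pairingN d (T : measurableType d) (mu : {measure set T -> \bar R})
    (w : T -> R) (a : R) (f g : T -> R[i]) :
  mu.-integrable setT
    (EFin \o (fun x => w x * complex.Re (cpow a (f x) * (g x)^*%C))) ->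
  pairing mu w a f (fun x => -1 * g x) = - pairing mu w a f g.
Proof.
move=> I; rewrite -[RHS]mulN1r -(@RintegralZl _ _ _ mu setT _ (-1) measurableT I);
  apply: eq_Rintegral => x _.
rewrite mulrCA; congr (_ * _).
by case: (cpow a (f x)) (g x) => a1 b1 [a2 b2] /=; ring.
Qed.

Lemma functional_negative (rho lam : R) : 0 < rho -> 0 < lam ->
  exists v, [/\ admissible v, gagliardo v <= rho & functional lam v < 0].
Proof.
move=> rho0 lam0.
have [n hn] := tent_positive mH H0 Hn0 (fun n => admissible_H (admissible_tent n)).
set h := wpow_int mu3 H q (@tent R n) in hn.
have Dt := admissible_tent n; set g := gagliardo (@tent R n).
have g0 : 0 <= g := gagliardo_ge0 _.
have pq0 : 0 < p - q by rewrite subr_gt0.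
have b0 : 0 < p^-1 * g + 1 by rewrite ltr_wpDl ?mulr_ge0// invr_ge0 ltW.
have lh : 0 < lam / q * h by rewrite mulr_gt0// divr_gt0.
(* The [K] term only lowers the energy. After division by [t^q] one needs
   [t^(p-q) g / p < lam h / q]; the [+ 1] gives strictness and covers [g = 0]. *)
have c1 : 0 < lam / q * h / (p^-1 * g + 1) by exact: divr_gt0.
have [t1 t10 H1] := powR_small pq0 c1.
have g1 : 0 < g + 1 by rewrite ltr_wpDl.
have [t2 t20 H2] := powR_small p0 (divr_gt0 rho0 g1).
pose t := Num.min t1 t2; have t0 : 0 < t by rewrite lt_min t10 t20.
have ct : cmod (t%:C%C) = t by rewrite cmod_real gtr0_norm.
have T1 : t `^ (p - q) <= lam / q * h / (p^-1 * g + 1).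
  by apply: H1; [exact: ltW|rewrite /t ge_min lexx].
have T2 : t `^ p <= rho / (g + 1).
  by apply: H2; [exact: ltW|rewrite /t ge_min lexx orbT].
exists (fun x => t%:C%C * @tent R n x); split; first exact: admissibleM.
  rewrite (gagliardoM _ Dt) ct -/g; apply: le_trans (ler_wpM2r g0 T2) _.
  by rewrite mulrAC ler_pdivrMr// ler_pM2l// lerDl.
rewrite /functional (gagliardoM _ Dt) ct -/g.
rewrite (wpow_intM _ (admissible_H Dt)) (wpow_intM _ (admissible_K Dt)) ct -/h.
have k0 : 0 <= P^-1 * (t `^ P * wpow_int mu3 K P (@tent R n)).
  apply: mulr_ge0; first by rewrite invr_ge0 (ltW P0).
  by apply: mulr_ge0; [exact: powR_ge0|exact: wpow_int_ge0].
have -> : t `^ p = t `^ q * t `^ (p - q).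
  by rewrite -powRD ?(gt_eqF t0) ?implybT//; congr (_ `^ _); ring.
have tq0 : 0 < t `^ q by exact: powR_gt0.
have key : p^-1 * (t `^ (p - q) * g) < lam / q * h.
  rewrite mulrCA; have pg0 : 0 <= p^-1 * g by rewrite mulr_ge0// invr_ge0 ltW.
  apply: le_lt_trans (ler_wpM2r pg0 T1) _.
  by rewrite mulrAC ltr_pdivrMr// ltr_pM2l// ltrDl.
have : t `^ q * (p^-1 * (t `^ (p - q) * g)) < t `^ q * (lam / q * h) by rewrite ltr_pM2l.
set X := t `^ q * _; set Y := t `^ q * _ => XY.
rewrite (_ : p^-1 * (t `^ q * t `^ (p - q) * g) = X); last by rewrite /X; ring.
rewrite (_ : lam / q * (t `^ q * h) = Y); last by rewrite /Y; ring.
by move: XY k0; set Z := P^-1 * _; lra.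
Qed.

(** On the sphere the energy starts with [rho / p]. The [K] term takes at most half of it by
    [small_half], and [lamstar] is set so that the [H] term takes at most the other half. *)
Lemma small_radius : exists2 rho : R, 0 < rho & exists2 lamstar : R, 0 < lamstar &
  (forall u, admissible u -> gagliardo u <= 2 `^ p * (rho + rho) ->
     wpow_int mu3 K P u <= smallness * gagliardo u) /\
  forall lam, 0 < lam -> lam < lamstar -> forall u, admissible u ->
    gagliardo u = rho -> 0 <= functional lam u.
Proof.
have [eta eta0 Heta] := critical_small.
have [S S_ge0 [c c_ge0 HS]] := subcritical_gagliardo.
have c2 : 0 < 2 `^ p * 2 :> R by rewrite mulr_gt0 ?powR_gt0.
pose rho := eta / (2 `^ p * 2); have rho0 : 0 < rho by exact: divr_gt0.
have rhoE : 2 `^ p * (rho + rho) = eta.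
  by rewrite /rho; field; rewrite gt_eqF// powR_gt0.
pose M := c + S * rho `^ (P / p).
have M0 : 0 <= M by rewrite addr_ge0// mulr_ge0// powR_ge0.
have M1 : 0 < M + 1 by rewrite ltr_wpDl.
have r0 : 0 < rho / (2 * p) by rewrite divr_gt0// mulr_gt0.
exists rho => //; exists (rho / (2 * p) * q / (M + 1)).
  by rewrite divr_gt0// mulr_gt0.
split; first by move=> u Du ue; apply: Heta => //; rewrite -rhoE.
move=> lam lam0 lamM u Du uE; rewrite /functional uE.
have h1 : lam / q * wpow_int mu3 H q u <= rho / (2 * p).
  have := HS u Du; rewrite uE -/M => hM.
  have lq0 : 0 <= lam / q by rewrite divr_ge0 ?ltW.
  apply: le_trans (ler_wpM2l lq0 hM) _.
  rewrite mulrAC ler_pdivrMr//; apply: le_trans (ler_wpM2r M0 (ltW lamM)) _.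
  rewrite mulrAC ler_pdivrMr// ler_wpM2l ?lerDl// mulr_ge0 ?(ltW q0)//.
  exact: ltW.
have h2 : P^-1 * wpow_int mu3 K P u <= rho / (2 * p).
  have ue : gagliardo u <= eta.
    rewrite uE -rhoE; have h3 : 1 <= 2 `^ p :> R.
      by have := ge0_ler_powR (ltW p0) ler01 (ler0n R 2) (ler1n R 2); rewrite powR1; apply.
    have h4 : 0 <= rho + rho by rewrite addr_ge0 ?ltW.
    by apply: le_trans (ler_wpM2r h4 h3); rewrite mul1r lerDl ltW.
  have := Heta u Du ue; rewrite uE => h3.
  rewrite mulrC ler_pdivrMr//; apply: le_trans h3 _.
  apply: le_trans (ler_wpM2r (ltW rho0) small_half) _.
  by rewrite le_eqVlt; apply/orP; left; apply/eqP; field; rewrite gt_eqF.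
have -> : p^-1 * rho = rho / (2 * p) + rho / (2 * p) by field; rewrite gt_eqF.
by move: h1 h2; set X := lam / q * _; set Y := P^-1 * _; lra.
Qed.

(** Interior minimality makes the one-sided derivative [L v] nonnegative in every direction; since
    [L] is odd, comparing [v] with [-v] forces [L v = 0]. *)
Lemma minimiser_critical (rho lam : R) u : admissible u -> gagliardo u < rho ->
  (forall v, admissible v -> gagliardo v <= rho -> functional lam u <= functional lam v) ->
  forall v, admissible v ->
  pairing mu6 W p (mdiff A u) (mdiff A v) =
    lam * pairing mu3 H q u v + pairing mu3 K P u v.
Proof.
move=> Du Gu umin.
pose L v := pairing mu6 W p (mdiff A u) (mdiff A v) -
  lam * pairing mu3 H q u v - pairing mu3 K P u v.
have L_ge0 v : admissible v -> 0 <= L v.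
  move=> Dv.
  have [_ cG] := pairing_derive mW W0 p1 Du.2 Dv.2.
  have [_ cH] := pairing_derive mH H0 q1 (admissible_H Du) (admissible_H Dv).
  have [_ cK] := pairing_derive mK K0 P1 (admissible_K Du) (admissible_K Dv).
  pose ut n x := u x + ((@harmonic R n)%:C)%C * v x.
  have Dut n : admissible (ut n) by apply: admissibleD => //; exact: admissibleM.
  have cv : (functional lam (ut n) - functional lam u) / harmonic n @[n --> \oo] --> L v.
    have -> : L v = p^-1 * (p * pairing mu6 W p (mdiff A u) (mdiff A v)) -
        lam / q * (q * pairing mu3 H q u v) - P^-1 * (P * pairing mu3 K P u v).
      rewrite /L !mulKf ?gt_eqF//; congr (_ - _ - _).
      by rewrite mulrA divfK// gt_eqF.
    pose dq d (T : measurableType d) (mu : {measure set T -> \bar R}) w a (f g : T -> R[i]) n :=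
      (wpow_int mu w a (fun x => f x + ((@harmonic R n)%:C)%C * g x) - wpow_int mu w a f) / harmonic n.
    rewrite (_ : (fun n => _) = fun n => p^-1 * dq _ _ mu6 W p (mdiff A u) (mdiff A v) n -
        lam / q * dq _ _ mu3 H q u v n - P^-1 * dq _ _ mu3 K P u v n).
      apply: cvgB; [apply: cvgB|]; (apply: cvgM; first exact: cvg_cst);
        [exact: cG|exact: cH|exact: cK].
    apply/funext => n; rewrite /dq /functional /gagliardo /ut mdiffD mdiffM.
    move: (wpow_int mu6 _ _ _) (wpow_int mu6 _ _ _) => a1 a2.
    move: (wpow_int mu3 H _ _) (wpow_int mu3 H _ _) => a3 a4.
    move: (wpow_int mu3 K _ _) (wpow_int mu3 K _ _) => a5 a6.
    by ring.
  rewrite -(cvg_lim _ cv)//; apply: limr_ge; first exact: cvgP cv.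
  have Duv : admissible (fun x => u x + v x) by exact: admissibleD.
  (* By convexity this expression bounds the energy of [u + harmonic n * v]; its limit is below
     [rho], so the perturbation stays in the ball for large [n]. *)
  have gt : (1 - harmonic n) * gagliardo u + harmonic n * gagliardo (fun x => u x + v x)
      @[n --> \oo] --> (1 - 0) * gagliardo u + 0 * gagliardo (fun x => u x + v x).
    apply: cvgD; apply: cvgM; try exact: cvg_cst; last exact: cvg_harmonic.
    by apply: cvgB; [exact: cvg_cst|exact: cvg_harmonic].
  rewrite subr0 mul1r mul0r addr0 in gt.
  have : \forall n \near \oo, (1 - harmonic n) * gagliardo u +
      harmonic n * gagliardo (fun x => u x + v x) < rho.
    by apply: cvgr_lt gt _ Gu.
  apply: filterS => n ltn; apply: divr_ge0; last exact: harmonic_ge0.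
  rewrite subr_ge0; apply: umin; [exact: Dut|apply: le_trans (ltW ltn)].
  rewrite /gagliardo /ut !mdiffD mdiffM.
  apply: wpow_int_convex => //; [exact: Du.2|exact: Dv.2|exact: harmonic_ge0|].
  by rewrite /= invf_le1// ler1n.
move=> v Dv; have h1 := L_ge0 v Dv.
have h2 := L_ge0 _ (admissibleM (-1) Dv).
have [iG _] := pairing_derive mW W0 p1 Du.2 Dv.2.
have [iH _] := pairing_derive mH H0 q1 (admissible_H Du) (admissible_H Dv).
have [iK _] := pairing_derive mK K0 P1 (admissible_K Du) (admissible_K Dv).
move: h2; rewrite {1}/L mdiffM !pairingN// => h2.
apply/eqP; rewrite -subr_eq0 opprD addrA -/(L v) eq_le h1 andbT.
by move: h2; rewrite /L mulrN;
  move: (pairing mu6 _ _ _ _) (pairing mu3 H _ _ _) (pairing mu3 K _ _ _) => a1 a2 a3; lra.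
Qed.

(** Each rotated function is itself an interior minimiser, so its equation needs no separate
    equivariance argument. *)
Lemma critical_circle : exists2 lamstar : R, 0 < lamstar &
  forall lam, 0 < lam -> lam < lamstar -> exists u,
  [/\ admissible u, functional lam u < 0 &
    forall c, cmod c = 1 -> forall v, admissible v ->
    pairing mu6 W p (mdiff A (fun x => c * u x)) (mdiff A v) =
      lam * pairing mu3 H q (fun x => c * u x) v + pairing mu3 K P (fun x => c * u x) v].
Proof.
have [rho rho0 [ls ls0 [small bdry]]] := small_radius.
exists ls => // lam lam0 lamls.
have [u [Du Gu umin]] := functional_minimiser (ltW rho0) lam0 small.
have [v0 [Dv0 Gv0 v0_lt0]] := functional_negative rho0 lam0.
have Fu : functional lam u < 0 by exact: le_lt_trans (umin v0 Dv0 Gv0) v0_lt0.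
have Gu' : gagliardo u < rho.
  rewrite lt_neqAle Gu andbT; apply/eqP => ue.
  by move: (bdry lam lam0 lamls u Du ue); rewrite leNgt Fu.
exists u; split; [exact: Du|exact: Fu|move=> c c1 v Dv].
have [Fc Gc] := functionalM_unit lam c1 Du.
have Gcu : gagliardo (fun x => c * u x) < rho by rewrite Gc.
have cumin v' : admissible v' -> gagliardo v' <= rho ->
    functional lam (fun x => c * u x) <= functional lam v'.
  by rewrite Fc; exact: umin.
exact: (minimiser_critical (admissibleM c Du) Gcu cumin Dv).
Qed.

End Minimisation.

Lemma ReD (R : realType) (z w : R[i]) :
  complex.Re (z + w) = complex.Re z + complex.Re w.
Proof. by case: z w => a b [c d]. Qed.

(** * Weak solutions *)

Section Transfer.
Variable R : realType.
Local Notation mu3 := (@leb3 R).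
Local Notation mu6 := (mu3 \x mu3)%E.
Implicit Types (u v : R3 R -> R[i]) (A : R3 R -> R3 R).

Lemma ae_eq_Rintegral d (T : measurableType d) (mu : {measure set T -> \bar R})
    (f g : T -> R) : measurable_fun setT f -> measurable_fun setT g ->
  {ae mu, forall x, f x = g x} -> \int[mu]_x f x = \int[mu]_x g x.
Proof.
move=> mf mg fg; rewrite /Rintegral; congr fine; apply: ae_eq_integral => //.
- exact/measurable_EFinP.
- exact/measurable_EFinP.
- by move: fg; apply: filterS => x /= -> _.
Qed.

Lemma ae_eq_wpow_int d (T : measurableType d) (mu : {measure set T -> \bar R})
    (w w' : T -> R) (a : R) (f : T -> R[i]) :
  measurable_fun setT w -> measurable_fun setT w' -> cmeasurable f ->
  {ae mu, forall x, w x = w' x} -> wpow_int mu w a f = wpow_int mu w' a f.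
Proof.
move=> mw mw' mf ww'; apply: ae_eq_Rintegral; try exact: measurable_wpow.
by move: ww'; apply: filterS => x /= wx; rewrite /wpow wx.
Qed.

Lemma ae_eq_pairing d (T : measurableType d) (mu : {measure set T -> \bar R})
    (w w' : T -> R) (a : R) (f g : T -> R[i]) :
  measurable_fun setT w -> measurable_fun setT w' -> cmeasurable f ->
  cmeasurable g -> {ae mu, forall x, w x = w' x} ->
  pairing mu w a f g = pairing mu w' a f g.
Proof.
move=> mw mw' mf mg ww'.
have [mR _] := cmeasurableM (cmeasurable_cpow a mf) (cmeasurable_conj mg).
apply: ae_eq_Rintegral; try exact: measurable_funM.
by move: ww'; apply: filterS => x /= wx; rewrite wx.
Qed.

Lemma Re_cintegral_pairing (w : R3 R -> R) (a : R) u v :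
  complex.Re (cintegral mu3 (fun x => ((w x)%:C * cpow a (u x) * (v x)^*)%C)) =
  pairing mu3 w a u v.
Proof.
rewrite /cintegral /=; apply: eq_Rintegral => x _.
by rewrite -mulrA ReZ.
Qed.

Variables (s p : R).
Hypotheses (s0 : 0 < s) (p1 : 1 < p) (sp3 : s * p < 3).
Let p0 : 0 < p. Proof. exact: lt_trans p1. Qed.
Let P0 : 0 < pstar s p. Proof. exact: lt_trans (pstar_gt s0 p1 sp3). Qed.

Lemma Re_cintegral_gagliardo A u v :
  complex.Re (cintegral mu6 (fun z => (
      cpow p (mdiff A u z) * (mdiff A v z)^*
      / (enorm (z.1 - z.2) `^ (3 + s * p))%:C)%C)) =
  pairing mu6 (gagliardo_kernel s p) p (mdiff A u) (mdiff A v).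
Proof.
rewrite /cintegral /=; apply: eq_Rintegral => z _.
rewrite /gagliardo_kernel; set t := _ `^ _.
rewrite mulrC (_ : (t%:C%C)^-1 = (t^-1)%:C%C) ?ReZ//.
by rewrite fmorphV.
Qed.

Lemma seminormE A u : seminorm A s p u =
  ((\int[mu6]_z (wpow (gagliardo_kernel s p) p (mdiff A u) z)%:E) `^ p^-1)%E.
Proof.
rewrite /seminorm; congr poweR; apply: eq_integral => z _.
by rewrite /wpow /gagliardo_kernel mulrC.
Qed.

Lemma in_D_admissible A u : continuous A -> in_D A s p u -> admissible s p A u.
Proof.
move=> cA [mu Lu Su].
have P1 : 1 <= pstar s p by exact: ltW (lt_trans p1 (pstar_gt s0 p1 sp3)).
have mm := cmeasurable_mdiff cA mu.
have kge0 := @gagliardo_kernel_ge0 R s p.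
split; split => //.
  have := Lfun_integrable P1 Lu; apply: eq_integrable => // x _.
  by rewrite /= ger0_norm ?cmod_ge0// /wpow mul1r.
apply: ge0_integrable.
- exact: (measurable_wpow p (measurable_gagliardo_kernel s p) mm).
- by move=> z; exact: wpow_ge0.
by move: Su; rewrite seminormE; apply: lty_poweRy; rewrite invr_eq0 gt_eqF.
Qed.

Lemma admissible_seminorm A u : admissible s p A u ->
  seminorm A s p u = (gagliardo s p A u `^ p^-1)%:E.
Proof. by move=> [_ [_ Iu]]; rewrite seminormE (integrable_EFinK Iu) poweR_EFin. Qed.

Lemma admissible_in_D A u : admissible s p A u -> in_D A s p u.
Proof.
move=> Du; have [[mu Iu] _] := Du; split => //; last first.
  by rewrite (admissible_seminorm Du) ltry.
rewrite inE /=; apply/andP; split; first by rewrite inE /=; exact: measurable_cmod.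
rewrite inE /= /finite_norm unlock /Lnorm; apply: poweR_lty.
under eq_integral => x _ do rewrite /= ger0_norm ?cmod_ge0//.
have := integrable_lty measurableT Iu.
by under eq_integral => x _ do rewrite /= /wpow mul1r.
Qed.

Lemma energyE A (q lam : R) (H H' K K' : R3 R -> R) u :
  measurable_fun setT H -> measurable_fun setT H' ->
  measurable_fun setT K -> measurable_fun setT K' ->
  {ae mu3, forall x, H x = H' x} -> {ae mu3, forall x, K x = K' x} ->
  admissible s p A u ->
  energy A s p q lam H K u = functional s p q A H' K' lam u.
Proof.
move=> mH mH' mK mK' HH' KK' Du; have [[mu _] _] := Du.
rewrite /energy (admissible_seminorm Du) /functional /=.
rewrite -powRrM mulVf ?gt_eqF// powRr1; last exact: wpow_int_ge0 (@gagliardo_kernel_ge0 R s p) _.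
by rewrite -(ae_eq_wpow_int q mH mH' mu HH') -(ae_eq_wpow_int (pstar s p) mK mK' mu KK').
Qed.

End Transfer.

Theorem theorem1p2 (R : realType) (s p q : R)
    (A : R3 R -> R3 R) (H K : R3 R -> R) (OmegaH : set (R3 R)) :
  0 < s -> s < 1 -> 1 < p -> s * p < 3 -> 1 < q -> q < p ->
  continuous A -> locally_bounded_gradient A ->
  ~ (H = cst 0 %[ae @leb3 R]) -> ~ (K = cst 0 %[ae @leb3 R]) ->
  H \in Lfun (@leb3 R) (pstar s p / (pstar s p - q))%:E ->
  (\forall x \ae @leb3 R, 0 <= H x) ->
  K \in Lfun (@leb3 R) +oo%E -> continuous K -> (forall x, 0 <= K x) ->
  measurable OmegaH -> (0 < @leb3 R OmegaH)%E ->
  (forall x, OmegaH x -> 0 < H x) ->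
  exists2 lamstar : R, 0 < lamstar &
    forall lam : R, 0 < lam -> lam < lamstar ->
    exists u : nat -> R3 R -> R[i],
      [/\ forall k, weak_solution A s p q lam H K (u k),
          forall k, ~ (u k = cst 0 %[ae @leb3 R]),
          forall k l, k <> l -> ~ (u k = u l %[ae @leb3 R])
        & forall k, energy A s p q lam H K (u k) < 0].
Proof.
move=> s0 s1 p1 sp3 q1 qp cA _ Hn0 _ LH Hge0 LK cK K0 _ _ _.
have pP := pstar_gt s0 p1 sp3.
have P0 : 0 < pstar s p by exact: lt_trans (lt_trans ltr01 p1) pP.
have qP : 0 < pstar s p - q by rewrite subr_gt0 (lt_trans qp).
have r1 : 1 <= pstar s p / (pstar s p - q).
  by rewrite ler_pdivlMr// mul1r gerBl (ltW (lt_trans ltr01 q1)).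
have mH : measurable_fun setT H.
  by have /andP[h _] := LH; move: h; rewrite inE.
have mK : measurable_fun setT K by exact: continuous3_measurable.
(* Nonnegative everywhere and equal to [H] almost everywhere; membership of [H] in [L^r] is
   integrability of exactly [H'^r]. *)
pose H' x := `|H x|.
have mH' : measurable_fun setT H' by exact: measurableT_comp.
have HH' : {ae @leb3 R, forall x, H x = H' x}.
  by move: Hge0; apply: filterS => x h; rewrite /H' ger0_norm.
have [Mk KM] : exists M : R, \forall x \ae @leb3 R, K x <= M.
  have /andP[_ h] := LK; move: h; rewrite inE /= /finite_norm unlock /Lnorm.
  case: ifPn => [_ /ess_supr_bounded[M HM]|leb0 _].
    by exists M; move: HM; apply: filterS => x; apply: le_trans; exact: ler_norm.
  (* The convention for the [L^oo] norm when the whole space is null: then any bound holds almost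
     everywhere. *)
  exists 0; exists setT; split => //.
  by apply/eqP; rewrite eq_le measure_ge0 andbT leNgt.
(* The essential bound becomes a bound at every point. *)
pose K' x := Num.min (K x) `|Mk|.
have mK' : measurable_fun setT K' by apply: measurable_minr => //; exact: measurable_cst.
have KK' : {ae @leb3 R, forall x, K x = K' x}.
  move: KM; apply: filterS => x h; rewrite /K' min_l//.
  by apply: le_trans h (ler_norm _).
have K'0 x : 0 <= K' x by rewrite le_min K0 normr_ge0.
have K'M x : K' x <= `|Mk| by rewrite ge_min lexx orbT.
have H'n0 : ~ (H' = cst 0 %[ae @leb3 R]).
  move=> h; apply: Hn0; move: h; apply: filterS => x /= h _.
  by have /eqP := h Logic.I; rewrite normr_eq0 => /eqP.
have IH' := Lfun_integrable r1 LH.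
have H'0 x : 0 <= H' x by exact: normr_ge0.
have [ls ls0 Hls] := critical_circle s0 s1 p1 sp3 q1 qp cA mH' H'0 IH' H'n0 mK' K'0 K'M.
exists ls => // lam lam0 lamls; have [u [Du Fu crit]] := Hls lam lam0 lamls.
have mu : cmeasurable u := Du.1.1.
(* For [u] null the [H] and [K] terms vanish and the remaining term is nonnegative, against the
   negative energy. *)
have un0 : ~ (u = cst 0 %[ae @leb3 R]).
  move=> u0; move: Fu; apply/negP; rewrite -leNgt.
  have z w a : measurable_fun setT w -> 1 < a -> wpow_int (@leb3 R) w a u = 0.
    move=> mw a1; rewrite /wpow_int (ae_eq_Rintegral (g := cst 0)).
    - by rewrite /Rintegral integral0.
    - exact: measurable_wpow.
    - exact: measurable_cst.
    move: u0; apply: filterS => x /= h; rewrite /wpow.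
    have -> : u x = 0 by exact: h.
    by rewrite cmod0 powR0 ?mulr0// gt_eqF// (lt_trans ltr01 a1).
  rewrite /functional !z//; last exact: lt_trans p1 pP.
  rewrite !mulr0 !subr0 mulr_ge0 ?invr_ge0 ?(ltW (lt_trans ltr01 p1))//.
  exact: gagliardo_ge0.
(* The angles [1 / (k + 1)] are distinct and lie in [[0, pi]], where the cosine is injective, so the
   phases are distinct. *)
pose c k := cis (@harmonic R k).
have c1 k : cmod (c k) = 1 by exact: cmod_cis.
have Dc k : admissible s p A (fun x => c k * u x) by exact: admissibleM.
have Fc k : functional s p q A H' K' lam (fun x => c k * u x) < 0.
  by have [-> _] := functionalM_unit s0 p1 sp3 q1 qp mH' H'0 IH' mK' K'0 K'M lam (c1 k) Du.
exists (fun k x => c k * u x); split.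
- move=> k; split; first exact: admissible_in_D.
  move=> v /(in_D_admissible s0 p1 sp3 cA) Dv.
  rewrite Re_cintegral_gagliardo (crit (c k) (c1 k) v Dv).
  rewrite ReD ReZ !Re_cintegral_pairing.
  by rewrite (ae_eq_pairing q mH mH' (Dc k).1.1 Dv.1.1 HH')
    (ae_eq_pairing _ mK mK' (Dc k).1.1 Dv.1.1 KK').
- move=> k h; apply: un0; move: h; apply: filterS => x /= h _.
  have /eqP := h Logic.I; rewrite mulf_eq0 => /predU1P[ck0|/eqP//].
  by have := c1 k; rewrite ck0 cmod0 => /esym/eqP; rewrite oner_eq0.
- move=> k l kl h; apply: un0; move: h; apply: filterS => x /= h _.
  have /eqP := h Logic.I; rewrite -subr_eq0 -mulrBl mulf_eq0 => /predU1P[ck|/eqP//].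
  exfalso; apply: kl; move/eqP : ck; rewrite subr_eq0 => /eqP[] ccos _.
  have h01 n : (@harmonic R n) \in `[0, pi].
    rewrite in_itv /= harmonic_ge0 /=; apply: (@le_trans _ _ 1).
      by rewrite invf_le1// ler1n.
    by apply: le_trans (@pi_ge2 R); rewrite ler1n.
  have := cos_inj (h01 k) (h01 l) ccos => /= /invr_inj/eqP.
  by rewrite eqr_nat => /eqP[].
- move=> k; rewrite (energyE p1 q lam mH mH' mK mK' HH' KK' (Dc k)).
  exact: Fc.
Qed.
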